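(* Let $n\ge1$. We have the direct sum decomposition of the Sergeev superalgebra into left ideals $$\mathcal S_n=\bigoplus_{\lambda\Vdash n}\ \bigoplus_{\mathrm{sh}(\mathcal U)=\lambda}\ \bigoplus_{r=1}^{2^m}\ \mathcal S_n\,e^{(r)}_{\mathcal U},\qquad m=\Big\lfloor\frac{\ell(\lambda)}2\Big\rfloor,$$ where the second sum is over standard barred tableaux $\mathcal U$ of shape $\lambda$. Moreover, for each such $\lambda$, $\mathcal U$ and $r$, the left ideal $\mathcal S_n\,e^{(r)}_{\mathcal U}$ is isomorphic to the irreducible $\mathcal S_n$-module $U^\lambda$.
   Context: All algebras are over $\mathbb C$. The Sergeev superalgebra $\mathcal S_n=\mathbb C\mathfrak S_n^-\otimes \mathcal{C}l_n$ is the graded tensor product of: the spin symmetric group algebra $\mathbb C\mathfrak S_n^-$, generated by odd $t_1,\dots,t_{n-1}$ with $t_a^2=1$, $t_at_{a+1}t_a=t_{a+1}t_at_{a+1}$, $t_at_b=-t_bt_a$ for $|a-b|>1$; and the Clifford superalgebra $\mathcal{C}l_n$, generated by odd $c_1,\dots,c_n$ with $c_a^2=-1$, $c_ac_b=-c_bc_a$ for $a\neq b$. In particular $t_ac_b=-c_bt_a$ for all $a,b$. For $k<n$, $\mathcal S_k\subset\mathcal S_n$ is generated by $t_1,\dots,t_{k-1},c_1,\dots,c_k$. Put $s_a=\frac1{\sqrt2}t_a(c_{a+1}-c_a)$; these satisfy the Coxeter relations of the symmetric group, and together with the $c_b$ they generate $\mathcal S_n$. Modules over superalgebras are $\mathbb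 Z_2$-graded; irreducible (simple) means having no nonzero proper graded submodules, and isomorphisms are considered up to parity shift. For $a<b$ put $t_{ab}=(-1)^{b-a-1}t_{b-1}\cdots t_{a+1}t_at_{a+1}\cdots t_{b-1}$. Jucys--Murphy elements: $m_1=0$, $m_a=t_{1a}+\dots+t_{a-1,a}$ for $a\ge2$, and $x_a=\sqrt2\,m_ac_a$ for $a=1,\dots,n$. The $x_a$ commute pairwise. A strict partition $\lambda\Vdash n$ is $\lambda=(\lambda_1>\dots>\lambda_\ell>0)$ with sum $n$; $\ell(\lambda)=\ell$. Its shifted Young diagram has boxes $(i,j)$ with $1\le i\le\ell$, $i\le j\le i+\lambda_i-1$; boxes $(i,i)$ are diagonal. A standard (unbarred) tableau of shape $\lambda$ is a bijective filling of the boxes by $1,\dots,n$ with entries increasing along rows and down columns. A standard barred tableau is obtained from a standard tableau by putting bars on an arbitrary subset of the non-diagonal entries. The signed content of the entry $a$ (unbarred) or $\bar a$ (barred) of $\mathcal U$ in box $(i,j)$, with $\sigma=j-i$, is $\sqrt{\sigma(\sigma+1)}$, respectively $-\sqrt{\sigma(\sigma+1)}$; for an unbarred tableau $\mathcal T$ it is denoted $\kappa_a(\mathcal T)$. The elements $e_{\mathcal U}\in\mathcal S_n$ are defined inductively: $e_{\mathcal U}=1$ for the one-box tableau, and for $n\ge2$ $$e_{\mathcal U}=e_{\mathcal V}\,\frac{(x_n-b_1)\cdots(x_n-b_p)}{(\kappa-b_1)\cdots(\kappa-b_p)},$$ where $\mathcal V$ is obtained from $\mathcal U$ by removing the box containing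 $n$ or $\bar n$, $\kappa$ is the signed content of that entry, and $b_1,\dots,b_p$ are the signed contents of all possible entries $n$ or $\bar n$ (bars being allowed only in non-diagonal boxes) in all addable boxes of the shape $\mu$ of $\mathcal V$ (boxes whose addition to $\mu$ gives the shifted diagram of a strict partition), except for the actual entry of $\mathcal U$. Clifford idempotents: $\mathcal{C}l_{2m}\cong\mathrm{Mat}(2^{m-1}|2^{m-1})$ (for $m\ge1$) and $\mathcal{C}l_{2m+1}\cong \mathrm Q(2^m)$ as superalgebras, where $\mathrm Q(N)$ is the superalgebra of $2N\times 2N$ block matrices $\begin{pmatrix} A & B \\ B & A \end{pmatrix}$. Each contains $2^m$ pairwise orthogonal even primitive idempotents $\mathcal E_1,\dots,\mathcal E_{2^m}$ with sum $1$, corresponding to the diagonal matrix units (in $\mathrm Q(2^m)$: $B=0$ and $A$ a diagonal matrix unit). If $\mathcal U$ has shape $\lambda$ with $\ell=\ell(\lambda)$ and diagonal entries $d_1<\dots<d_\ell$, let $\mathcal E^{\mathcal U}_1,\dots,\mathcal E^{\mathcal U}_{2^m}$, $m=\lfloor\ell/2\rfloor$, be these idempotents in the subalgebra generated by $c_{d_1},\dots,c_{d_\ell}$, identified with $\mathcal{C}l_\ell$. The element $e_{\mathcal U}$ commutes with $c_{d_1},\dots,c_{d_\ell}$, and one sets $e^{(r)}_{\mathcal U}=\mathcal E^{\mathcal U}_r e_{\mathcal U}=e_{\mathcal U}\mathcal E^{\mathcal U}_r$. The simple modules (known facts): $\mathcal S_n$ is semisimple and its simple modules $U^\lambda$ are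 parameterized by $\lambda\Vdash n$, with $\dim U^\lambda=2^{\,n-\lfloor\ell(\lambda)/2\rfloor}g_\lambda$, where $g_\lambda$ is the number of standard unbarred tableaux of shape $\lambda$. Here $U^\lambda$ is the simple module such that the following $\mathcal S_n$-module $\widehat U^\lambda$ is a direct sum of $2^{\lfloor\ell(\lambda)/2\rfloor}$ copies of $U^\lambda$: $\widehat U^\lambda=\bigoplus_{\mathrm{sh}(\mathcal T)=\lambda}\mathcal{C}l_n v_{\mathcal T}$ is the free $\mathcal{C}l_n$-module on vectors $v_{\mathcal T}$ indexed by standard unbarred tableaux of shape $\lambda$, with $$s_av_{\mathcal T}=\Big(\frac1{\kappa_{a+1}(\mathcal T)-\kappa_a(\mathcal T)}+\frac{c_ac_{a+1}}{\kappa_{a+1}(\mathcal T)+\kappa_a(\mathcal T)}\Big)v_{\mathcal T}+\mathcal Y_a(\mathcal T)\,v_{s_a\mathcal T},\qquad x_av_{\mathcal T}=\kappa_a(\mathcal T)v_{\mathcal T},$$ where $s_a\mathcal T$ is obtained by swapping $a$ and $a+1$, $v_{s_a\mathcal T}=0$ if $s_a\mathcal T$ is not standard, $\mathcal Y_a(\mathcal T)=\sqrt{A(\kappa_a(\mathcal T),\kappa_{a+1}(\mathcal T))}$ and $A(u,v)=1-\frac1{(u-v)^2}-\frac1{(u+v)^2}$. *)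

(* Defs.v *)
From HB Require Import structures.
From mathcomp Require Import all_boot all_order all_algebra.
From mathcomp Require Import perm.
From mathcomp Require Import classical_sets functions reals.
From mathcomp Require Import complex.

Set Implicit Arguments.
Unset Strict Implicit.
Unset Printing Implicit Defensive.

Import Order.TTheory GRing.Theory Num.Theory.

Local Open Scope classical_set_scope.
Local Open Scope ring_scope.

(* Strict partitions, shifted diagrams and tableaux. Boxes and entries are    *)
(* numbered from 0: the box (i, j) below is (i + 1, j + 1) in the usual       *)
(* convention, and the entry a : 'I_n stands for a + 1.                       *)

Definition strict_partition_of (k : nat) (l : seq nat) : bool :=
  [&& sorted gtn l, 0%N \notin l & sumn l == k].

(* A strict partition of k has at most k parts, all of them at most k, so     *)
(* that bounded sequences make this a finType without losing any of them.     *)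
Definition spart (k : nat) :=
  {l : k.-bseq 'I_k.+1 | strict_partition_of k (map val l)}.

Definition parts k (lam : spart k) : seq nat := map val (val lam).

Definition len k (lam : spart k) : nat := size (parts lam).

Definition box (n : nat) := ('I_n * 'I_n)%type.

Definition is_diag n (b : box n) : bool := b.1 == b.2.

Definition diagram (n : nat) (l : seq nat) : {set box n} :=
  finset (fun b : box n =>
    (b.1 < size l)%N && (b.1 <= b.2 < b.1 + nth 0%N l b.1)%N).

Definition addable n (D : {set box n}) (b : box n) : bool :=
  (b \notin D) &&
  [exists nu : spart #|D|.+1, diagram n (parts nu) == (b |: D)%SET].

(* A tableau is recorded by the inverse of the filling: T a is the box that   *)
(* contains the entry a.                                                      *)
Definition standard n (l : seq nat) (T : {ffun 'I_n -> box n}) : bool :=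
  [&& injectiveb T,
      finset (fun b => b \in codom T) == diagram n l,
      [forall a, forall b,
         ((T a).1 == (T b).1) && ((T a).2 < (T b).2)%N ==> (a < b)%N] &
      [forall a, forall b,
         ((T a).2 == (T b).2) && ((T a).1 < (T b).1)%N ==> (a < b)%N]].

Definition std_tab n (lam : spart n) :=
  {T : {ffun 'I_n -> box n} | standard (parts lam) T}.

(* The second component is the set of barred entries.                         *)
Definition barred_tab n (lam : spart n) :=
  {U : std_tab lam * {set 'I_n} |
    [forall a in U.2, ~~ is_diag (val U.1 a)]}.

Definition pos n (lam : spart n) (U : barred_tab lam) : 'I_n -> box n :=
  val (val U).1.

Definition barred n (lam : spart n) (U : barred_tab lam) (a : 'I_n) : bool :=
  a \in (val U).2.

Definition diag_entry n (lam : spart n) (U : barred_tab lam) (a : 'I_n) :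
  bool := is_diag (pos U a).

Definition ideal_index (n : nat) :=
  {lam : spart n & (barred_tab lam * 'I_(2 ^ (len lam)./2))%type}.

Section Content.
Variables (R : realType) (n : nat).

(* An entry in the box b.1, barred when b.2 holds.                            *)
Definition scontent (b : box n * bool) : R :=
  let sigma := ((b.1).2 - (b.1).1)%N in
  (-1) ^+ b.2 * Num.sqrt (sigma * sigma.+1)%N%:R.

Definition kappa (T : 'I_n -> box n) (a : 'I_n) : R := scontent (T a, false).

End Content.

Section Algebra.
Variable C : fieldType.

Definition subspace (V : lmodType C) (X : set V) : Prop :=
  X 0 /\ forall (k : C) u v, X u -> X v -> X (k *: u + v).

Definition subalgebra (A : algType C) (X : set A) : Prop :=
  [/\ subspace X, X 1 & forall a b, X a -> X b -> X (a * b)].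

(* The component of parity i (true is odd) when the generators g are odd.     *)
Definition parity_part (A : algType C) (I : Type) (g : I -> A) (i : bool) :
    set A :=
  smallest (@subspace A)
    [set a | exists w : seq I, odd (size w) = i /\ a = \prod_(k <- w) g k].

(* g makes A the algebra presented by generators indexed by I and relations   *)
(* rels.                                                                      *)
Definition presented (I : Type)
    (rels : forall B : algType C, (I -> B) -> Prop)
    (A : algType C) (g : I -> A) : Prop :=
  rels A g /\
  forall (B : algType C) (h : I -> B), rels B h ->
    exists f : {lrmorphism A -> B}, (forall i, f (g i) = h i) /\
      forall f' : {lrmorphism A -> B}, (forall i, f' (g i) = h i) -> f' =1 f.

Definition spin_rels n (B : algType C) (t : 'I_n.-1 -> B) : Prop :=
  [/\ forall a, t a ^+ 2 = 1,
      forall a b : 'I_n.-1, b = a.+1 :> nat -> t a * t b * t a = t b * t a * t b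
    & forall a b : 'I_n.-1, (a.+1 < b)%N || (b.+1 < a)%N ->
        t a * t b = - (t b * t a)].

Definition clifford_rels n (B : algType C) (c : 'I_n -> B) : Prop :=
  (forall a, c a ^+ 2 = -1) /\
  (forall a b, a != b -> c a * c b = - (c b * c a)).

(* A is the graded tensor product of the superalgebras T and K, generated by  *)
(* odd t and c: (1 (x) b) (a (x) 1) = (-1)^(|a||b|) a (x) b, and the bilinear *)
(* map (a, b) |-> a (x) b is universal.                                       *)
Definition graded_tensor (I J : Type) (T K A : algType C)
    (t : I -> T) (c : J -> K)
    (iT : {lrmorphism T -> A}) (iK : {lrmorphism K -> A}) : Prop :=
  (forall (i j : bool) a b, parity_part t i a -> parity_part c j b ->
     iK b * iT a = (-1) ^+ (i && j) * (iT a * iK b)) /\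
  (forall (W : lmodType C) (beta : T -> K -> W),
     (forall a, linear (beta a)) -> (forall b, linear (beta^~ b)) ->
     exists h : {linear A -> W}, (forall a b, h (iT a * iK b) = beta a b) /\
       forall h' : {linear A -> W},
         (forall a b, h' (iT a * iK b) = beta a b) -> h' =1 h).

Definition sergeev_algebra n (A : algType C)
    (t : 'I_n.-1 -> A) (c : 'I_n -> A) : Prop :=
  exists (T K : algType C) (t0 : 'I_n.-1 -> T) (c0 : 'I_n -> K)
    (iT : {lrmorphism T -> A}) (iK : {lrmorphism K -> A}),
    [/\ presented (@spin_rels n) t0, presented (@clifford_rels n) c0,
        graded_tensor t0 c0 iT iK, t =1 iT \o t0 & c =1 iK \o c0].

End Algebra.

(* V is the direct sum of the subsets X i (subgroups, in all uses below).     *)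
Definition direct_sum (V : zmodType) (I : finType) (X : I -> set V) : Prop :=
  forall v, exists! f : {ffun I -> V}, (forall i, X i (f i)) /\ v = \sum_i f i.

Section Supermodules.
Variables (C : fieldType) (A : algType C) (gA : bool -> set A).

Definition supermodule (V : lmodType A) (gV : bool -> set V) : Prop :=
  [/\ forall i, gV i 0 /\
        forall (k : C) u v, gV i u -> gV i v -> gV i (k%:A *: u + v),
      direct_sum gV &
      forall i j a v, gA i a -> gV j v -> gV (i (+) j) (a *: v)].

Definition graded_submodule (V : lmodType A) (gV : bool -> set V)
    (X : set V) : Prop :=
  [/\ X 0, forall a u v, X u -> X v -> X (a *: u + v) &
      forall v, X v -> exists v0 v1,
        [/\ X v0, gV false v0, X v1, gV true v1 & v = v0 + v1]].

Definition simple_supermodule (V : lmodType A) (gV : bool -> set V) : Prop :=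
  [/\ supermodule gV, exists v : V, v != 0 &
      forall X : set V, graded_submodule gV X -> X = [set 0] \/ X = setT].

(* The graded submodules X of V and Y of W are isomorphic up to parity shift: *)
(* p tells whether the isomorphism preserves or exchanges the parities.       *)
Definition super_isomorphic (V W : lmodType A)
    (gV : bool -> set V) (gW : bool -> set W)
    (X : set V) (Y : set W) : Prop :=
  exists (f : V -> W) (p : bool),
    [/\ forall a u v, X u -> X v -> f (a *: u + v) = a *: f u + f v,
        set_bij X Y f &
        forall i v, X v -> gV i v -> gW (i (+) p) (f v)].

Definition left_ideal (e : A) : set A^o := [set a * e | a in setT].

End Supermodules.

Section Sergeev.
Variables (R : realType) (n : nat) (A : algType R[i]).
Variables (t : 'I_n.-1 -> A) (c : 'I_n -> A).

Definition gA : bool -> set A :=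
  parity_part (fun g : 'I_n.-1 + 'I_n =>
                 match g with inl a => t a | inr b => c b end).

(* The indices of a and a + 1 among the n letters.                            *)
Definition lo (a : 'I_n.-1) : 'I_n := widen_ord (leq_pred n) a.
Lemma hi_subproof (a : 'I_n.-1) : (a.+1 < n)%N.
Proof. by rewrite -ltn_predRL. Qed.
Definition hi (a : 'I_n.-1) : 'I_n := Ordinal (hi_subproof a).

Definition sqrt2 : R[i] := (Num.sqrt 2)%:C%C.

Definition cox (a : 'I_n.-1) : A := sqrt2^-1 *: (t a * (c (hi a) - c (lo a))).

(* The first product is t_(b-1) ... t_(a+1) t_a, by decreasing index.         *)
Definition t_pair (a b : 'I_n) : A :=
  (-1) ^+ (b - a.+1) *
  \prod_(i < n.-1 | (a <= rev_ord i < b)%N) t (rev_ord i) *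
  \prod_(i < n.-1 | (a < i < b)%N) t i.

Definition jm (b : 'I_n) : A := \sum_(a < n | (a < b)%N) t_pair a b.

Definition x_jm (a : 'I_n) : A := sqrt2 *: (jm a * c a).

(* The possible entries at the step where the entry k is added: q.1 is the    *)
(* box and q.2 tells whether the entry is barred.                             *)
Definition possible (D : {set box n}) (q : box n * bool) : bool :=
  addable D q.1 && (q.2 ==> ~~ is_diag q.1).

Definition e_step (lam : spart n) (U : barred_tab lam) (k : 'I_n) : A :=
  let D := finset (fun b => [exists a : 'I_n, (a < k)%N && (pos U a == b)]) in
  let q0 := (pos U k, barred U k) in
  \prod_(q | possible D q && (q != q0))
     (((scontent R q0 - scontent R q)^-1)%:C%C *:
       (x_jm k - (scontent R q)%:C%C%:A)).

(* The inductive definition unrolled: the factors are multiplied in the order *)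
(* k = 0, 1, ..., n - 1, and the one for k = 0 is the empty product.          *)
Definition e_tab (lam : spart n) (U : barred_tab lam) : A :=
  \prod_(k < n) e_step U k.

(* Isomorphism of a graded subalgebra B of A onto a subalgebra D of a matrix  *)
(* algebra whose homogeneous parts are cut out by gD.                         *)
Definition superalgebra_iso N (B : set A) (D : set 'M[R[i]]_N)
    (gD : bool -> set 'M[R[i]]_N) (phi : A -> 'M[R[i]]_N) : Prop :=
  [/\ forall (k : R[i]) a b, B a -> B b ->
        phi (k *: a + b) = k *: phi a + phi b,
      forall a b, B a -> B b -> phi (a * b) = phi a *m phi b,
      phi 1 = 1%:M,
      set_bij B D phi &
      forall i a, B a -> gA i a -> gD i (phi a)].

(* Mat(p | p), as matrices of size N = 2p.                                    *)
Definition mat_part N (i : bool) : set 'M[R[i]]_N :=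
  [set M | forall y z : 'I_N,
     (y < N./2)%N (+) (z < N./2)%N != i -> M y z = 0].

Definition Q_mat N : set 'M[R[i]]_(N + N) :=
  [set M | exists M0 M1, M = block_mx M0 M1 M1 M0].

Definition Q_part N (i : bool) : set 'M[R[i]]_(N + N) :=
  [set M | exists M0, M = if i then block_mx 0 M0 M0 0 else block_mx M0 0 0 M0].

Definition clifford_subalgebra (P : pred 'I_n) : set A :=
  smallest (@subalgebra _ A) [set a | exists d, P d /\ a = c d].

(* E lists the elements that correspond to the diagonal matrix units under    *)
(* some isomorphism of the Clifford subalgebra on the diagonal entries of U   *)
(* with Mat(2^(m-1) | 2^(m-1)) or Q(2^m).                                     *)
Definition clifford_idempotents (lam : spart n) (U : barred_tab lam)
    (E : 'I_(2 ^ (len lam)./2) -> A) : Prop :=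
  let N := (2 ^ (len lam)./2)%N in
  let B := clifford_subalgebra (diag_entry U) in
  (forall r, B (E r)) /\
  if odd (len lam) then
    exists phi, superalgebra_iso B (@Q_mat N) (@Q_part N) phi /\
      forall r, phi (E r) = block_mx (delta_mx r r) 0 0 (delta_mx r r)
  else
    exists phi, superalgebra_iso B setT (@mat_part N) phi /\
      forall r, phi (E r) = delta_mx r r.

Definition swap_entries (T : {ffun 'I_n -> box n}) (a : 'I_n.-1) :
    {ffun 'I_n -> box n} :=
  [ffun k => T (tperm (lo a) (hi a) k)].

Definition A_coef (u v : R) : R :=
  1 - ((u - v) ^+ 2)^-1 - ((u + v) ^+ 2)^-1.

Definition Y_coef (T : {ffun 'I_n -> box n}) (a : 'I_n.-1) : R :=
  Num.sqrt (A_coef (kappa R T (lo a)) (kappa R T (hi a))).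

(* The module \hat U^lambda; making the v_T even determines its grading.      *)
Definition is_Uhat (lam : spart n) (W : lmodType A) (gW : bool -> set W)
    (v : std_tab lam -> W) : Prop :=
  [/\ supermodule gA gW,
      forall T, gW false (v T),
      forall w, exists! y : {ffun std_tab lam -> A},
        (forall T, clifford_subalgebra predT (y T)) /\
        w = \sum_T y T *: v T,
      forall (T : std_tab lam) (a : 'I_n.-1),
        let u := kappa R (val T) (lo a) in
        let u' := kappa R (val T) (hi a) in
        cox a *: v T =
          (((u' - u)^-1)%:C%C%:A +
             ((u' + u)^-1)%:C%C *: (c (lo a) * c (hi a))) *: v T +
          (Y_coef (val T) a)%:C%C%:A *:
            oapp v 0 (insub (swap_entries (val T) a)) &
      forall (T : std_tab lam) (a : 'I_n),
        x_jm a *: v T = (kappa R (val T) a)%:C%C%:A *: v T].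

Definition is_U (lam : spart n) (U : lmodType A) (gU : bool -> set U) : Prop :=
  simple_supermodule gA gU /\
  exists (W : lmodType A) (gW : bool -> set W) (v : std_tab lam -> W),
    is_Uhat gW v /\
    exists X : 'I_(2 ^ (len lam)./2) -> set W,
      [/\ forall r, graded_submodule gW (X r), direct_sum X &
          forall r, super_isomorphic gW gU (X r) setT].

End Sergeev.

(* Main.v *)
From HB Require Import structures.
Require Import Defs.
From mathcomp Require Import all_boot all_order all_algebra.
From mathcomp Require Import perm.
From mathcomp Require Import boolp reals complex.
From mathcomp Require Import ring lra zify.

Set Implicit Arguments.
Unset Strict Implicit.
Unset Printing Implicit Defensive.

Import Order.TTheory GRing.Theory Num.Theory.

(** Everything is read off the modules hat U^lambda. The element x_a anticommutes with c_a and
    commutes with the other c_b, so in the basis c_S v_T of hat U^lambda all x_a are diagonal, with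
    eigenvalue kappa_a(T) up to a sign that is negative exactly when a lies in S. These eigenvalues
    are the signed contents of the tableau T barred at the non-diagonal entries in S. Since e_U is
    an interpolation polynomial in the x_a, it acts as the projection onto the span of the c_S v_T
    that belong to U ([e_of_weight], [e_of_cliff_mon]).

    To turn this into identities of the algebra, S_n is shown to act faithfully on the sum of the
    hat U^lambda. The n! 2^n products of a spin word and a Clifford monomial span S_n
    ([sergeev_span]). For U with tableau T and bars S put w_U = c_S v_T ([wvec]), and let psi be an
    element that maps w_U to v_(T'). The elements c_S psi e_U, indexed by a set S and a pair (T', U)
    of tableaux of the same shape, are independent because they act independently on the w_U. There
    are at least n! such pairs ([tableau_pairs_count]), by an up-down argument on strict partitions
    ([wt_balance], [cnt_up]). Hence these elements form a basis, and an element that kills every w_U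
    is 0 ([sergeev_faithful]). It follows that the e_U are orthogonal idempotents with sum 1, that
    they commute with the c_d for diagonal entries d, and that x |-> x w_U is injective on S_n e_U
    ([wvec_ann]). Multiplying by the Clifford idempotents E_r gives the direct sum.

    For irreducibility let B be the Clifford subalgebra on the diagonal entries of U. The vectors of
    weight U are B w_U, so e_U S_n e_U = B e_U ([corner]). By the structure of Mat and Q, a nonzero
    homogeneous y = y E_r of B can be brought to E_r by left multiplication
    ([clifford_idempotentsP]). So a nonzero graded submodule of S_n E_r e_U contains E_r e_U
    ([ideal_simple]), and S_n E_r e_U is isomorphic to every simple module on which E_r e_U does not
    vanish ([simple_generator]). It does not vanish on U^lambda, because hat U^lambda is a sum of
    copies of U^lambda and contains nonzero vectors fixed by E_r e_U ([is_U_nonzero]).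

    The modules hat U^lambda have to be constructed as well ([model_exists]). The s_a act on
    functions from tableaux to the Clifford algebra; their braid relation ([sop_braid]) amounts to
    Yang--Baxter identities in a quaternion algebra, and the eigenvalues of the x_a follow from the
    recursion [x_jm_rec]. A grading and the module U^lambda itself are then obtained inside S_n,
    from S_n e_U for an unbarred U ([Uhat_exists], [fixed_ideal_is_U]). *)

(** * Shifted Young diagrams as order ideals of boxes *)

Section Ideals.
Variable n : nat.
Implicit Types (b : box n) (D : {set box n}).

Definition box_le b b' := (b.1 <= b'.1) && (b.2 <= b'.2).

(* Shifted diagrams are the finite order ideals of {(i, j) | i <= j}. *)
Definition ideal D := [forall b in D, (b.1 <= b.2) &&
  [forall b' : box n, (b'.1 <= b'.2) && box_le b' b ==> (b' \in D)]].

Lemma idealP D : reflect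
  (forall b, b \in D -> (b.1 <= b.2) /\
     forall b', (b'.1 <= b'.2) -> box_le b' b -> b' \in D) (ideal D).
Proof.
apply: (iffP forall_inP) => h b bD.
  have /andP[-> /forallP h'] := h b bD; split=> // b' h1 h2.
  by have := h' b'; rewrite h1 h2.
have [-> h'] := h b bD; apply/forallP => b'; apply/implyP => /andP[]; exact: h'.
Qed.

Lemma ideal_oct D b : ideal D -> b \in D -> (b.1 <= b.2).
Proof. by move=> /idealP h /h[]. Qed.

Lemma ideal_le D b b' : ideal D -> b \in D -> (b'.1 <= b'.2) -> box_le b' b -> b' \in D.
Proof. by move=> /idealP h /h[_]; apply. Qed.

Lemma box_lexx b : box_le b b. Proof. by rewrite /box_le !leqnn. Qed.

Lemma box_le_anti b b' : box_le b b' -> box_le b' b -> b = b'.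
Proof.
case: b b' => [i j] [i' j'] /andP[/= h1 h2] /andP[/= h3 h4].
by congr pair; apply/val_inj/eqP; rewrite eqn_leq ?h1 ?h2.
Qed.

Lemma idealI D D' : ideal D -> ideal D' -> ideal (D :&: D').
Proof.
move=> iD iD'; apply/idealP => b; rewrite in_setI => /andP[bD bD'].
split; first exact: ideal_oct bD.
by move=> b' h1 h2; rewrite in_setI (ideal_le iD bD) // (ideal_le iD' bD').
Qed.

Lemma idealU D D' : ideal D -> ideal D' -> ideal (D :|: D').
Proof.
move=> iD iD'; apply/idealP => b; rewrite in_setU => /orP[bD|bD].
  split; first exact: ideal_oct bD.
  by move=> b' h1 h2; rewrite in_setU (ideal_le iD bD).
split; first exact: ideal_oct bD.
by move=> b' h1 h2; rewrite in_setU (ideal_le iD' bD) // orbT.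
Qed.

Lemma ideal0 : ideal set0.
Proof. by apply/idealP => b; rewrite in_set0. Qed.

Lemma sum_ord_ival i j : (j <= n) ->
  \sum_(x < n | (i <= x < j)) 1 = (j - i).
Proof.
move=> jn; rewrite -[RHS]muln1 -sum_nat_const_nat (big_nat_widen i j n) //.
rewrite -(big_mkord (fun x => i <= x < j) (fun=> 1)).
case: (leqP i n) => [ni|ni]; last first.
  rewrite [RHS]big_geq; last exact: ltnW.
  rewrite big_nat_cond big1 // => x; lia.
rewrite (big_cat_nat _ ni) //= big_nat_cond big_pred0 ?add0n; last first.
  by move=> x; apply/negP; lia.
rewrite [LHS]big_nat_cond [RHS]big_nat_cond; apply: eq_bigl => x; lia.
Qed.

(** The row index is a natural number rather than an ordinal: rows from [n] on are empty, so
    [row_len D i.+1] makes sense for every [i]. *)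
Definition row_len D i := #|[set b in D | val b.1 == i]|.

Lemma row_lenE D (i : 'I_n) : row_len D i = \sum_(j < n | (i, j) \in D) 1.
Proof.
rewrite /row_len -sum1_card (reindex_onto (fun j : 'I_n => (i, j)) snd) /=.
  by apply: eq_bigl => j; rewrite !inE /= !eqxx !andbT.
by case=> i' j; rewrite inE => /andP[_ /= /eqP/val_inj ->].
Qed.

(** A row of an ideal is an initial segment of the columns from the diagonal on, so counting decides
    membership: a box forces all boxes to its left, and a missing box excludes all boxes to its
    right. *)
Lemma in_ideal D b : ideal D ->
  (b \in D) = (b.1 <= b.2 < b.1 + row_len D b.1).
Proof.
case: b => i j iD /=; apply/idP/idP => [bD|/andP[ij]].
  have ij : (i <= j) := ideal_oct iD bD.
  rewrite ij row_lenE -ltn_subLR // /= -subSn //.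
  rewrite -(@sum_ord_ival i j.+1) //.
  rewrite [X in (X <= _)]big_mkcond [X in (_ <= X)]big_mkcond.
  apply: leq_sum => x _; case: ifP => // /andP[h1 h2].
  by rewrite (ideal_le iD bD) //; rewrite /box_le /= leqnn.
apply: contraTT => bD; rewrite -leqNgt -leq_subRL // row_lenE.
rewrite -(@sum_ord_ival i j); last exact: ltnW.
rewrite [X in (X <= _)]big_mkcond [X in (_ <= X)]big_mkcond.
apply: leq_sum => x _; case: ifP => // xD.
rewrite (ideal_oct iD xD) /= ifT // ltnNge; apply: contra bD => jx.
by apply: (ideal_le iD xD); rewrite /box_le //= leqnn.
Qed.

Lemma row_len_gt0 D i : 0 < row_len D i -> i < n.
Proof.
rewrite card_gt0 => /set0Pn[[i1 j]]; rewrite inE /= => /andP[_ /eqP <-].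
exact: ltn_ord.
Qed.

Lemma row_len_fits D (i : 'I_n) : ideal D -> i + row_len D i <= n.
Proof.
move=> iD; rewrite leqNgt; apply/negP => h.
have rn (x : 'I_n) : ((i, x) \in D) = (i <= x < n).
  by rewrite in_ideal //=; have := ltn_ord x; lia.
by have := ltn_ord i; have := row_lenE D i; rewrite (eq_bigl _ _ rn) sum_ord_ival //; lia.
Qed.

(** The last box of row [i.+1] has a box of [D] above it, and row [i] starts one column earlier. *)
Lemma row_len_dec D i : ideal D -> 0 < row_len D i.+1 ->
  row_len D i.+1 < row_len D i.
Proof.
move=> iD r0; have i1n := row_len_gt0 r0.
pose i1 := Ordinal i1n; have r1 : i.+1 + row_len D i.+1 <= n := @row_len_fits D i1 iD.
have xn : i.+1 + row_len D i.+1 - 1 < n by clear -r1 r0; lia.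
pose x := Ordinal xn.
have xD : (i1, x) \in D by rewrite in_ideal //=; lia.
have : (Ordinal (ltnW i1n), x) \in D.
  by apply: (ideal_le iD xD); rewrite /box_le /=; lia.
by rewrite in_ideal //=; lia.
Qed.

Lemma card_row_len D : #|D| = \sum_(i < n) row_len D i.
Proof.
rewrite -sum1_card; under [RHS]eq_bigr => i _ do rewrite row_lenE.
by rewrite pair_big_dep /=; apply: eq_bigl => -[i j].
Qed.

Definition strict (l : seq nat) := sorted gtn l && (0 \notin l).

Lemma strict_gt0 l i : strict l -> (0 < nth 0 l i) = (i < size l).
Proof.
move=> /andP[_ l0]; case: (ltnP i (size l)) => [il|il]; last by rewrite nth_default.
by rewrite lt0n; apply: contraNneq l0 => <-; apply: mem_nth.
Qed.

Lemma strict_step l i : strict l -> 0 < nth 0 l i.+1 -> nth 0 l i.+1 < nth 0 l i.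
Proof.
move=> sl; rewrite strict_gt0 // => il; case/andP: sl => sl _.
by have /(sortedP 0)/(_ i il) := sl.
Qed.

Lemma strict_antitone l i k : strict l -> 0 < nth 0 l (i + k) ->
  nth 0 l (i + k) + k <= nth 0 l i.
Proof.
move=> sl; elim: k => [|k IH]; first by rewrite !addn0.
rewrite addnS => h; have := strict_step sl h; lia.
Qed.

Lemma in_diagram l b :
  (b \in diagram n l) = (b.1 <= b.2 < b.1 + nth 0 l b.1).
Proof.
by rewrite inE; case: ltnP => //= il; rewrite nth_default //; lia.
Qed.

Lemma diagram_ideal l : strict l -> ideal (diagram n l).
Proof.
move=> sl; apply/idealP => b; rewrite in_diagram => /andP[h1 h2]; split=> // b' h3.
move=> /andP[h4 h5]; rewrite in_diagram h3 /=.
have := @strict_antitone l b'.1 (b.1 - b'.1) sl; rewrite subnKC //; lia.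
Qed.

Lemma strict_fits m l i : strict_partition_of m l -> i < size l ->
  i + nth 0 l i <= m.
Proof.
move=> /and3P[s1 s2 /eqP <-] il; have sl : strict l by apply/andP.
have := @strict_antitone l 0 i sl; rewrite add0n strict_gt0 // => /(_ il).
move: il; case: (l) => //= a l' il; lia.
Qed.

Lemma strict_partition_strict m l : strict_partition_of m l -> strict l.
Proof. by move=> /and3P[s1 s2 _]; apply/andP. Qed.

(** The bound [m <= n] guarantees that the n by n grid cuts off no box. *)
Lemma row_len_diagram m l i : m <= n -> strict_partition_of m l ->
  row_len (diagram n l) i = nth 0 l i.
Proof.
move=> mn sl; have ss := strict_partition_strict sl.
have [il|il] := ltnP i (size l); last first.
  rewrite (nth_default _ il); apply/eqP; rewrite cards_eq0; apply/eqP/setP => b.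
  rewrite !inE; apply/negP => /andP[/andP[h _] /eqP h']; move: h; rewrite h'; lia.
have fi := strict_fits sl il; have r0 := strict_gt0 i ss; rewrite il in r0.
have iN : i < n by lia.
have -> : row_len (diagram n l) i = row_len (diagram n l) (Ordinal iN) by [].
rewrite row_lenE.
rewrite (eq_bigl (fun j : 'I_n => i <= j < i + nth 0 l i)); last first.
  by move=> j; rewrite in_diagram.
by rewrite sum_ord_ival; lia.
Qed.

Lemma card_diagram m l : m <= n -> strict_partition_of m l -> #|diagram n l| = m.
Proof.
move=> mn sl; rewrite card_row_len.
under eq_bigr => i _ do rewrite (row_len_diagram _ mn sl).
have ss := strict_partition_strict sl.
have sn : size l <= n.
  case: (posnP (size l)) => [-> //|s0].
  have := @strict_fits m l (size l).-1 sl; rewrite prednK // => /(_ (leqnn _)).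
  have := strict_gt0 (size l).-1 ss; rewrite prednK // leqnn; lia.
rewrite -(big_mkord xpredT (fun i => nth 0 l i)) (big_cat_nat (leq0n _) sn) /=.
rewrite [X in _ + X]big_nat_cond [X in _ + X]big1 ?addn0; last first.
  by move=> i /andP[/andP[h _] _]; apply: nth_default.
by rewrite -(big_nth 0 xpredT id) -sumnE; case/and3P: sl => _ _ /eqP.
Qed.

Lemma diagram_inj m l l' : m <= n ->
  strict_partition_of m l -> strict_partition_of m l' ->
  diagram n l = diagram n l' -> l = l'.
Proof.
move=> mn sl sl' E.
have nE i : nth 0 l i = nth 0 l' i.
  by rewrite -(row_len_diagram _ mn sl) -(row_len_diagram _ mn sl') E.
have g i : (i < size l) = (i < size l').
  by rewrite -!strict_gt0 ?nE //; apply: strict_partition_strict; eassumption.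
apply: (@eq_from_nth _ 0) => //.
by apply/eqP; rewrite eqn_leq leqNgt g ltnn leqNgt -g ltnn.
Qed.

(** Row lengths strictly decrease while they are positive, so the lengths of the rows above the
    first empty one form the partition. *)
Lemma ideal_parts D : ideal D ->
  exists l, strict_partition_of #|D| l /\ diagram n l = D.
Proof.
move=> iD.
have ex0 : exists i, row_len D i == 0.
  exists n; rewrite -leqn0 leqNgt; apply/negP => /row_len_gt0; rewrite ltnn //.
pose m := ex_minn ex0.
have mP : row_len D m = 0 /\ forall i, i < m -> 0 < row_len D i.
  rewrite /m; case: ex_minnP => k /eqP k0 kmin; split=> // i ik.
  by rewrite lt0n; apply/negP => /kmin; rewrite leqNgt ik.
have mP' i : m <= i -> row_len D i = 0.
  elim: i => [|i IH] mi; first by move: mP mi; case: (m) => // -[].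
  case: (posnP (row_len D i.+1)) => // r0.
  have r1 := row_len_dec iD r0; have [mi'|mi'] := leqP m i.
    by move: r1; rewrite IH.
  by have -> : i.+1 = m; [lia | case: mP].
pose l := mkseq (row_len D) m.
have nE i : nth 0 l i = row_len D i.
  have [im|im] := ltnP i m; first by rewrite nth_mkseq.
  by rewrite nth_default ?size_mkseq // mP'.
have ss : strict l.
  apply/andP; split.
    apply/(sortedP 0) => i; rewrite size_mkseq => im; rewrite !nE.
    by apply: row_len_dec => //; apply: (proj2 mP).
  apply/negP => h; have [j] := nthP 0 h; rewrite size_mkseq nE => im E.
  by have := (proj2 mP) j im; rewrite E.
have dE : diagram n l = D.
  by apply/setP => b; rewrite in_diagram nE in_ideal.
have sl : strict_partition_of (sumn l) l by case/andP: ss => s1 s2; apply/and3P.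
exists l; split=> //; suff <- : sumn l = #|D| by [].
rewrite card_row_len sumnE (big_nth 0) size_mkseq.
have mn : m <= n.
  by rewrite leqNgt; apply/negP => /(proj2 mP) /row_len_gt0; rewrite ltnn.
rewrite -(big_mkord xpredT (row_len D)) (big_cat_nat (leq0n _) mn) /=.
rewrite [X in _ = _ + X]big_nat_cond [X in _ = _ + X]big1 ?addn0; last first.
  by move=> i /andP[/andP[h _] _]; apply: mP'.
by apply: eq_bigr => i _; rewrite nE.
Qed.

End Ideals.

(** * Strict partitions and addable boxes *)

Section Parts.

Lemma strict_partition_spart k l : strict_partition_of k l ->
  exists nu : spart k, parts nu = l.
Proof.
move=> sl; have ss := strict_partition_strict sl.
have [s1 s2 /eqP sk] := and3P sl.
have sz : size l <= k.
  case: (posnP (size l)) => [-> //|s0].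
  have := @strict_fits k l (size l).-1 sl; rewrite prednK // => /(_ (leqnn _)).
  have := strict_gt0 (size l).-1 ss; rewrite prednK // leqnn; lia.
have bd x : x \in l -> x <= k.
  move=> xl; have [j jl <-] := nthP 0 xl.
  exact: leq_trans (leq_addl _ _) (strict_fits sl jl).
have E : map val (map (@inord k) l) = l.
  rewrite -map_comp -[RHS]map_id; apply/eq_in_map => x xl /=.
  by rewrite inordK // ltnS bd.
have sz' : size (map (@inord k) l) <= k by rewrite size_map.
have P : strict_partition_of k (map val (val (Bseq sz'))) by rewrite /= E.
by exists (exist _ (Bseq sz') P); rewrite /parts /= E.
Qed.

Lemma partsP k (lam : spart k) : strict_partition_of k (parts lam).
Proof. by case: lam. Qed.

Lemma parts_inj k : injective (@parts k).
Proof.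
move=> lam mu E; apply/val_inj/val_inj.
exact: (inj_map val_inj E).
Qed.

Variable n : nat.

(** This replaces the search for a partition in [addable] by a local condition: by [ideal_parts], an
    ideal with [#|D|.+1] boxes is the diagram of a strict partition of that size. *)
Lemma addableE (D : {set box n}) b :
  addable D b = (b \notin D) && ideal (b |: D).
Proof.
rewrite /addable; case: (boolP (b \in D)) => //= bD.
have cD : #|b |: D| = #|D|.+1 by rewrite cardsU1 bD.
apply/existsP/idP => [[nu /eqP <-]|iD].
  exact: diagram_ideal (strict_partition_strict (partsP nu)).
have [l [sl dE]] := ideal_parts iD; rewrite cD in sl.
by have [nu E] := strict_partition_spart sl; exists nu; rewrite E dE.
Qed.

(** Two boxes on the same diagonal are comparable, so adding the larger one to [D] without the
    smaller would not give an ideal. This is what makes the denominators in e_U nonzero. *)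
Lemma addable_inj (D : {set box n}) b b' : addable D b -> addable D b' ->
  b.2 - b.1 = b'.2 - b'.1 -> b = b'.
Proof.
rewrite !addableE => /andP[bD iD] /andP[bD' iD'] E.
wlog le : b b' bD iD bD' iD' E / b.1 <= b'.1 => [H|].
  by case: (leqP b.1 b'.1) => [|/ltnW] le; [|apply/esym]; apply: H.
have o := ideal_oct iD (setU11 b D); have o' := ideal_oct iD' (setU11 b' D).
have: b \in b' |: D.
  by apply: (ideal_le iD' (setU11 b' D) o); rewrite /box_le le; lia.
by rewrite in_setU1 (negbTE bD) orbF => /eqP.
Qed.

End Parts.

(** * Standard tableaux as linear extensions of the box order *)

Section Tableaux.
Variable n : nat.
Implicit Types (b : box n) (D : {set box n}).

(** Monotonicity for the box order replaces the separate row and column conditions of [standard]; it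
    is the form in which prefixes are seen to be ideals. *)
Definition tableau (T : 'I_n -> box n) D :=
  [/\ injective T, ideal D, forall b, (b \in D) = [exists a, T a == b]
    & forall a a', box_le (T a) (T a') -> a <= a'].

Definition prefix_set (T : 'I_n -> box n) (k : nat) : {set box n} :=
  [set b | [exists a : 'I_n, (a < k) && (T a == b)]].

Lemma standardP l (T : {ffun 'I_n -> box n}) : strict l ->
  standard l T <-> tableau T (diagram n l).
Proof.
move=> sl; have iD := diagram_ideal n sl; split.
  move=> /and4P[/injectiveP Ti /eqP cT /forallP rT /forallP kT].
  have inD b : (b \in diagram n l) = [exists a, T a == b].
    rewrite -cT inE; apply/codomP/existsP => -[a] E; exists a; first by rewrite E.
    by rewrite (eqP E).
  split=> // a a'.
  rewrite /box_le; case Ta: (T a) => [i j]; case Ta': (T a') => [i' j'].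
  move=> /andP[/= ii jj].
  have aD : (i, j) \in diagram n l by rewrite inD; apply/existsP; exists a; rewrite Ta.
  have aD' : (i', j') \in diagram n l by rewrite inD; apply/existsP; exists a'; rewrite Ta'.
  have oj := ideal_oct iD aD; have oj' := ideal_oct iD aD'; rewrite /= in oj oj'.
  (* The corner (i, j') is in the row of the first box and in the column of the second, so its entry
     [x] satisfies a <= x <= a'. *)
  have : (i, j') \in diagram n l.
    by apply: (ideal_le iD aD'); rewrite /box_le /= ?ii ?leqnn //; exact: leq_trans jj.
  rewrite inD => /existsP[x /eqP xE]; apply: (@leq_trans x).
    have [/val_inj jE|jn] := eqVneq (val j) (val j').
      by rewrite (_ : a = x) //; apply: Ti; rewrite Ta xE jE.
    have /forallP/(_ x) := rT a; rewrite Ta xE /= eqxx ltn_neqAle jn jj /=.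
    by move=> /ltnW.
  have [/val_inj iE|jn] := eqVneq (val i) (val i').
    by rewrite (_ : a' = x) //; apply: Ti; rewrite Ta' xE iE.
  have /forallP/(_ a') := kT x; rewrite Ta' xE /= eqxx ltn_neqAle jn ii /=.
  by move=> /ltnW.
move=> [Ti _ inD mT]; apply/and4P; split.
- exact/injectiveP.
- apply/eqP/setP => b; rewrite inE inD; apply/codomP/existsP => -[a] E; exists a.
    by rewrite E.
  by rewrite (eqP E).
- apply/forallP => a; apply/forallP => a'; apply/implyP => /andP[/eqP e1 e2].
  rewrite ltn_neqAle mT ?andbT; last by rewrite /box_le e1 leqnn ltnW.
  by apply: contraTneq e2 => /val_inj ->; rewrite ltnn.
- apply/forallP => a; apply/forallP => a'; apply/implyP => /andP[/eqP e1 e2].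
  rewrite ltn_neqAle mT ?andbT; last by rewrite /box_le e1 leqnn ltnW.
  by apply: contraTneq e2 => /val_inj ->; rewrite ltnn.
Qed.

Lemma tableau_mem T D a : tableau T D -> T a \in D.
Proof. by case=> _ _ -> _; apply/existsP; exists a. Qed.

Lemma tableau_prefix T D k : tableau T D -> ideal (prefix_set T k).
Proof.
move=> tT; have [Ti iD inD mT] := tT.
apply/idealP => b; rewrite inE => /existsP[a /andP[ak /eqP <-]]; split.
  exact: ideal_oct (tableau_mem a tT).
move=> b' o le; have := ideal_le iD (tableau_mem a tT) o le.
rewrite inD => /existsP[x /eqP xE]; rewrite inE; apply/existsP; exists x.
by rewrite xE eqxx andbT; apply: leq_ltn_trans ak; apply: mT; rewrite xE.
Qed.

Lemma prefix_tableau T D : injective T ->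
  (forall b, (b \in D) = [exists a, T a == b]) ->
  (forall k, k <= n -> ideal (prefix_set T k)) -> tableau T D.
Proof.
move=> Ti inD pT; split=> //.
  rewrite (_ : D = prefix_set T n) ?pT //; apply/setP => b; rewrite inD inE.
  by apply: eq_existsb => a; rewrite ltn_ord.
move=> a a' le.
have a'P : T a' \in prefix_set T a'.+1 by rewrite inE; apply/existsP; exists a'; rewrite ltnSn eqxx.
have o : (T a).1 <= (T a).2.
  apply: (ideal_oct (pT a.+1 (ltn_ord a))).
  by rewrite inE; apply/existsP; exists a; rewrite ltnSn eqxx.
have := ideal_le (pT a'.+1 (ltn_ord a')) a'P o le.
by rewrite inE => /existsP[x /andP[xa /eqP/Ti <-]].
Qed.

Lemma tableau_addable T D (k : 'I_n) : tableau T D ->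
  addable (prefix_set T k) (T k).
Proof.
move=> tT; have [Ti _ _ _] := tT; rewrite addableE; apply/andP; split.
  rewrite inE; apply/existsP => -[a /andP[ak /eqP/Ti E]].
  by rewrite E ltnn in ak.
rewrite (_ : _ |: _ = prefix_set T k.+1) ?(tableau_prefix _ tT) //.
apply/setP => b; rewrite in_setU1 !inE; apply/orP/existsP.
  case=> [/eqP ->|/existsP[a /andP[ak E]]]; first by exists k; rewrite ltnSn eqxx.
  by exists a; rewrite E andbT ltnS ltnW.
move=> [a /andP[]]; rewrite ltnS leq_eqVlt => /orP[/eqP/val_inj -> /eqP ->|ak E].
  by left.
by right; apply/existsP; exists a; rewrite ak.
Qed.

Definition ct (T : 'I_n -> box n) (a : 'I_n) : nat := (T a).2 - (T a).1.

Section Local.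
Variables (T : 'I_n -> box n) (D : {set box n}).
Hypothesis tT : tableau T D.

Lemma tableau_oct a : (T a).1 <= (T a).2.
Proof. by case: tT => _ iD _ _; apply: ideal_oct iD (tableau_mem a tT). Qed.

Lemma tableau_below a (i j : 'I_n) : i <= j -> i <= (T a).1 -> j <= (T a).2 ->
  exists2 x, T x = (i, j) & x <= a.
Proof.
case: tT => _ iD inD mT ij h1 h2.
have := @ideal_le _ _ _ (i, j) iD (tableau_mem a tT) ij.
rewrite /box_le h1 h2 => /(_ isT); rewrite inD => /existsP[x /eqP xE].
by exists x => //; apply: mT; rewrite xE /box_le h1 h2.
Qed.

Lemma ct0 (a : 'I_n) : a = 0 :> nat -> ct T a = 0.
Proof.
move=> a0; have o := tableau_oct a; have [Ti _ _ _] := tT.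
have [x xE] := @tableau_below a (T a).1 (T a).1 (leqnn _) (leqnn _) o.
rewrite a0 leqn0 => /eqP x0.
have xa : x = a by apply: val_inj; rewrite /= x0 a0.
by rewrite /ct -[in (T a).2]xa xE subnn.
Qed.

(** A box strictly between two comparable boxes would carry an entry strictly between [a] and
    [a.+1]. So the two boxes are neighbours. *)
Lemma ct_adjacent (a b : 'I_n) : b = a.+1 :> nat -> box_le (T a) (T b) ->
  ct T b = (ct T a).+1 \/ ct T a = (ct T b).+1.
Proof.
have [Ti _ _ mT] := tT; move=> ba /andP[h1 h2].
have oa := tableau_oct a; have ob := tableau_oct b.
have mid (i j : 'I_n) : (T a).1 <= i <= (T b).1 -> (T a).2 <= j <= (T b).2 -> i <= j ->
    ((i, j) == T a) || ((i, j) == T b).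
  move=> /andP[i1 i2] /andP[j1 j2] ij; have [x xE xb] := tableau_below ij i2 j2.
  have ax : a <= x by apply: mT; rewrite xE /box_le /= i1 j1.
  have [/val_inj xa|xna] := eqVneq (val a) (val x); first by rewrite -xE xa eqxx.
  rewrite -xE !(inj_eq Ti) -!val_eqE /=; move: xna; rewrite /=; lia.
have nab : T a != T b by rewrite (inj_eq Ti) -val_eqE /= ba; lia.
have m1 := @mid (T a).1 (T b).2 ltac:(lia) ltac:(lia) ltac:(lia).
have lt_n := ltn_ord (T b).2; have lt_n1 := ltn_ord (T b).1.
move: nab m1 mid oa ob h1 h2 lt_n lt_n1; rewrite /ct; move: (T a) (T b) => [i j] [i' j'] /=.
rewrite !xpair_eqE -!val_eqE /= !eqxx /= !andbT => nab.
move=> /orP[/eqP jE|/eqP iE] mid oa ob h1 h2 lt_n lt_n1.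
  have i1n : i.+1 < n by lia.
  have := mid (Ordinal i1n) j ltac:(rewrite /=; lia) ltac:(lia) ltac:(rewrite /=; lia).
  rewrite !xpair_eqE -!val_eqE /=; lia.
have j1n : j.+1 < n by lia.
have := mid i (Ordinal j1n) ltac:(lia) ltac:(rewrite /=; lia) ltac:(rewrite /=; lia).
rewrite !xpair_eqE -!val_eqE /=; lia.
Qed.

(** Of two incomparable boxes one is strictly above and strictly to the right of the other, and each
    direction adds at least 1 to the content. *)
Lemma ct_far (a b : 'I_n) : a < b -> ~~ box_le (T a) (T b) ->
  (ct T a).+2 <= ct T b \/ (ct T b).+2 <= ct T a.
Proof.
have [Ti _ _ mT] := tT; move=> ab nle.
have nle' : ~~ box_le (T b) (T a) by apply/negP => /mT; lia.
have oa := tableau_oct a; have ob := tableau_oct b.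
move: nle nle' oa ob; rewrite /ct /box_le; lia.
Qed.

(** Let [T a] be (i, j) and [T d] be (i', j'), further down the same diagonal. The boxes (i, j + 1),
    (i, j') and, if i' <= j, (i', j) lie between them, and [b] is the only entry left for these.
    Hence i' = i + 1 > j, so i = j. *)
Lemma ct_repeat (a b d : 'I_n) : b = a.+1 :> nat -> d = b.+1 :> nat ->
  ct T a = ct T d -> ct T a = 0.
Proof.
have [Ti _ _ mT] := tT; move=> ba db E.
have oa := tableau_oct a; have od := tableau_oct d.
have nad : T a != T d by rewrite (inj_eq Ti) -val_eqE /= db ba; lia.
have h1 : (T a).1 < (T d).1.
  rewrite ltnNge; apply/negP => h; have : box_le (T d) (T a).
    by rewrite /box_le h; move: E oa od; rewrite /ct; lia.
  by move/mT; lia.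
have mid (i j : 'I_n) : (T a).1 <= i <= (T d).1 -> (T a).2 <= j <= (T d).2 -> i <= j ->
    [|| (i, j) == T a, (i, j) == T b | (i, j) == T d].
  move=> /andP[i1 i2] /andP[j1 j2] ij; have [x xE xb] := tableau_below ij i2 j2.
  have ax : a <= x by apply: mT; rewrite xE /box_le /= i1 j1.
  rewrite -xE !(inj_eq Ti) -!val_eqE /=; lia.
have lt_n := ltn_ord (T d).2.
have m1 := @mid (T a).1 (T d).2 ltac:(lia) ltac:(move: E; rewrite /ct; lia) ltac:(lia).
move: nad E m1 mid oa od h1 lt_n; rewrite /ct; move: (T a) (T b) (T d) => [i j] [k l] [i' j'] /=.
rewrite !xpair_eqE -!val_eqE /= => nad E m1 mid oa od h1 lt_n.
have j1n : j.+1 < n by lia.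
have := mid i (Ordinal j1n) ltac:(lia) ltac:(rewrite /=; lia) ltac:(rewrite /=; lia).
have [ij|ij] := leqP i' j.
  have := mid i' j ltac:(lia) ltac:(lia) ij.
  rewrite !xpair_eqE -!val_eqE /=; lia.
rewrite !xpair_eqE -!val_eqE /=; lia.
Qed.

End Local.
End Tableaux.

(** * Connectedness of standard tableaux under exchanges of consecutive entries *)

Section Connect.
Variable n : nat.

Lemma lo_val (a : 'I_n.-1) : lo a = a :> nat. Proof. by []. Qed.
Lemma hi_val (a : 'I_n.-1) : hi a = a.+1 :> nat. Proof. by []. Qed.
Lemma lo_hi (a : 'I_n.-1) : (lo a == hi a) = false.
Proof. by rewrite -val_eqE /=; lia. Qed.

Lemma std_tableau (lam : spart n) (T : std_tab lam) :
  tableau (val T) (diagram n (parts lam)).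
Proof.
by apply/standardP; [exact: strict_partition_strict (partsP lam) | exact: valP].
Qed.

Lemma swap_standard (lam : spart n) (T : std_tab lam) (a : 'I_n.-1) :
  standard (parts lam) (swap_entries (val T) a) =
  ~~ box_le (val T (lo a)) (val T (hi a)).
Proof.
have [Ti iD inD mT] := std_tableau T.
have sl := strict_partition_strict (partsP lam).
apply/idP/negP => [/(standardP _ sl)[_ _ _ mT'] le|nle].
  have := mT' (hi a) (lo a); rewrite !ffunE tpermL tpermR => /(_ le) /=.
  by rewrite ltnn.
apply/(standardP _ sl); split=> //.
- by move=> x y; rewrite !ffunE => /Ti /perm_inj.
- move=> b; rewrite inD; apply/existsP/existsP => -[x xE];
    exists (tperm (lo a) (hi a) x); first by rewrite ffunE tpermK.
  by move: xE; rewrite ffunE.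
have neq (u v : 'I_n) : u <> v -> (u : nat) <> v by move=> h /val_inj.
move=> x y; rewrite !ffunE => le; have := mT _ _ le; move: le.
case: (tpermP (lo a) (hi a) x) => [->|->|/neq xl /neq xh];
  case: (tpermP (lo a) (hi a) y) => [->|->|/neq yl /neq yh] le //=;
  simpl in *; lia.
Qed.

Definition rank (b : box n) : nat := b.1 * n + b.2.

Lemma rank_inj : injective rank.
Proof.
move=> [i j] [i' j']; rewrite /rank /= => E.
have n0 : 0 < n := leq_ltn_trans (leq0n i) (ltn_ord i).
have := congr1 (divn^~ n) E; have := congr1 (modn^~ n) E.
rewrite !modnMDl !divnMDl // !modn_small // !divn_small // !addn0.
by move=> /val_inj -> /val_inj ->.
Qed.

Lemma rank_le b b' : box_le b b' -> rank b <= rank b'.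
Proof. by move=> /andP[h1 h2]; rewrite leq_add ?leq_mul2r ?h1 ?orbT. Qed.

(** The boxes listed by increasing entry are the diagram sorted by rank, and a sorted list is
    determined by its members. *)
Lemma row_reading_unique (lam : spart n) (T T' : std_tab lam) :
  (forall a : 'I_n.-1, rank (val T (lo a)) < rank (val T (hi a))) ->
  (forall a : 'I_n.-1, rank (val T' (lo a)) < rank (val T' (hi a))) ->
  T = T'.
Proof.
have H (S : std_tab lam) :
    (forall a : 'I_n.-1, rank (val S (lo a)) < rank (val S (hi a))) ->
    sorted (relpre rank ltn) [seq val S a | a <- enum 'I_n] /\
    [seq val S a | a <- enum 'I_n] =i diagram n (parts lam).
  move=> h; have [Ti iD inD mT] := std_tableau S; split; last first.
    move=> b; rewrite inD; apply/mapP/existsP => [[x _ ->]|[x /eqP <-]].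
      by exists x.
    by exists x; rewrite ?mem_enum.
  case: (posnP n) => [n0|n0].
    by rewrite (_ : enum _ = [::]) //; apply: size0nil; rewrite size_enum_ord.
  have x0 : 'I_n := Ordinal n0.
  rewrite sorted_map; apply/(sortedP x0) => k; rewrite size_enum_ord => kn.
  have kn' : k < n.-1 by lia.
  have -> : nth x0 (enum 'I_n) k = lo (Ordinal kn').
    by apply: val_inj; rewrite /= nth_enum_ord // ltnW.
  have -> : nth x0 (enum 'I_n) k.+1 = hi (Ordinal kn').
    by apply: val_inj; rewrite /= nth_enum_ord.
  exact: h.
move=> /H[s1 e1] /H[s2 e2]; apply: val_inj; apply/ffunP => a.
have E : [seq val T a | a <- enum 'I_n] = [seq val T' a | a <- enum 'I_n].
  apply: (irr_sorted_eq (leT := relpre rank ltn)) => //.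
  - by move=> x y z /=; apply: ltn_trans.
  - by move=> x /=; apply: ltnn.
  - by move=> b; rewrite e1 e2.
by have /eq_in_map := E; apply; rewrite mem_enum.
Qed.

Lemma swap_involutive (T : {ffun 'I_n -> box n}) a :
  swap_entries (swap_entries T a) a = T.
Proof. by apply/ffunP => x; rewrite !ffunE tpermK. Qed.

(* Exchanging a and a + 1 whenever a + 1 precedes a in reading order increases
   sum_a a * rank (T a); the maximum is attained only by the row reading tableau. *)
Lemma row_reading_reachable (lam : spart n) (P : std_tab lam -> Prop) T0 :
  P T0 ->
  (forall (T T' : std_tab lam) a, P T -> val T' = swap_entries (val T) a -> P T') ->
  exists2 T, P T & forall a : 'I_n.-1, rank (val T (lo a)) < rank (val T (hi a)).
Proof.
move=> P0 Pswap; pose m (T : std_tab lam) := \sum_(a < n) a * rank (val T a).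
pose Pb T := `[< P T >]; have Pb0 : Pb T0 by apply/asboolP.
have [T /asboolP PT Tmax] := @arg_maxnP _ T0 Pb m Pb0.
exists T => // a; rewrite ltnNge; apply/negP => le.
have [Ti _ _ mT] := std_tableau T.
have lt : rank (val T (hi a)) < rank (val T (lo a)).
  rewrite ltn_neqAle le andbT; apply/eqP => /rank_inj/Ti/eqP.
  by rewrite eq_sym lo_hi.
have sT : standard (parts lam) (swap_entries (val T) a).
  by rewrite swap_standard; apply/negP => /rank_le; rewrite leqNgt lt.
pose T' : std_tab lam := exist _ (swap_entries (val T) a) sT.
have PT' : Pb T' by apply/asboolP; apply: (Pswap T T' a).
have : m T' <= m T := Tmax _ PT'; rewrite leqNgt => /negP; apply.
have hl : hi a != lo a by rewrite eq_sym lo_hi.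
have E (S : std_tab lam) : m S = lo a * rank (val S (lo a)) +
    (hi a * rank (val S (hi a)) +
     \sum_(i < n | (i != lo a) && (i != hi a)) i * rank (val S i)).
  by rewrite /m (bigD1 (lo a)) // (bigD1 (hi a)).
rewrite !E (_ : val T' (lo a) = val T (hi a)); last by rewrite ffunE tpermL.
rewrite (_ : val T' (hi a) = val T (lo a)); last by rewrite ffunE tpermR.
rewrite [X in _ < _ + (_ + X)](eq_bigr (fun i : 'I_n => i * rank (val T i))).
  have key l h x y s : y < x -> h = l.+1 -> l * x + (h * y + s) < l * y + (h * x + s).
    by move=> yx ->; nia.
  exact: (key (lo a) (hi a) _ _ _ lt (hi_val a)).
by move=> i /andP[h1 h2]; rewrite ffunE tpermD // eq_sym.
Qed.

(** Exchanges are involutive, so the complement of [P] is closed under them too. If it were not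
    empty, [P] and its complement would both contain the row reading tableau. *)
Lemma std_tab_connected (lam : spart n) (P : std_tab lam -> Prop) T0 :
  P T0 ->
  (forall (T T' : std_tab lam) a, P T -> val T' = swap_entries (val T) a -> P T') ->
  forall T, P T.
Proof.
move=> P0 Pswap T; apply: contrapT => nPT.
have [T1 PT1 m1] := row_reading_reachable P0 Pswap.
have [|T2 nPT2 m2] := @row_reading_reachable lam (fun T => ~ P T) T nPT.
  move=> T2 T3 a nP2 E P3; apply: nP2; apply: (Pswap T3 T2 a) => //.
  by rewrite E swap_involutive.
by apply: nPT2; rewrite (row_reading_unique m2 m1).
Qed.

End Connect.

(** * Weighted counts of tableaux; addable against removable boxes *)

Section Count.
Variable n : nat.
Implicit Types (b : box n) (D : {set box n}).

(** Counts the standard fillings of [D], as chains of ideals growing by one box from the empty set,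
    where a box [b] has [w b] variants. Weight 1 gives standard tableaux and [wt] gives barred
    ones. *)
Fixpoint cnt (w : box n -> nat) k D : nat :=
  if k is k'.+1 then
    if ideal D then \sum_(b in D) w b * cnt w k' (D :\ b) else 0
  else (D == set0).

Lemma cnt_neq0 w k D : cnt w k D != 0 -> ideal D /\ #|D| = k.
Proof.
case: k D => [|k] D /=.
  by rewrite eqb0 negbK => /eqP ->; rewrite cards0; split=> //; apply: ideal0.
case: ifP => // iD; elim: k D iD => [|k IH] D iD /=.
  rewrite sum_nat_eq0 negb_forall_in => /existsP[b /andP[bD]].
  rewrite muln_eq0 negb_or eqb0 negbK => /andP[_ /eqP E].
  by split=> //; rewrite (cardsD1 b) bD E cards0.
rewrite sum_nat_eq0 negb_forall_in => /existsP[b /andP[bD]].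
rewrite muln_eq0 negb_or => /andP[_]; case: ifP => // iD' h.
by have [_ cD] := IH _ iD' h; split=> //; rewrite (cardsD1 b) bD cD.
Qed.

(** The number of ways to bar or not to bar an entry in the box. *)
Definition wt b : nat := if is_diag b then 1 else 2.

Section Balance.
Variable D : {set box n}.
Hypotheses (iD : ideal D) (Dn : #|D| < n).
Local Notation r := (row_len D).

(** [add_wt] and [rem_wt] express through row lengths the weight of the box that row [i] can gain or
    lose, 0 if there is none; the weight is 1 when this box is on the diagonal. *)
Definition add_wt i : nat :=
  if (i == 0) || (i + r i < i.-1 + r i.-1) then if r i == 0 then 1 else 2 else 0.
Definition rem_wt i : nat :=
  if (0 < r i) && ((r i.+1 == 0) || (i.+1 + r i.+1 < i + r i))
  then if r i == 1 then 1 else 2 else 0.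

Lemma row_dec i : 0 < r i.+1 -> r i.+1 < r i.
Proof. exact: row_len_dec. Qed.

Lemma row_fits i : i < n -> i + r i <= n.
Proof. by move=> h; exact: (row_len_fits (Ordinal h) iD). Qed.

Lemma row0_lt : r 0 < n.
Proof.
have n0 : 0 < n by exact: leq_ltn_trans Dn.
apply: leq_ltn_trans Dn; rewrite card_row_len (bigD1 (Ordinal n0)) //=.
exact: leq_addr.
Qed.

Lemma row_nil : r n = 0.
Proof. by apply/eqP; rewrite -leqn0 leqNgt; apply/negP => /row_len_gt0; rewrite ltnn. Qed.

Lemma addable_row (i j : 'I_n) :
  addable D (i, j) = (j == i + r i :> nat) && ((i == 0 :> nat) || (i + r i < i.-1 + r i.-1)).
Proof.
rewrite addableE in_ideal //=; apply/idP/idP.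
  move=> /andP[nin id]; have bin : (i, j) \in (i, j) |: D by rewrite setU11.
  have ij : i <= j := ideal_oct id bin.
  have jE : j = i + r i :> nat.
    apply/eqP; rewrite eqn_leq; apply/andP; split; last by move: nin; rewrite ij /= -leqNgt.
    rewrite leqNgt; apply/negP => h.
    have xn : i + r i < n := ltn_trans h (ltn_ord j).
    have := @ideal_le _ _ _ (i, Ordinal xn) id bin; rewrite /box_le /= leqnn (ltnW h) leq_addr.
    move=> /(_ isT isT); rewrite in_setU1 in_ideal //= xpair_eqE -val_eqE /=.
    by rewrite -!val_eqE /=; lia.
  rewrite jE eqxx /=; case: (posnP i) => [//|i0] /=.
  have pn : i.-1 < n by have := ltn_ord i; lia.
  have := @ideal_le _ _ _ (Ordinal pn, j) id bin; rewrite /box_le /= leqnn leq_pred.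
  move=> /(_ (leq_trans (leq_pred _) ij) isT); rewrite in_setU1 in_ideal //= xpair_eqE -!val_eqE /=.
  by rewrite jE; lia.
move=> /andP[/eqP jE c]; apply/andP; split; first by rewrite jE; lia.
apply/idealP => b; rewrite in_setU1 => /orP[/eqP ->|bD]; last first.
  split; first exact: ideal_oct bD.
  by move=> b' h1 h2; rewrite in_setU1 (ideal_le iD bD h1 h2) orbT.
split; first by rewrite /= jE leq_addr.
move=> [i' j'] /= h1 /andP[/= h2 h3]; rewrite in_setU1.
have [e|ne] := eqVneq (i' : nat) i.
  rewrite in_ideal //= xpair_eqE -!val_eqE /= e eqxx /=; lia.
have pn : i.-1 < n by have := ltn_ord i; lia.
have pD : (Ordinal pn, j) \in D by rewrite in_ideal //= jE; move: c ne h2; lia.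
by rewrite (@ideal_le _ D _ (i', j') iD pD h1) ?orbT // /box_le /= h3 andbT; lia.
Qed.

Lemma removable_row (i j : 'I_n) :
  ((i, j) \in D) && ideal (D :\ (i, j)) =
  [&& 0 < r i, j.+1 == i + r i :> nat & (r i.+1 == 0) || (i.+1 + r i.+1 < i + r i)].
Proof.
have rd := @row_dec i; have rf := row_fits (ltn_ord i).
rewrite in_ideal //=; apply/idP/idP.
  move=> /andP[/andP[ij jr] id].
  have jE : j.+1 = i + r i :> nat.
    apply/eqP; rewrite eqn_leq jr /= leqNgt; apply/negP => h.
    have xn : j.+1 < n by lia.
    have xD : (i, Ordinal xn) \in D :\ (i, j).
      by rewrite in_setD1 in_ideal //= xpair_eqE -!val_eqE /=; lia.
    have := @ideal_le _ _ _ (i, j) id xD ij; rewrite /box_le /= leqnn leqnSn.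
    by move=> /(_ isT); rewrite in_setD1 eqxx.
  rewrite jE eqxx /=; apply/andP; split; first by lia.
  case: (posnP (r i.+1)) => [-> //|r0] /=; rewrite ltnNge; apply/negP => h.
  have i1n := row_len_gt0 r0; have ij' : i.+1 <= j by have := rd r0; lia.
  have xD : (Ordinal i1n, j) \in D :\ (i, j).
    by rewrite in_setD1 in_ideal //= xpair_eqE -!val_eqE /=; lia.
  have := @ideal_le _ _ _ (i, j) id xD ij; rewrite /box_le /= leqnn leqnSn.
  by move=> /(_ isT); rewrite in_setD1 eqxx.
move=> /and3P[r0 /eqP jE c]; apply/andP; split; first by lia.
apply/idealP => b; rewrite in_setD1 => /andP[nb bD]; split; first exact: ideal_oct bD.
move=> b' h1 h2; rewrite in_setD1 (ideal_le iD bD h1 h2) andbT.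
apply/eqP => E; rewrite E in h1 h2; case: b nb bD h2 => [i2 j2] nb bD /andP[/= h3 h4].
have o2 : i2 <= j2 := ideal_oct iD bD.
have [e|ne] := eqVneq (i2 : nat) i.
  by move: bD nb; rewrite in_ideal //= xpair_eqE -!val_eqE /= e eqxx /=; lia.
have i1n : i.+1 < n by have := ltn_ord i2; lia.
have : (Ordinal i1n, j2) \in D by apply: (ideal_le iD bD); rewrite /box_le /=; lia.
rewrite in_ideal //= => /andP[h5 h6]; have r1 : 0 < r i.+1 by lia.
by move: c (rd r1); lia.
Qed.

Lemma sum_ord_at (P : bool) (m w : nat) :
  (P -> m < n) -> \sum_(j < n | (j == m :> nat) && P) w = (if P then w else 0).
Proof.
case: P => [h|_]; last by rewrite big_pred0 // => j; rewrite andbF.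
by rewrite (big_pred1 (Ordinal (h isT))) // => j; rewrite andbT.
Qed.

Lemma add_wt_row (i : 'I_n) : \sum_(j < n | addable D (i, j)) wt (i, j) = add_wt i.
Proof.
rewrite (eq_bigl _ _ (addable_row i)).
rewrite (eq_bigr (fun=> if r i == 0 then 1 else 2)); last first.
  move=> j /andP[/eqP jE _]; rewrite /wt /is_diag -val_eqE /= jE.
  by rewrite -[X in X == _]addn0 eqn_add2l eq_sym.
rewrite sum_ord_at // => /orP[/eqP ->|]; first by rewrite add0n row0_lt.
have [pi0|pi0] := posnP (nat_of_ord i); first by rewrite pi0 /=; lia.
have pn : i.-1 < n by have := ltn_ord i; lia.
by have := row_fits pn; lia.
Qed.

Lemma rem_wt_row (i : 'I_n) :
  \sum_(j < n | ((i, j) \in D) && ideal (D :\ (i, j))) wt (i, j) = rem_wt i.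
Proof.
have rf := row_fits (ltn_ord i).
rewrite (eq_bigl _ _ (removable_row i)).
rewrite (eq_bigr (fun=> if r i == 1 then 1 else 2)); last first.
  move=> j /and3P[_ /eqP jE _]; rewrite /wt /is_diag -val_eqE /=.
  by rewrite (_ : (val i == val j) = (r i == 1)) //=; lia.
rewrite (eq_bigl (fun j : 'I_n => (j == (i + r i).-1 :> nat) &&
   ((0 < r i) && ((r i.+1 == 0) || (i.+1 + r i.+1 < i + r i))))); last by move=> j; lia.
by rewrite sum_ord_at //; lia.
Qed.

(** If row [i.+1] is not empty, row [i] can lose a box exactly when row [i.+1] can gain one, both of
    weight 2. At the last nonempty row the removable box weighs 2, or 1 if it is the whole row,
    while the new diagonal box below weighs 1, respectively is not addable. *)
Lemma rem_wtE i : rem_wt i = add_wt i.+1 + ((0 < r i) && (r i.+1 == 0)).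
Proof.
rewrite /rem_wt /add_wt /=; have := @row_dec i.
by case: (posnP (r i.+1)) => [->|r0] rd; case: (posnP (r i)) => [->|r1];
  rewrite /= ?ltnn ?addn0; repeat case: ifP; lia.
Qed.

Lemma sum_row_end k : \sum_(i < k) ((0 < r i) && (r i.+1 == 0) : nat) + (0 < r k) = (0 < r 0).
Proof.
elim: k => [|k IH]; first by rewrite big_ord0.
rewrite big_ord_recr /= -IH -addnA; congr (_ + _).
by have := @row_dec k; case: (posnP (r k.+1)) => h; case: (posnP (r k)) => h'; lia.
Qed.

(** By [rem_wtE] the two sums agree row by row after a shift, up to 1 for the last nonempty row. The
    remaining term [add_wt 0] is 2 for a nonempty diagram and 1 for the empty one, which leaves an
    excess of 1 in both cases. *)
Lemma wt_balance : \sum_(b | addable D b) wt b =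
  (\sum_(b in D | ideal (D :\ b)) wt b).+1.
Proof.
have n0 : 0 < n by exact: leq_ltn_trans Dn.
transitivity (\sum_(i < n) add_wt i).
  rewrite -(eq_bigr _ (fun i _ => add_wt_row i)).
  by rewrite pair_big_dep /=; apply: eq_big => -[i j].
transitivity (\sum_(i < n) rem_wt i).+1; last first.
  congr _.+1; rewrite -(eq_bigr _ (fun i _ => rem_wt_row i)).
  by rewrite pair_big_dep /=; apply: eq_big => -[i j].
under [in RHS]eq_bigr => i _ do rewrite rem_wtE.
rewrite big_split /=; have := sum_row_end n; rewrite row_nil addn0 => ->.
rewrite -(big_mkord xpredT add_wt) -(big_mkord xpredT (fun i => add_wt i.+1)).
rewrite big_ltn // (_ : \sum_(0 <= i < n) add_wt i.+1 = \sum_(1 <= i < n) add_wt i).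
  by rewrite {1}/add_wt /=; case: (r 0) => [|x] /=; lia.
rewrite -[1 in RHS]addn1 -{2}(prednK n0) -(addn1 n.-1) big_addn.
rewrite -{1}(prednK n0) addnK big_nat_recr //=.
(* The shifted sum has an extra term for row [n]. It vanishes because row [n.-1] ends at the border
   of the grid at the latest. *)
rewrite [X in _ + X](_ : _ = 0) ?addn0; last first.
  rewrite /add_wt prednK // row_nil /=; have := @row_fits n.-1; case: ifP => //; lia.
by apply: eq_bigr => i _; rewrite addn1.
Qed.

End Balance.
End Count.

(** * The up-down identity for the graph of strict partitions *)

Section Updown.
Variable n : nat.
Implicit Types (b : box n) (D : {set box n}).
Local Notation h := (cnt (@wt n)).

Lemma cntS w k D : ideal D -> cnt w k.+1 D = \sum_(b in D) w b * cnt w k (D :\ b).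
Proof. by move=> iD; rewrite /= iD. Qed.

Lemma cnt_eq0 w k D : ~~ ideal D -> cnt w k D = 0.
Proof. by move=> iD; apply/eqP; apply: contraR iD => /cnt_neq0[]. Qed.

(* The commutation of adding and removing a box: both orders lead to the same
   diagrams, except for the box added and removed at once. *)
Lemma cnt_exchange k D b' : ideal D -> b' \in D ->
  \sum_(b | addable D b) h k ((b |: D) :\ b') + ideal (D :\ b') * h k D =
  ideal (D :\ b') * \sum_(b | addable (D :\ b') b) h k (b |: (D :\ b')).
Proof.
move=> iD bD; case: (boolP (ideal (D :\ b'))) => iDb; last first.
  rewrite !mul0n addn0 big1 // => b; rewrite addableE => /andP[nb ib].
  apply: cnt_eq0; apply: contra iDb => ie.
  rewrite (_ : D :\ b' = D :&: ((b |: D) :\ b')) ?idealI //.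
  by apply/setP => x; rewrite !inE; case: (x \in D); rewrite ?orbT ?andbF ?andbT.
rewrite !mul1n [RHS](bigD1 b') /=; last by rewrite addableE setD11 setD1K.
rewrite setD1K // addnC; congr (_ + _).
rewrite big_mkcond [RHS]big_mkcond; apply: eq_bigr => b _.
have [->|nbb] := eqVneq b b'; first by rewrite andbF addableE bD.
rewrite andbT; have E : (b |: D) :\ b' = b |: (D :\ b').
  by apply/setP => x; rewrite !inE; case: (eqVneq x b') => //= ->; rewrite eq_sym (negbTE nbb).
rewrite E !addableE in_setD1 nbb /=; case: (boolP (b \in D)) => //= nb.
case: (boolP (ideal (b |: (D :\ b')))) => i1; last by rewrite cnt_eq0 // if_same.
rewrite ifT //; have -> : b |: D = D :|: (b |: (D :\ b')); last exact: idealU.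
by apply/setP => x; rewrite !inE; case: (x \in D); rewrite ?orbT ?andbF.
Qed.

(** Adding a box and removing one commute up to the identity. The last box of a filling of [b |: D]
    is [b], whose total weight is given by [wt_balance], or some b' in [D]; then [cnt_exchange]
    leads to the induction hypothesis for [D :\ b']. *)
Lemma cnt_up k D : ideal D -> #|D| = k -> k < n ->
  \sum_(b | addable D b) h k.+1 (b |: D) = k.+1 * h k D.
Proof.
elim: k D => [|k IH] D iD Dk kn.
  have D0 : D = set0 by apply/eqP; rewrite -cards_eq0 Dk.
  have := @wt_balance n D iD; rewrite Dk => /(_ kn).
  rewrite [X in X.+1]big1 => [E|b]; last by rewrite D0 in_set0.
  rewrite mul1n; transitivity (\sum_(b | addable D b) wt b * h 0 D); last first.
    by rewrite -big_distrl /= E mul1n.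
  apply: eq_bigr => b; rewrite addableE => /andP[nb ib].
  by rewrite cntS // D0 setU0 big_set1 setDv.
have step b : addable D b -> h k.+2 (b |: D) =
    wt b * h k.+1 D + \sum_(b' in D) wt b' * h k.+1 ((b |: D) :\ b').
  rewrite addableE => /andP[nb ib]; rewrite cntS // big_setU1 //=.
  by rewrite setU1K.
rewrite (eq_bigr _ step) big_split /= -big_distrl /= exchange_big /=.
rewrite wt_balance ?Dk // mulSn -addnA mulSn; congr (_ + _).
have hE : h k.+1 D = \sum_(b' in D) wt b' * h k (D :\ b') by rewrite cntS.
transitivity (\sum_(b' in D) wt b' * (ideal (D :\ b') * (k.+1 * h k (D :\ b')))).
  rewrite [X in X * _ + _]big_mkcondr big_distrl -big_split /=.
  apply: eq_bigr => b' bD; rewrite -big_distrr /=.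
  have := @cnt_exchange k.+1 D b' iD bD; case: (boolP (ideal (D :\ b'))) => iDb.
    rewrite !mul1n => E; rewrite -mulnDr addnC E IH //; last exact: ltnW.
    by move: Dk; rewrite (cardsD1 b') bD => -[].
  by rewrite !mul0n !addn0 => ->; rewrite ?mul0n ?add0n.
rewrite /= iD big_distrr /=; apply: eq_bigr => b' bD.
by case: (boolP (ideal (D :\ b'))) => iDb; rewrite ?mul1n 1?mulnCA // cnt_eq0 ?muln0.
Qed.

(** Moving the last box of the first factor into the second one and summing with [cnt_up] extracts
    the factor k + 1. *)
Lemma cnt_factorial w k : k <= n -> (forall b, w b = 1) ->
  \sum_D cnt w k D * h k D = k`!.
Proof.
move=> kn w1; elim: k kn => [|k IH] kn.
  rewrite (bigD1 set0) //= eqxx big1 // => D /negbTE ->; by rewrite mul0n.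
rewrite factS -IH; last exact: ltnW.
transitivity (\sum_(b : box n) \sum_(D : {set box n} | (b \in D) && ideal D) cnt w k (D :\ b) * h k.+1 D).
  rewrite (exchange_big_dep xpredT) //=; apply: eq_bigr => D _.
  by case: (boolP (ideal D)) => iD; [
     rewrite big_distrl /=; apply: eq_big => [b|b bD]; rewrite ?andbT // w1 mul1n
   | rewrite mul0n big_pred0 // => b; rewrite andbF].
transitivity (\sum_(b : box n) \sum_(D : {set box n} | addable D b) cnt w k D * h k.+1 (b |: D)).
  apply: eq_bigr => b _.
  rewrite (reindex_onto (fun D => b |: D) (fun D => D :\ b)) /=; last first.
    by move=> D /andP[bD _]; rewrite setD1K.
  apply: eq_big => [D|D]; last by move=> /andP[_ /eqP ->].
  rewrite setU11 addableE /= andbC; congr (_ && _).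
  case: (boolP (b \in D)) => bD; last by rewrite setU1K // eqxx.
  by apply/eqP => /setP/(_ b); rewrite setD11 bD.
rewrite (exchange_big_dep xpredT) //= big_distrr /=; apply: eq_bigr => D _.
have [->|c0] := eqVneq (cnt w k D) 0.
  by rewrite mul0n muln0 big1 // => b _; rewrite mul0n.
have [iD Dk] := cnt_neq0 c0.
by rewrite -big_distrr /= cnt_up // mulnCA.
Qed.

Lemma cnt_gt0 k w D : (forall b, 0 < w b) -> ideal D -> #|D| = k -> 0 < cnt w k D.
Proof.
move=> w0; elim: k D => [|k IH] D iD Dk.
  by rewrite /= (_ : D == set0) // -cards_eq0 Dk.
have [b0 b0D] : exists b, b \in D by apply/set0Pn; rewrite -card_gt0 Dk.
(* A box with maximal coordinate sum is maximal for the box order, hence removable. *)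
have [b bD' bmax'] := @arg_maxnP _ b0 (mem D) (fun b => b.1 + b.2) b0D.
have bD : b \in D := bD'.
have bmax x : x \in D -> x.1 + x.2 <= b.1 + b.2 := bmax' x.
rewrite cntS // (bigD1 b) //= ltn_addr // muln_gt0 w0 /=; apply: IH.
  apply/idealP => x; rewrite in_setD1 => /andP[xb xD]; split; first exact: ideal_oct xD.
  move=> y h1 h2; rewrite in_setD1 (ideal_le iD xD h1 h2) andbT.
  apply: contraNneq xb => yb; rewrite yb in h2; apply/eqP/esym/box_le_anti => //.
  by move: h2 (bmax x xD); rewrite /box_le /=; lia.
by move: Dk; rewrite (cardsD1 b) bD => -[].
Qed.

End Updown.

(** * Fillings encoded as words *)

Lemma size_le_card (S : eqType) (Y : finType) (s : seq S) (Rel : S -> Y -> Prop) :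
  uniq s -> (forall w, w \in s -> exists y, Rel w y) ->
  (forall w w' y, w \in s -> w' \in s -> Rel w y -> Rel w' y -> w = w') ->
  size s <= #|Y|.
Proof.
case: s => // w0 s us ex inj; have [y0 _] := ex w0 (mem_head _ _).
have /choice[f fP] : forall w, exists y, w \in w0 :: s -> Rel w y.
  move=> w; case: (boolP (w \in w0 :: s)) => [/ex[y wy]|_]; last by exists y0.
  by exists y.
rewrite -(size_map f); apply: leq_trans (max_card (mem (map f (w0 :: s)))).
rewrite leq_eqVlt; apply/orP; left; rewrite eq_sym; apply/eqP/card_uniqP.
rewrite map_inj_in_uniq // => w w' ws ws' E.
by apply: (inj _ _ (f w)) => //; [exact: fP | rewrite E; exact: fP].
Qed.

Section Words.
Variables (n : nat) (X : finType) (beta : X -> box n) (adm : pred X).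
Implicit Types (b : box n) (D : {set box n}).

(** A letter [x] puts the next entry into the box [beta x]. Boxes as letters give standard tableaux;
    admissible pairs of a box and a bar give barred ones. *)
Fixpoint words k D : seq (seq X) :=
  if k is k'.+1 then
    if ideal D then
      [seq rcons w x | x <- [seq x <- enum X | adm x && (beta x \in D)],
                       w <- words k' (D :\ beta x)]
    else [::]
  else if D == set0 then [:: [::]] else [::].

Definition letters b : nat := #|[pred x | adm x && (beta x == b)]|.

Lemma size_words k D : size (words k D) = cnt letters k D.
Proof.
elim: k D => [|k IH] D /=; first by case: ifP.
case: ifP => // iD; rewrite size_allpairs_dep sumnE big_map big_filter big_enum_cond /=.
rewrite (partition_big beta (mem D)) /=; last by move=> x /andP[].
apply: eq_bigr => b bD; rewrite /letters -sum1_card big_distrl /=.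
apply: eq_big => [x|x /andP[_ /eqP <-]]; last by rewrite IH mul1n.
by rewrite !inE; case: (eqVneq (beta x) b) => [->|]; rewrite ?bD ?andbT ?andbF.
Qed.

Lemma words_uniq k D : uniq (words k D).
Proof.
elim: k D => [|k IH] D /=; first by case: ifP.
case: ifP => // iD; apply: allpairs_uniq_dep => //.
  by rewrite filter_uniq // enum_uniq.
move=> [x w] [x' w'] _ _ /= /rcons_inj[-> E]; by rewrite E.
Qed.

Definition word_spec k D (w : seq X) :=
  [/\ size w = k, all adm w, forall b, (b \in D) = (b \in map beta w),
      uniq (map beta w) &
      forall j, j <= k -> ideal [set b in map beta (take j w)]].

Lemma wordsP k D w : w \in words k D -> word_spec k D w.
Proof.
elim: k D w => [|k IH] D w /=.
  case: ifP => // /eqP ->; rewrite inE => /eqP ->; split=> //.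
    by move=> b; rewrite in_set0.
  by move=> j _; rewrite /= (_ : finset _ = set0) ?ideal0 //; apply/setP => b; rewrite !inE.
case: ifP => // iD /allpairsPdep[x [v [xs /IH[sv av Dv uv iv] ->]]].
move: xs; rewrite mem_filter => /andP[/andP[ax xD] _].
have memD b : (b \in D) = (b \in map beta (rcons v x)).
  rewrite map_rcons mem_rcons inE -Dv in_setD1.
  by case: (eqVneq b (beta x)) => [->|].
split=> //.
- by rewrite size_rcons sv.
- by rewrite all_rcons ax.
- by rewrite map_rcons rcons_uniq uv -Dv setD11.
move=> j; rewrite leq_eqVlt => /orP[/eqP ->|jk]; last first.
  by rewrite -cats1 takel_cat ?sv //; apply: iv.
rewrite take_oversize ?size_rcons ?sv // (_ : finset _ = D) //.
by apply/setP => b; rewrite inE memD.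
Qed.

Lemma word_tableau (x0 : X) D w : word_spec n D w ->
  tableau [ffun a : 'I_n => beta (nth x0 w a)] D.
Proof.
move=> [sw _ Dw uw iw].
have nE (a : 'I_n) : beta (nth x0 w a) = nth (beta x0) (map beta w) a.
  by rewrite (nth_map x0) // sw.
have pE k : k <= n -> prefix_set [ffun a : 'I_n => beta (nth x0 w a)] k =
    [set b in map beta (take k w)].
  move=> kn; apply/setP => b; rewrite !inE; apply/existsP/mapP.
    move=> [a /andP[ak /eqP <-]]; exists (nth x0 w a); last by rewrite ffunE.
    by rewrite -(nth_take x0 ak) mem_nth // size_takel // sw.
  move=> [x xw ->]; have := xw; rewrite -index_mem size_takel ?sw // => xk.
  exists (Ordinal (leq_trans xk kn)); rewrite ffunE /= xk -(nth_take x0 xk).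
  by rewrite nth_index //= eqxx.
apply: prefix_tableau.
- move=> a a'; rewrite !ffunE !nE => /eqP; rewrite nth_uniq ?size_map ?sw //.
  by move=> /eqP/val_inj.
- move=> b; rewrite Dw; apply/mapP/existsP => [[x xw ->]|[a /eqP <-]].
    have xn : index x w < n by rewrite -sw index_mem.
    by exists (Ordinal xn); rewrite ffunE /= nth_index.
  by exists (nth x0 w a); [rewrite mem_nth // sw | rewrite ffunE].
- by move=> k kn; rewrite pE // iw.
Qed.

End Words.

(** * Pairs of tableaux against n! *)

Section TableauCount.
Variable n : nat.
Hypothesis n_gt0 : 0 < n.

Let b0 : box n := (Ordinal n_gt0, Ordinal n_gt0).

Lemma letters_std b : letters (n := n) id predT b = 1.
Proof. by rewrite /letters -(card1 b); apply: eq_card => x; rewrite !inE. Qed.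

Definition barred_adm (q : box n * bool) := q.2 ==> ~~ is_diag q.1.

Lemma letters_barred b : letters fst barred_adm b = wt b.
Proof.
rewrite /letters -sum1_card (reindex_onto (fun s => (b, s)) snd) /=; last first.
  by move=> [x s]; rewrite inE /= => /andP[_ /eqP ->].
rewrite big_mkcond big_bool /= !inE /barred_adm /wt /= !eqxx /=.
by case: (is_diag b); rewrite ?addn0.
Qed.

Lemma cnt_std (lam : spart n) :
  cnt (fun=> 1) n (diagram n (parts lam)) <= #|{: std_tab lam}|.
Proof.
have -> : cnt (fun=> 1) n (diagram n (parts lam)) =
    cnt (letters (n := n) id predT) n (diagram n (parts lam)).
  by congr (cnt _ _ _); apply/funext => b; rewrite letters_std.
rewrite -size_words; have sl := strict_partition_strict (partsP lam).
apply: (@size_le_card _ _ _ (fun w (T : std_tab lam) =>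
  val T = [ffun a : 'I_n => nth b0 w a])).
- exact: words_uniq.
- move=> w /wordsP/(word_tableau b0) h.
  have sT : standard (parts lam) [ffun a : 'I_n => nth b0 w a] by apply/standardP.
  by exists (exist _ [ffun a : 'I_n => nth b0 w a] sT).
- move=> w w' T /wordsP[sw _ _ _ _] /wordsP[sw' _ _ _ _] -> /ffunP E.
  apply: (@eq_from_nth _ b0) => [|k]; rewrite sw ?sw' // => kn.
  by have := E (Ordinal kn); rewrite !ffunE.
Qed.

Lemma cnt_barred (lam : spart n) :
  cnt (@wt n) n (diagram n (parts lam)) <= #|{: barred_tab lam}|.
Proof.
have -> : cnt (@wt n) n (diagram n (parts lam)) =
    cnt (letters fst barred_adm) n (diagram n (parts lam)).
  by congr (cnt _ _ _); apply/funext => b; rewrite letters_barred.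
rewrite -size_words; have sl := strict_partition_strict (partsP lam).
pose q0 : box n * bool := (b0, false).
apply: (@size_le_card _ _ _ (fun w (U : barred_tab lam) => forall a : 'I_n,
  pos U a = (nth q0 w a).1 /\ barred U a = (nth q0 w a).2)).
- exact: words_uniq.
- move=> w ww; have [sw aw _ _ _] := wordsP ww.
  have h := word_tableau q0 (wordsP ww).
  have sT : standard (parts lam) [ffun a : 'I_n => (nth q0 w a).1] by apply/standardP.
  pose T : std_tab lam := exist _ [ffun a : 'I_n => (nth q0 w a).1] sT.
  pose S : {set 'I_n} := [set a : 'I_n | (nth q0 w a).2].
  have P : [forall a in (T, S).2, ~~ is_diag (val (T, S).1 a)].
    apply/forall_inP => a; rewrite inE /= ffunE => wa.
    have /allP/(_ (nth q0 w a)) := aw; rewrite mem_nth ?sw //= => /(_ isT).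
    by rewrite /barred_adm wa.
  exists (exist _ (T, S) P) => a; rewrite /pos /barred /=.
  by rewrite ffunE inE.
- move=> w w' U /wordsP[sw _ _ _ _] /wordsP[sw' _ _ _ _] h h'.
  apply: (@eq_from_nth _ q0) => [|k]; rewrite sw ?sw' // => kn.
  have [e1 e2] := h (Ordinal kn); have [] := h' (Ordinal kn).
  by rewrite e1 e2 /=; case: (nth q0 w k) => x s /= -> ->; case: (nth q0 w' k).
Qed.

(** A nonzero term of [cnt_factorial] belongs to an ideal with n boxes, that is, to the diagram of a
    strict partition of n. The bound makes the independent family of [sergeev_faithful] at least as
    large as the spanning family of [sergeev_span]. *)
Lemma tableau_pairs_count :
  n`! <= \sum_(lam : spart n) #|{: std_tab lam}| * #|{: barred_tab lam}|.
Proof.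
have <- := @cnt_factorial n (fun=> 1) n (leqnn n) (fun=> erefl).
pose F D := cnt (fun=> 1) n D * cnt (@wt n) n D.
apply: (@leq_trans (\sum_(lam : spart n) F (diagram n (parts lam)))); last first.
  by apply: leq_sum => lam _; rewrite leq_mul ?cnt_std ?cnt_barred.
have -> : \sum_(lam : spart n) F (diagram n (parts lam)) =
    \sum_D \sum_(lam : spart n | diagram n (parts lam) == D) F D.
  rewrite (exchange_big_dep xpredT) //=; apply: eq_bigr => lam _.
  by rewrite (big_pred1 (diagram n (parts lam))) // => D; rewrite eq_sym.
apply: leq_sum => D _; rewrite -/(F D); case: (posnP (F D)) => [-> //|F0].
have c0 : cnt (@wt n) n D != 0 by apply: contraTneq F0; rewrite /F => ->; rewrite muln0.
have [iD Dn] := cnt_neq0 c0; have [l [sl dE]] := ideal_parts iD.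
rewrite Dn in sl; have [nu nuE] := strict_partition_spart sl.
by rewrite (bigD1 nu) /= ?nuE ?dE // leq_addr.
Qed.

Lemma std_tab_exists (lam : spart n) : exists T : std_tab lam, True.
Proof.
have iD := diagram_ideal n (strict_partition_strict (partsP lam)).
have := @cnt_gt0 n n (fun=> 1) _ (fun=> isT) iD (card_diagram (leqnn n) (partsP lam)).
by move=> /leq_trans/(_ (cnt_std lam))/card_gt0P[T _]; exists T.
Qed.

End TableauCount.

From mathcomp Require Import classical_sets functions.

Local Open Scope classical_set_scope.
Local Open Scope ring_scope.

(** * Subalgebras, subspaces and endomorphisms as types *)

Section Subtypes.
Variable C : fieldType.

(** The closure proof is an argument of the type, so that the algebra structure can be attached to
    it. *)
Definition sub_algT (A : algType C) (X : set A) of subalgebra X :=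
  {a : A | `[< X a >]}.

Definition sub_lmodT (V : lmodType C) (X : set V) of subspace X :=
  {v : V | `[< X v >]}.

End Subtypes.

Section SubAlg.
Variables (C : fieldType) (A : algType C) (X : set A) (hX : subalgebra X).

HB.instance Definition _ := SubChoice.on (sub_algT hX).

Lemma sub_algT_closed : GRing.subsemialg_closed (fun a : A => `[< X a >]).
Proof.
have [[X0 XL] X1 XM] := hX.
have E a : (a \in (fun a : A => `[< X a >])) = `[< X a >] by [].
split.
- by rewrite E; apply/asboolP.
- split; first by rewrite E; apply/asboolP.
  move=> a b; rewrite !E => /asboolP Xa /asboolP Xb; apply/asboolP.
  by have := XL 1 _ _ Xa Xb; rewrite scale1r.
- move=> k a; rewrite !E => /asboolP Xa; apply/asboolP.
  by have := XL k _ _ Xa X0; rewrite addr0.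
- by move=> a b; rewrite !E => /asboolP Xa /asboolP Xb; apply/asboolP; apply: XM.
Qed.

HB.instance Definition _ :=
  GRing.SubChoice_isSubAlgebra.Build C A _ (sub_algT hX) sub_algT_closed.

Definition sub_alg_val : sub_algT hX -> A := val.
HB.instance Definition _ := GRing.RMorphism.copy sub_alg_val
  (val : {rmorphism sub_algT hX -> A}).
HB.instance Definition _ := GRing.Linear.copy sub_alg_val
  (val : {linear sub_algT hX -> A}).

End SubAlg.
Arguments sub_alg_val {C A X} hX _.

Section SubLmod.
Variables (C : fieldType) (V : lmodType C) (X : set V) (hX : subspace X).

HB.instance Definition _ := SubChoice.on (sub_lmodT hX).

Lemma sub_lmodT_closed : GRing.subsemimod_closed (fun a : V => `[< X a >]).
Proof.
have [X0 XL] := hX.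
have E a : (a \in (fun a : V => `[< X a >])) = `[< X a >] by [].
split; first split.
- by rewrite E; apply/asboolP.
- move=> a b; rewrite !E => /asboolP Xa /asboolP Xb; apply/asboolP.
  by have := XL 1 _ _ Xa Xb; rewrite scale1r.
- move=> k a; rewrite !E => /asboolP Xa; apply/asboolP.
  by have := XL k _ _ Xa X0; rewrite addr0.
Qed.

HB.instance Definition _ :=
  GRing.SubChoice_isSubLmodule.Build C V _ (sub_lmodT hX) sub_lmodT_closed.

End SubLmod.

Section Endo.
Variables (C : fieldType) (V : lmodType C).

Definition endo := {f : V -> V | `[< linear f >]}.
Definition endo_fun (f : endo) : V -> V := sval f.
Coercion endo_fun : endo >-> Funclass.

Lemma endoP (f : endo) : linear f.
Proof. by case: f => f hf; apply/asboolP. Qed.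

Definition Endo (f : V -> V) (hf : linear f) : endo :=
  exist _ f (introT (asboolP _) hf).

Lemma endo_ext (f g : endo) : f =1 g -> f = g.
Proof.
case: f g => [f hf] [g hg] /= /funext fg.
rewrite /endo_fun /= in fg; subst g; congr exist; exact: bool_irrelevance.
Qed.

Lemma endoD (f : endo) : {morph f : u v / u + v}.
Proof. by move=> u v; have := endoP f 1 u v; rewrite !scale1r. Qed.
Lemma endo0 (f : endo) : f 0 = 0.
Proof. by apply: (addIr (f 0)); rewrite -endoD !add0r. Qed.
Lemma endoZ (f : endo) k u : f (k *: u) = k *: f u.
Proof. by have := endoP f k u 0; rewrite endo0 !addr0. Qed.
Lemma endoN (f : endo) u : f (- u) = - f u.
Proof. by rewrite -scaleN1r endoZ scaleN1r. Qed.

HB.instance Definition _ := gen_eqMixin endo.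
HB.instance Definition _ := gen_choiceMixin endo.

Fact endo_zero_lin : linear (fun _ : V => 0 : V).
Proof. by move=> k u v; rewrite scaler0 addr0. Qed.
Fact endo_add_lin (f g : endo) : linear (fun u => f u + g u).
Proof. by move=> k u v; rewrite !endoP scalerDr addrACA. Qed.
Fact endo_opp_lin (f : endo) : linear (fun u => - f u).
Proof. by move=> k u v; rewrite endoP opprD scalerN. Qed.
Fact endo_one_lin : linear (fun u : V => u).
Proof. by []. Qed.
Fact endo_mul_lin (f g : endo) : linear (fun u => f (g u)).
Proof. by move=> k u v; rewrite !endoP. Qed.
Fact endo_scale_lin (k : C) (f : endo) : linear (fun u => k *: f u).
Proof. by move=> l u v; rewrite endoP scalerDr !scalerA mulrC. Qed.

Definition endo_zero := Endo endo_zero_lin.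
Definition endo_add f g := Endo (endo_add_lin f g).
Definition endo_opp f := Endo (endo_opp_lin f).
Definition endo_one := Endo endo_one_lin.
Definition endo_mul f g := Endo (endo_mul_lin f g).
Definition endo_scale k f := Endo (endo_scale_lin k f).

Fact endo_addA : associative endo_add.
Proof. by move=> f g h; apply: endo_ext => u /=; rewrite /= addrA. Qed.
Fact endo_addC : commutative endo_add.
Proof. by move=> f g; apply: endo_ext => u /=; rewrite /= addrC. Qed.
Fact endo_add0 : left_id endo_zero endo_add.
Proof. by move=> f; apply: endo_ext => u /=; rewrite /= add0r. Qed.
Fact endo_addN : left_inverse endo_zero endo_opp endo_add.
Proof. by move=> f; apply: endo_ext => u /=; rewrite /= addNr. Qed.

HB.instance Definition _ :=
  GRing.isZmodule.Build endo endo_addA endo_addC endo_add0 endo_addN.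

End Endo.

Section EndoAlg.
Variables (C : fieldType) (V : lmodType C) (v0 : V) (hv0 : v0 != 0).

(** A nonzero vector is recorded in the type because the ring structure requires 1 to differ from
    0. *)
Definition endo_alg of v0 != 0 := endo V.
Local Notation EV := (endo_alg hv0).

HB.instance Definition _ := GRing.Zmodule.on EV.

Fact endo_mulA : associative (@endo_mul _ V : EV -> EV -> EV).
Proof. by move=> f g h; apply: endo_ext. Qed.
Fact endo_mul1 : left_id (endo_one V) (@endo_mul _ V : EV -> EV -> EV).
Proof. by move=> f; apply: endo_ext. Qed.
Fact endo_mulr1 : right_id (endo_one V) (@endo_mul _ V : EV -> EV -> EV).
Proof. by move=> f; apply: endo_ext. Qed.
Fact endo_mulDl : left_distributive (@endo_mul _ V : EV -> EV -> EV) +%R.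
Proof. by move=> f g h; apply: endo_ext. Qed.
Fact endo_mulDr : right_distributive (@endo_mul _ V : EV -> EV -> EV) +%R.
Proof. by move=> f g h; apply: endo_ext => u /=; apply: endoD. Qed.
Fact endo_1neq0 : (endo_one V : EV) != 0.
Proof.
apply/eqP => /(congr1 (fun f : endo V => f v0)) /= h.
by move: hv0; rewrite [v0]h eqxx.
Qed.

HB.instance Definition _ := GRing.Zmodule_isNzRing.Build EV
  endo_mulA endo_mul1 endo_mulr1 endo_mulDl endo_mulDr endo_1neq0.

Fact endo_scaleA (a b : C) (f : EV) :
  endo_scale a (endo_scale b f) = endo_scale (a * b) f.
Proof. by apply: endo_ext => u /=; rewrite /= scalerA. Qed.
Fact endo_scale1 : left_id 1 (@endo_scale _ V : C -> EV -> EV).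
Proof. by move=> f; apply: endo_ext => u /=; rewrite /= scale1r. Qed.
Fact endo_scaleDr : right_distributive (@endo_scale _ V : C -> EV -> EV) +%R.
Proof. by move=> k f g; apply: endo_ext => u /=; rewrite /= scalerDr. Qed.
Fact endo_scaleDl (f : EV) :
  {morph (@endo_scale _ V : C -> EV -> EV)^~ f : a b / a + b}.
Proof. by move=> a b; apply: endo_ext => u /=; rewrite /= scalerDl. Qed.

HB.instance Definition _ := GRing.Zmodule_isLmodule.Build C EV
  endo_scaleA endo_scale1 endo_scaleDr endo_scaleDl.

Fact endo_scaleAl (k : C) (f g : EV) : k *: (f * g) = (k *: f) * g.
Proof. exact: endo_ext. Qed.
HB.instance Definition _ := GRing.Lmodule_isLalgebra.Build C EV endo_scaleAl.
Fact endo_scaleAr (k : C) (f g : EV) : k *: (f * g) = f * (k *: g).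
Proof. by apply: endo_ext => u /=; rewrite /= -endoZ. Qed.
HB.instance Definition _ := GRing.Lalgebra_isAlgebra.Build C EV endo_scaleAr.


Lemma endo_algM (f g : EV) u : endo_fun (f * g) u = endo_fun f (endo_fun g u).
Proof. by []. Qed.
Lemma endo_algD (f g : EV) u : endo_fun (f + g) u = endo_fun f u + endo_fun g u.
Proof. by []. Qed.
Lemma endo_algZ k (f : EV) u : endo_fun (k *: f) u = k *: endo_fun f u.
Proof. by []. Qed.
Lemma endo_algN (f : EV) u : endo_fun (- f) u = - endo_fun f u.
Proof. by []. Qed.
Lemma endo_alg0 u : endo_fun (0 : EV) u = 0.
Proof. by []. Qed.
Lemma endo_alg1 u : endo_fun (1 : EV) u = u.
Proof. by []. Qed.

End EndoAlg.

Section Lrmorphism.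
Variables (C : fieldType) (A B : algType C) (f : {lrmorphism A -> B}).

Lemma lrM a b : f (a * b) = f a * f b. Proof. exact: rmorphM. Qed.
Lemma lrD a b : f (a + b) = f a + f b. Proof. exact: rmorphD. Qed.
Lemma lrB a b : f (a - b) = f a - f b. Proof. exact: rmorphB. Qed.
Lemma lrN a : f (- a) = - f a. Proof. exact: rmorphN. Qed.
Lemma lr1 : f 1 = 1. Proof. exact: rmorph1. Qed.
Lemma lr0 : f 0 = 0. Proof. exact: rmorph0. Qed.
Lemma lrZ k a : f (k *: a) = k *: f a. Proof. exact: linearZ. Qed.
Lemma lrP k a b : f (k *: a + b) = k *: f a + f b. Proof. exact: linearP. Qed.
Lemma lrX a m : f (a ^+ m) = f a ^+ m. Proof. exact: rmorphXn. Qed.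
Lemma lr_sum (I : Type) (r : seq I) (P : pred I) (F : I -> A) :
  f (\sum_(i <- r | P i) F i) = \sum_(i <- r | P i) f (F i).
Proof. exact: rmorph_sum. Qed.
Lemma lr_prod (I : Type) (r : seq I) (P : pred I) (F : I -> A) :
  f (\prod_(i <- r | P i) F i) = \prod_(i <- r | P i) f (F i).
Proof. exact: rmorph_prod. Qed.

End Lrmorphism.

(** * Generators, presentations and parity *)

Section Generation.
Variable C : fieldType.

Definition generates (A : algType C) (I : Type) (g : I -> A) : Prop :=
  forall X : set A, subalgebra X -> (forall i, X (g i)) -> forall a, X a.

Lemma subspaceD (V : lmodType C) (X : set V) u v :
  subspace X -> X u -> X v -> X (u + v).
Proof. by case=> _ XL Xu Xv; have := XL 1 _ _ Xu Xv; rewrite scale1r. Qed.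

Lemma subspaceZ (V : lmodType C) (X : set V) k u :
  subspace X -> X u -> X (k *: u).
Proof. by case=> X0 XL Xu; have := XL k _ _ Xu X0; rewrite addr0. Qed.

Lemma subspaceN (V : lmodType C) (X : set V) u : subspace X -> X u -> X (- u).
Proof. by move=> hX /(subspaceZ (-1) hX); rewrite scaleN1r. Qed.

Lemma subspace_sum (V : lmodType C) (X : set V) (I : Type) (r : seq I)
    (P : pred I) (F : I -> V) :
  subspace X -> (forall i, P i -> X (F i)) -> X (\sum_(i <- r | P i) F i).
Proof.
by move=> hX hF; apply: big_ind => // [|u v]; [case: hX | apply: subspaceD].
Qed.

Lemma smallest_subspace (V : lmodType C) (G : set V) :
  subspace (smallest (@subspace _ V) G).
Proof.
split=> [X [[X0 _] _] //|k u v hu hv X [hX GX]].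
by case: (hX) => _ XL; apply: XL; [apply: hu | apply: hv].
Qed.

Lemma smallest_subalgebra (A : algType C) (G : set A) :
  subalgebra (smallest (@subalgebra _ A) G).
Proof.
split; first split.
- by move=> X [[[X0 _] _ _] _].
- by move=> k u v hu hv X [hX GX]; case: (hX) => [[_ XL] _ _]; apply: XL;
    [apply: hu | apply: hv].
- by move=> X [[_ X1 _] _].
- by move=> u v hu hv X [hX GX]; case: (hX) => _ _ XM; apply: XM;
    [apply: hu | apply: hv].
Qed.

(** The elements [a] such that multiplication by [a] preserves [P] form a subalgebra that contains
    the generators. *)
Lemma gen_ind (A : algType C) (I : Type) (g : I -> A) (P : set A) :
  generates g -> subspace P -> P 1 ->
  (forall i a, P a -> P (g i * a)) -> forall a, P a.
Proof.
move=> gG hP P1 Pg a; rewrite -[a]mulr1.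
suff: forall b, P b -> P (a * b) by apply.
apply: (gG (fun x : A => forall b, P b -> P (x * b))); last exact: Pg.
split; first split.
- by move=> b _; rewrite mul0r; case: hP.
- move=> k u v hu hv b Pb; rewrite mulrDl -scalerAl.
  by apply: subspaceD (hv _ Pb) => //; apply: subspaceZ (hu _ Pb).
- by move=> b; rewrite mul1r.
- by move=> u v hu hv b Pb; rewrite -mulrA; apply/hu/hv.
Qed.

Lemma gen_ind_right (A : algType C) (I : Type) (g : I -> A) (P : set A) :
  generates g -> subspace P -> P 1 ->
  (forall i a, P a -> P (a * g i)) -> forall a, P a.
Proof.
move=> gG hP P1 Pg a; rewrite -[a]mul1r.
suff: forall b, P b -> P (b * a) by apply.
apply: (gG (fun x : A => forall b, P b -> P (b * x))); last exact: Pg.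
split; first split.
- by move=> b _; rewrite mulr0; case: hP.
- move=> k u v hu hv b Pb; rewrite mulrDr -scalerAr.
  by apply: subspaceD (hv _ Pb) => //; apply: subspaceZ (hu _ Pb).
- by move=> b; rewrite mulr1.
- by move=> u v hu hv b Pb; rewrite mulrA; apply/hv/hu.
Qed.

(** The universal map into a subalgebra [X] that contains the generators, followed by the inclusion,
    is the identity by uniqueness. The first hypothesis says that the relations hold in [X] because
    they hold in [A]. *)
Lemma presented_generates (I : Type)
    (rels : forall B : algType C, (I -> B) -> Prop)
    (A : algType C) (g : I -> A) :
  (forall (B B' : algType C) (f : {lrmorphism B -> B'}) (h : I -> B),
     injective f -> rels B' (f \o h) -> rels B h) ->
  presented rels g -> generates g.
Proof.
move=> relsI [rg univ] X hX gX a.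
pose g' i : sub_algT hX := exist _ (g i) (introT (asboolP _) (gX i)).
have rg' : rels (sub_algT hX) g'.
  have := @relsI _ _ (sub_alg_val hX : {lrmorphism sub_algT hX -> A}) g' val_inj.
  by apply; exact: rg.
have [f [fg _]] := univ _ _ rg'.
have [f0 [f0g f0U]] := univ _ _ rg.
have h1 : (sub_alg_val hX \o f : {lrmorphism A -> A}) =1 f0.
  by apply: f0U => i /=; rewrite fg.
have h2 : (idfun : {lrmorphism A -> A}) =1 f0 by apply: f0U.
have -> : a = val (f a) by rewrite -[LHS]/(idfun a) h2 -h1.
by case: (f a) => x /= /asboolP.
Qed.

Lemma spin_rels_inj n (B B' : algType C) (f : {lrmorphism B -> B'})
    (t : 'I_n.-1 -> B) :
  injective f -> spin_rels (f \o t) -> spin_rels t.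
Proof.
move=> fI [h1 h2 h3]; split=> [a|a b ab|a b ab]; apply: fI.
- by rewrite rmorphXn rmorph1; apply: h1.
- by rewrite !rmorphM; apply: h2.
- by rewrite rmorphN !rmorphM; apply: h3.
Qed.

Lemma clifford_rels_inj n (B B' : algType C) (f : {lrmorphism B -> B'})
    (c : 'I_n -> B) :
  injective f -> clifford_rels (f \o c) -> clifford_rels c.
Proof.
move=> fI [h1 h2]; split=> [a|a b ab]; apply: fI.
- by rewrite rmorphXn rmorphN1; apply: h1.
- by rewrite rmorphN !rmorphM; apply: h2.
Qed.

Lemma gen_ext (A B : algType C) (I : Type) (g : I -> A)
    (f f' : {lrmorphism A -> B}) :
  generates g -> (forall i, f (g i) = f' (g i)) -> f =1 f'.
Proof.
move=> gG ff'; apply: (gG (fun a => f a = f' a)) => //; split; first split.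
- by rewrite !raddf0.
- by move=> k u v hu hv; rewrite !lrP hu hv.
- by rewrite !rmorph1.
- by move=> u v hu hv; rewrite !lrM hu hv.
Qed.

Lemma parity_subspace (A : algType C) (I : Type) (g : I -> A) i :
  subspace (parity_part g i).
Proof. exact: smallest_subspace. Qed.

Lemma parity_word (A : algType C) (I : Type) (g : I -> A) (w : seq I) :
  parity_part g (odd (size w)) (\prod_(k <- w) g k).
Proof. by apply: sub_gen_smallest; exists w. Qed.

Arguments parity_word {A I} g w.

Lemma parity_ind (A : algType C) (I : Type) (g : I -> A) i (P : set A) :
  subspace P ->
  (forall w : seq I, odd (size w) = i -> P (\prod_(k <- w) g k)) ->
  forall a, parity_part g i a -> P a.
Proof.
by move=> hP Pw a; apply; split=> // x [w [ow ->]]; apply: Pw.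
Qed.

Lemma parity_gen (A : algType C) (I : Type) (g : I -> A) i :
  parity_part g true (g i).
Proof. by have := parity_word g [:: i]; rewrite big_seq1. Qed.

Arguments parity_gen {A I} g i.

Lemma parity1 (A : algType C) (I : Type) (g : I -> A) :
  parity_part g false 1.
Proof. by have := parity_word g [::]; rewrite big_nil. Qed.

Arguments parity1 {A I} g.

Lemma parityM (A : algType C) (I : Type) (g : I -> A) i j a b :
  parity_part g i a -> parity_part g j b -> parity_part g (i (+) j) (a * b).
Proof.
move=> ga gb; move: a ga; apply: parity_ind => [|w ow].
  split=> [|k u v hu hv]; first by rewrite mul0r; case: (parity_subspace g (i (+) j)).
  rewrite mulrDl -scalerAl; apply: subspaceD hv; first exact: parity_subspace.
  by apply: subspaceZ hu; exact: parity_subspace.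
move: b gb; apply: parity_ind => [|w' ow'].
  split=> [|k u v hu hv]; first by rewrite mulr0; case: (parity_subspace g (i (+) j)).
  rewrite mulrDr -scalerAr; apply: subspaceD hv; first exact: parity_subspace.
  by apply: subspaceZ hu; exact: parity_subspace.
by rewrite -big_cat -ow -ow' -oddD -size_cat; apply: parity_word.
Qed.

Lemma parity_split (A : algType C) (I : Type) (g : I -> A) :
  generates g -> forall a : A, exists a0 a1,
    [/\ parity_part g false a0, parity_part g true a1 & a = a0 + a1].
Proof.
move=> gG.
have Z i : parity_part g i 0 by case: (parity_subspace g i).
apply: (gen_ind gG).
- split=> [|k u v [u0 [u1 [h0 h1 ->]]] [v0 [v1 [h0' h1' ->]]]].
    by exists 0, 0; split; rewrite ?addr0.
  exists (k *: u0 + v0), (k *: u1 + v1).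
  by split; [case: (parity_subspace g false) | case: (parity_subspace g true) |];
    rewrite ?scalerDr 1?addrACA //; auto.
- by exists 1, 0; split; rewrite ?addr0 //; apply: parity1.
- move=> i a [a0 [a1 [h0 h1 ->]]]; exists (g i * a1), (g i * a0).
  split; last by rewrite mulrDr addrC.
  + exact: (parityM (parity_gen g i) h1).
  + exact: (parityM (parity_gen g i) h0).
Qed.

End Generation.

Arguments parity_word {C A I} g w.
Arguments parity_gen {C A I} g i.
Arguments parity1 {C A I} g.

(** * The Sergeev algebra by generators and relations *)

Section Relations.
Variables (C : fieldType) (n : nat).

Definition sergeev_rels (B : algType C) (t : 'I_n.-1 -> B) (c : 'I_n -> B) :
    Prop :=
  [/\ spin_rels t, clifford_rels c & forall a b, t a * c b = - (c b * t a)].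

Definition sergeev_gen (B : algType C) (t : 'I_n.-1 -> B) (c : 'I_n -> B)
    (g : 'I_n.-1 + 'I_n) : B :=
  match g with inl a => t a | inr b => c b end.

Variables (A : algType C) (t : 'I_n.-1 -> A) (c : 'I_n -> A).
Hypothesis hA : sergeev_algebra t c.

(** The universal bilinear map factors through the subspace [X], and by uniqueness the resulting
    endomorphism of [A] is the identity. *)
Lemma tensor_ind (T K : algType C) (t0 : 'I_n.-1 -> T) (c0 : 'I_n -> K)
    (iT : {lrmorphism T -> A}) (iK : {lrmorphism K -> A}) (X : set A) :
  graded_tensor t0 c0 iT iK -> subspace X ->
  (forall a b, X (iT a * iK b)) -> forall x, X x.
Proof.
move=> [_ univ] hX hab x.
pose beta a b : sub_lmodT hX := exist _ (iT a * iK b) (introT (asboolP _) (hab a b)).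
have b1 a : linear (beta a).
  by move=> k u v; apply: val_inj; rewrite /= lrP mulrDr -scalerAr.
have b2 b : linear (beta^~ b).
  by move=> k u v; apply: val_inj; rewrite /= lrP mulrDl -scalerAl.
have [h [hb _]] := univ _ _ b1 b2.
have [|| h0 [_ h0U]] := univ A (fun a b => iT a * iK b).
- by move=> a k u v; rewrite /= lrP mulrDr -scalerAr.
- by move=> b k u v; rewrite /= lrP mulrDl -scalerAl.
have e1 : (idfun : {linear A -> A}) =1 h0 by apply: h0U.
have e2 : (val \o h : {linear A -> A}) =1 h0 by apply: h0U => a b /=; rewrite hb.
have -> : x = val (h x) by rewrite -[LHS]/(idfun x) e1 -e2.
by case: (h x) => y /= /asboolP.
Qed.

Lemma sergeev_algebra_rels : sergeev_rels t c.
Proof.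
have [T [K [t0 [c0 [iT [iK [[spin _] [cliff _] [com _] tE cE]]]]]]] := hA.
split.
- have [h1 h2 h3] := spin; split=> [a|a b ab|a b ab]; rewrite !tE /=.
  + by rewrite -lrX h1 lr1.
  + by rewrite -!lrM h2.
  + by rewrite -!lrM h3 // lrN.
- have [h1 h2] := cliff; split=> [a|a b ab]; rewrite !cE /=.
  + by rewrite -lrX h1 lrN lr1.
  + by rewrite -!lrM h2 // lrN.
- move=> a b; rewrite tE cE /=.
  have := com true true _ _ (parity_gen t0 a) (parity_gen c0 b).
  by rewrite /= expr1 mulN1r => ->; rewrite opprK.
Qed.

Lemma sergeev_algebra_tensor : exists (T K : algType C)
    (t0 : 'I_n.-1 -> T) (c0 : 'I_n -> K)
    (iT : {lrmorphism T -> A}) (iK : {lrmorphism K -> A}),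
  [/\ presented (@spin_rels C n) t0 /\ presented (@clifford_rels C n) c0,
      generates t0, generates c0,
      graded_tensor t0 c0 iT iK & t =1 iT \o t0 /\ c =1 iK \o c0].
Proof.
have [T [K [t0 [c0 [iT [iK [pt pc gt tE cE]]]]]]] := hA.
exists T, K, t0, c0, iT, iK; split=> //.
- by apply: presented_generates pt => B B' f h; apply: spin_rels_inj.
- by apply: presented_generates pc => B B' f h; apply: clifford_rels_inj.
Qed.

Lemma sergeev_generates : generates (sergeev_gen t c).
Proof.
have [T [K [t0 [c0 [iT [iK [_ gT gK gt [tE cE]]]]]]]] := sergeev_algebra_tensor.
move=> X hX gX; have [hXs X1 XM] := hX.
have tX a : X (iT a).
  apply: (gT (fun a => X (iT a))) => [|i]; last first.
    by have := gX (inl i); rewrite /= tE.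
  split; first split.
  - by rewrite lr0; case: hXs.
  - by move=> k u v hu hv; rewrite lrP; case: hXs => _; apply.
  - by rewrite lr1.
  - by move=> u v hu hv; rewrite lrM; apply: XM.
have cX a : X (iK a).
  apply: (gK (fun a => X (iK a))) => [|i]; last first.
    by have := gX (inr i); rewrite /= cE.
  split; first split.
  - by rewrite lr0; case: hXs.
  - by move=> k u v hu hv; rewrite lrP; case: hXs => _; apply.
  - by rewrite lr1.
  - by move=> u v hu hv; rewrite lrM; apply: XM.
by apply: (tensor_ind gt hXs) => a b; apply: XM.
Qed.

Lemma linear_lr (U W : algType C) (f : {lrmorphism U -> W}) (y : W) :
  linear (fun a => f a * y).
Proof. by move=> k u v; rewrite lrP mulrDl -scalerAl. Qed.

(** The tensor product only yields a linear map [h] with [h (iT a * iK b)] equal to [fT a * fK b].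
    It is multiplicative because it commutes with left multiplication by each generator; for c_b
    this uses the sign rule for moving c_b across a homogeneous element. *)
Lemma sergeev_univ (B : algType C) (t' : 'I_n.-1 -> B) (c' : 'I_n -> B) :
  sergeev_rels t' c' ->
  exists f : {lrmorphism A -> B},
    (forall a, f (t a) = t' a) /\ (forall b, f (c b) = c' b).
Proof.
move=> [sp cl anti].
have [T [K [t0 [c0 [iT [iK [[[_ pt] [_ pc]] gT gK gt [tE cE]]]]]]]] :=
  sergeev_algebra_tensor.
have [fT [fTE _]] := pt _ _ sp.
have [fK [fKE _]] := pc _ _ cl.
have fcom i a b : parity_part t0 i a ->
    fK (c0 b) * fT a = (-1) ^+ i * (fT a * fK (c0 b)).
  move: a; apply: parity_ind => [|w <-].
    split=> [|k u v hu hv]; first by rewrite lr0 mulr0 mul0r mulr0.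
    by rewrite lrP mulrDr mulrDl mulrDr -!scalerAl -!scalerAr hu hv.
  elim: w => [|x w IH]; first by rewrite big_nil lr1 expr0 mul1r mulr1 mul1r.
  rewrite big_cons lrM mulrA fTE fKE.
  have -> : c' b * t' x = - (t' x * c' b) by rewrite anti opprK.
  rewrite mulNr -[t' x * c' b * _]mulrA -fKE IH /= signrN mulNr !mulrA.
  by rewrite (commr_sign (t' x)).
have [||h [hab _]] := gt.2 B (fun a b => fT a * fK b).
- by move=> a k u v; rewrite /= lrP mulrDr -scalerAr.
- by move=> b k u v; rewrite /= lrP mulrDl -scalerAl.
have hP k u v : h (k *: u + v) = k *: h u + h v by exact: linearP.
have h1 : h 1 = 1 by have := hab 1 1; rewrite !lr1 !mulr1.
have ht a x : h (t a * x) = t' a * h x.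
  move: x; apply: (tensor_ind gt).
    split=> [|k u v hu hv]; first by rewrite mulr0 linear0 mulr0.
    by rewrite mulrDr -scalerAr !hP hu hv mulrDr -scalerAr.
  by move=> u v; rewrite mulrA tE -lrM !hab lrM fTE mulrA.
have hc b x : h (c b * x) = c' b * h x.
  move: x; apply: (tensor_ind gt).
    split=> [|k u v hu hv]; first by rewrite mulr0 linear0 mulr0.
    by rewrite mulrDr -scalerAr !hP hu hv mulrDr -scalerAr.
  (* The sign depends on the parity of the left factor, so that factor is split into homogeneous
     parts. *)
  have pp i u v : parity_part t0 i u ->
      h (c b * (iT u * iK v)) = c' b * h (iT u * iK v).
    move=> pu; rewrite mulrA cE /=.
    rewrite (gt.1 _ _ _ _ pu (parity_gen c0 b)) andbT hab mulrA -fKE (fcom i) //.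
    case: {pu} i; rewrite ?expr1 ?expr0 ?mulN1r ?mul1r ?mulNr -!mulrA -!lrM.
      by rewrite linearN hab.
    by rewrite hab.
  move=> u v; have [u0 [u1 [p0 p1 ->]]] := parity_split gT u.
  rewrite lrD mulrDl mulrDr !linearD /= !(pp _ _ _ p0) !(pp _ _ _ p1).
  by rewrite mulrDr.
have hM : {morph h : x y / x * y}.
  move=> x y; move: x; apply: (gen_ind sergeev_generates).
  - split=> [|k u v hu hv]; first by rewrite mul0r linear0 mul0r.
    by rewrite mulrDl -scalerAl !hP hu hv mulrDl -scalerAl.
  - by rewrite mul1r h1 mul1r.
  - by move=> [i|i] a IH /=; rewrite -mulrA ?ht ?hc IH mulrA.
pose hm := GRing.isMonoidMorphism.Build A B h (h1, hM).
pose f : {lrmorphism A -> B} := HB.pack (GRing.Linear.sort h) hm (GRing.Linear.class h).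
exists f; split=> i.
- by have := ht i 1; rewrite h1 !mulr1.
- by have := hc i 1; rewrite h1 !mulr1.
Qed.

End Relations.

(** * Monomials of the Clifford algebra *)

Section CliffordWords.
Variables (C : fieldType) (n : nat).

Definition cliff_mon (B : algType C) (c : 'I_n -> B) (S : {set 'I_n}) : B :=
  \prod_(i < n | i \in S) c i.

(** The symmetric difference with the singleton of [a]: up to sign, the effect of left
    multiplication by c_a on monomials. *)
Definition flip (a : 'I_n) (S : {set 'I_n}) : {set 'I_n} :=
  finset (fun i => (i \in S) (+) (i == a)).

Lemma flipK a : involutive (flip a).
Proof. by move=> S; apply/setP => i; rewrite !inE -addbA addbb addbF. Qed.

Variables (B : algType C) (c : 'I_n -> B).
Hypothesis hc : clifford_rels c.

Lemma cliff_sq a : c a * c a = -1.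
Proof. by case: hc => h _; rewrite -expr2 h. Qed.

Lemma cliff_anti a b : a != b -> c a * c b = - (c b * c a).
Proof. by case: hc => _; apply. Qed.

Lemma cliff_diff_sq a b : a != b -> (c a - c b) * (c a - c b) = - 2.
Proof.
move=> ab; rewrite mulrBl !mulrBr !cliff_sq (cliff_anti ab) opprK.
by rewrite opprB addrACA subrr addr0 -opprD -mulr2n.
Qed.

Lemma cliff_mon_flip a S :
  exists s : bool, c a * cliff_mon c S = (-1) ^+ s *: cliff_mon c (flip a S).
Proof.
rewrite /cliff_mon; have: a \in index_enum 'I_n by rewrite mem_index_enum.
elim: (index_enum 'I_n) (index_enum_uniq 'I_n) => //= x r IH /andP[xr ur].
rewrite inE => /orP[/eqP ->|ar].
  have E : \prod_(i <- r | i \in flip x S) c i = \prod_(i <- r | i \in S) c i.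
    rewrite !(big_mkcond (fun i => i \in _)) !big_seq; apply: eq_bigr => i ir.
    by rewrite inE (_ : i == x = false) ?addbF //; apply: contraNF xr => /eqP <-.
  rewrite !big_cons E !inE eqxx addbT; case: (x \in S) => /=.
    by exists true; rewrite mulrA cliff_sq scaleN1r mulN1r.
  by exists false; rewrite scale1r.
have [s Es] := IH ur ar; rewrite !big_cons inE.
have ax : a != x by apply: contraNneq xr => <-.
rewrite (eq_sym x) (negbTE ax) addbF; case: ifP => _; last by exists s.
exists (~~ s); rewrite mulrA cliff_anti // mulNr -mulrA Es signrN scaleNr.
by rewrite scalerAr.
Qed.

Lemma cliff_mon0 : cliff_mon c finset.set0 = 1.
Proof. by rewrite /cliff_mon big_pred0 // => i; rewrite inE. Qed.

Lemma cliff_mon1 a : cliff_mon c [set a]%SET = c a.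
Proof. by rewrite /cliff_mon (big_pred1 a) // => i; rewrite inE. Qed.

Lemma cliff_mon_linv S : exists y, y * cliff_mon c S = 1 /\ cliff_mon c S * y = 1.
Proof.
rewrite /cliff_mon; apply: (big_ind (fun z : B => exists y, y * z = 1 /\ z * y = 1)).
- by exists 1; rewrite mulr1.
- move=> u v [u' [hu hu']] [v' [hv hv']]; exists (v' * u').
  by rewrite mulrA -(mulrA v') hu mulr1 hv mulrA -(mulrA u) hv' mulr1.
- by move=> i _; exists (- c i); rewrite mulNr mulrN cliff_sq opprK.
Qed.

Lemma cliff_span : generates c ->
  forall x, exists k : {set 'I_n} -> C, x = \sum_S k S *: cliff_mon c S.
Proof.
move=> cG; apply: (gen_ind cG).
- split=> [|k u v [ku ->] [kv ->]].
    by exists (fun=> 0); rewrite big1 // => S _; rewrite scale0r.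
  exists (fun S => k * ku S + kv S); rewrite scaler_sumr -big_split /=.
  by apply: eq_bigr => S _; rewrite scalerA -scalerDl.
- exists (fun S => (S == finset.set0)%:R); rewrite (bigD1 finset.set0) //= big1 ?addr0.
    by rewrite eqxx scale1r cliff_mon0.
  by move=> S /negbTE ->; rewrite scale0r.
move=> a x [k ->]; have [s hs] := choice (cliff_mon_flip a).
exists (fun S => k (flip a S) * (-1) ^+ s (flip a S)).
rewrite mulr_sumr (reindex_inj (inv_inj (flipK a))) /=; apply: eq_bigr => S _.
by rewrite -scalerAr hs flipK scalerA.
Qed.

Definition sign_flip (a : 'I_n) (f : {lrmorphism B -> B}) : Prop :=
  forall b, f (c b) = (-1) ^+ (b == a) *: c b.

Lemma sign_flip_mon a f S :
  sign_flip a f -> f (cliff_mon c S) = (-1) ^+ (a \in S) *: cliff_mon c S.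
Proof.
move=> fa; rewrite /cliff_mon lr_prod (eq_bigr _ (fun i _ => fa i)) scaler_prod.
congr (_ *: _); case: (boolP (a \in S)) => aS.
  rewrite (bigD1 a) //= eqxx expr1 big1 ?mulr1 // => i /andP[_ /negbTE ->].
  by rewrite expr0.
rewrite big1 // => i iS; rewrite (_ : i == a = false) //.
by apply: contraNF aS => /eqP <-.
Qed.

(* The sign changes c_a -> -c_a separate the monomials. *)
Lemma cliff_mon_free (k : {set 'I_n} -> C) :
  (2 : C) != 0 -> (forall a, exists f, sign_flip a f) ->
  \sum_S k S *: cliff_mon c S = 0 -> forall S, k S = 0.
Proof.
move=> two_neq0 hflip k0 S0.
pose agree r (S : {set 'I_n}) := all (fun a : 'I_n => (a \in S) == (a \in S0)) r.
have H (r : seq 'I_n) : \sum_(S | agree r S) k S *: cliff_mon c S = 0.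
  elim: r => [|a r IH] /=; first by rewrite -[RHS]k0; apply: eq_bigl.
  have [f fa] := hflip a.
  suff /eqP: (2 : C) *: (\sum_(S | agree (a :: r) S) k S *: cliff_mon c S) = 0.
    by rewrite scaler_eq0 (negbTE two_neq0) => /eqP.
  have: \sum_(S | agree r S) k S *: cliff_mon c S +
    (-1) ^+ (a \in S0) *: f (\sum_(S | agree r S) k S *: cliff_mon c S) == 0 by rewrite IH lr0 scaler0 addr0.
  set G := (2 : C) *: _; rewrite lr_sum scaler_sumr -big_split /= (bigID (fun S : {set 'I_n} => (a \in S) == (a \in S0))) /=.
  rewrite [X in _ + X == 0]big1 ?addr0; last first.
    move=> S /andP[_ aS]; rewrite lrZ (sign_flip_mon _ fa) !scalerA.
    rewrite [X in _ + X *: _](_ : _ = - k S); last first.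
      by move: aS; case: (a \in S); case: (a \in S0) => //= _;
        rewrite expr0 expr1 ?mul1r ?mulr1 ?mulrN1 ?mulN1r.
    by rewrite scaleNr addrN.
  move=> /eqP E; rewrite /G scaler_sumr; apply: etrans E; apply: eq_big => [S|S].
    by rewrite andbC.
  move=> /andP[/eqP aS _]; rewrite lrZ (sign_flip_mon _ fa) aS !scalerA.
  rewrite mulrAC -expr2 sqrr_sign mul1r -scalerDl.
  by rewrite mulr_natl mulr2n.
have := H (enum 'I_n); rewrite (big_pred1 S0) => [E|S].
  have [y [_ yK]] := cliff_mon_linv S0.
  have : k S0 *: (1 : B) = 0 by rewrite -yK scalerAl E mul0r.
  by move/eqP; rewrite scaler_eq0 oner_eq0 orbF => /eqP.
apply/allP/eqP => [h|-> //]; apply/setP => i.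
by apply/eqP/h; rewrite mem_enum.
Qed.

End CliffordWords.

(** * Normal words of the spin symmetric group algebra *)

Section SpinSpan.
Variables (C : fieldType) (N : nat) (B : algType C) (u : nat -> B).
Hypothesis u_sq : forall i, (i < N)%N -> u i * u i = 1.
Hypothesis u_braid : forall i, (i.+1 < N)%N ->
  u i * u i.+1 * u i = u i.+1 * u i * u i.+1.
Hypothesis u_anti : forall i j, (i.+1 < j)%N -> (j < N)%N ->
  u i * u j = - (u j * u i).

Local Notation span s := (smallest (@subspace C B) [set` s]).

(** The product u_k u_(k-1) ... of [l] factors with decreasing index. For l = 0, ..., k + 1 these
    correspond to coset representatives of a symmetric group in the next one. *)
Fixpoint run (k l : nat) : B :=
  if l is l'.+1 then run k l' * u (k - l') else 1.

Fixpoint spin_words (k : nat) : seq B :=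
  if k is k'.+1
  then [seq w * run k' l | w <- spin_words k', l <- iota 0 k'.+2]
  else [:: 1].

Lemma spin_wordsS k :
  spin_words k.+1 = allpairs (fun w l => w * run k l) (spin_words k) (iota 0 k.+2).
Proof. by []. Qed.

Lemma size_spin_words k : size (spin_words k) = k.+1`!.
Proof.
elim: k => // k IH; rewrite factS -IH -[in RHS](size_iota 0 k.+2) mulnC.
by rewrite -(size_allpairs (fun w l => w * run k l)).
Qed.

(** The index [i] differs by at least 2 from all indices of the run. *)
Lemma run_low k l i : (k < N)%N -> (l <= k)%N -> (i + l < k)%N ->
  exists s : bool, run k l * u i = (-1) ^+ s *: (u i * run k l).
Proof.
move=> kN; elim: l => [|l IH] lk ilk.
  by exists false; rewrite mul1r mulr1 scale1r.
have [||s Es] := IH; [lia | lia |].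
exists (~~ s); rewrite /= -mulrA.
have -> : u (k - l)%N * u i = - (u i * u (k - l)%N).
  by rewrite (@u_anti i (k - l)%N) ?opprK //; lia.
by rewrite mulrN (mulrA (run k l)) Es -scalerAl -mulrA signrN scaleNr.
Qed.

(** Here u_i and u_(i-1) both occur in the run. The new factor anticommutes past the smaller
    indices, one braid relation turns it into u_(i-1), and this moves to the front by [run_low]. *)
Lemma run_high k l i : (k < N)%N -> (l <= k.+1)%N -> (i <= k)%N ->
  (k.+1 < i + l)%N ->
  exists s : bool, run k l * u i = (-1) ^+ s *: (u i.-1 * run k l).
Proof.
move=> kN; elim: l => [|l IH] lk ik kil; first by lia.
have [E|kil'] : ((i + l = k.+1) \/ (k.+1 < i + l))%N by lia.
  case: l E lk kil {IH} => [|l] E lk kil; first by lia.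
  have [s Es] := @run_low k l i.-1 kN ltac:(lia) ltac:(lia).
  exists s; rewrite /= (_ : (k - l = i)%N); last lia.
  rewrite (_ : (k - l.+1 = i.-1)%N); last lia.
  have := @u_braid i.-1; rewrite prednK; last lia.
  move=> /(_ ltac:(lia)) br.
  by rewrite -!mulrA (mulrA (u i)) -br !mulrA Es -!scalerAl -!mulrA.
have [|||s Es] := IH; [lia | lia | lia |].
exists (~~ s); rewrite /= -mulrA.
have -> : u (k - l)%N * u i = - (u i * u (k - l)%N).
  by rewrite (@u_anti (k - l)%N i) ?opprK //; lia.
by rewrite mulrN (mulrA (run k l)) Es -scalerAl -mulrA signrN scaleNr.
Qed.

Lemma spin_words_mul k w l :
  span (spin_words k) w -> (l <= k.+1)%N -> span (spin_words k.+1) (w * run k l).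
Proof.
move=> hw lk; move: w hw; apply: smallest_sub.
  split=> [|c x y hx hy]; first by rewrite mul0r; case: (smallest_subspace [set` spin_words k.+1]).
  rewrite mulrDl -scalerAl; case: (smallest_subspace [set` spin_words k.+1]) => _; exact.
move=> w /= ws; apply: sub_gen_smallest.
suff: w * run k l \in spin_words k.+1 by [].
rewrite spin_wordsS.
by apply: (allpairs_f (fun w l => w * run k l)) => //; rewrite mem_iota.
Qed.

(** Multiplying a run by u_i moves the factor to the left if i + l < k, lengthens the run if i + l =
    k, shortens it if i + l = k + 1, and moves u_(i-1) to the left otherwise. *)
Lemma spin_words_closed k : (k <= N)%N ->
  span (spin_words k) 1 /\
  forall i w, (i < k)%N -> span (spin_words k) w -> span (spin_words k) (w * u i).
Proof.
elim: k => [|k IH] kN.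
  by split=> [|i w] //; apply: sub_gen_smallest; rewrite /= inE.
have [|k1 kw] := IH; first exact: ltnW.
split; first by rewrite -(mulr1 1); exact: (@spin_words_mul k 1 0 k1).
move=> i w ik hw; move: w hw; apply: smallest_sub.
  split=> [|c x y hx hy]; first by rewrite mul0r; case: (smallest_subspace [set` spin_words k.+1]).
  rewrite mulrDl -scalerAl; case: (smallest_subspace [set` spin_words k.+1]) => _; exact.
move=> w ws; have : w \in spin_words k.+1 by [].
rewrite spin_wordsS => /allpairsP[[v l] [vs lin ->]].
have {lin} lk : (l < k.+2)%N by move: lin; rewrite mem_iota.
rewrite [(v, l).1]/= [(v, l).2]/=; rewrite [(v, l).1]/= in vs; move: lk; rewrite ltnS => lk.
have hv : span (spin_words k) v by apply: sub_gen_smallest.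
have [ilk|ilk|E] := ltngtP (i + l) k.
- have [s Es] := @run_low k l i kN ltac:(lia) ilk.
  rewrite -mulrA Es -scalerAr; refine (subspaceZ _ (smallest_subspace _) _).
  by rewrite mulrA; exact: (spin_words_mul (kw i v ltac:(lia) hv) lk).
- have [E|ilk'] : ((i + l = k.+1) \/ (k.+1 < i + l))%N by lia.
    case: l E lk {ilk} => [|l] E lk; first by lia.
    rewrite [run k l.+1]/= -!mulrA (_ : (k - l = i)%N); last lia.
    by rewrite u_sq ?mulr1; [exact: (spin_words_mul hv (ltnW lk))|lia].
  have [s Es] := @run_high k l i kN ltac:(lia) ltac:(lia) ilk'.
  rewrite -mulrA Es -scalerAr; refine (subspaceZ _ (smallest_subspace _) _).
  by rewrite mulrA; exact: (spin_words_mul (kw i.-1 v ltac:(lia) hv) lk).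
- rewrite -mulrA (_ : run k l * u i = run k l.+1); last first.
    by rewrite /= (_ : (k - l = i)%N) //; lia.
  by apply: (@spin_words_mul _ _ l.+1 hv); lia.
Qed.

End SpinSpan.

(** * Spanning families and free families *)

Section Dimension.
Variables (C : fieldType) (V : lmodType C).

Lemma span_coef (I : finType) (s : I -> V) x :
  smallest (@subspace C V) [set y | exists i, y = s i] x ->
  exists k : I -> C, x = \sum_i k i *: s i.
Proof.
move: x; apply: smallest_sub => [|_ [i ->]].
  split=> [|k u v [ku ->] [kv ->]].
    by exists (fun=> 0); rewrite big1 // => i _; rewrite scale0r.
  exists (fun i => k * ku i + kv i); rewrite scaler_sumr -big_split /=.
  by apply: eq_bigr => i _; rewrite scalerA -scalerDl.
exists (fun j => (j == i)%:R); rewrite (bigD1 i) //= big1 ?addr0.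
  by rewrite eqxx scale1r.
by move=> j /negbTE ->; rewrite scale0r.
Qed.

Lemma sum_enum_rank (W : nmodType) (I : finType) (F : 'I_#|I| -> W) :
  \sum_i F (enum_rank i) = \sum_j F j.
Proof. by rewrite [RHS](reindex enum_rank) //; apply: onW_bij; apply: enum_rank_bij. Qed.

(** The coefficient matrix of [b] in terms of [s] has independent rows and at least as many rows as
    columns, hence full column rank. *)
Lemma free_big_spans (I J : finType) (s : I -> V) (b : J -> V) :
  (forall x, exists k : I -> C, x = \sum_i k i *: s i) ->
  (forall k : J -> C, \sum_j k j *: b j = 0 -> forall j, k j = 0) ->
  (#|I| <= #|J|)%N ->
  forall x, exists k : J -> C, x = \sum_j k j *: b j.
Proof.
move=> sS bF IJ.
have [m bm] := choice (fun j => sS (b j)).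
pose M : 'M[C]_(#|J|, #|I|) := \matrix_(j, i) m (enum_val j) (enum_val i).
have bE j : b j = \sum_i M (enum_rank j) i *: s (enum_val i).
  rewrite bm -sum_enum_rank; apply: eq_bigr => i _.
  by rewrite mxE !enum_rankK.
have Mfree : row_free M.
  apply/inj_row_free => v vM; apply/rowP => j; rewrite mxE.
  have := bF (fun j => v 0 (enum_rank j)) _ (enum_val j); rewrite enum_valK; apply.
  under eq_bigr => i _ do rewrite bE scaler_sumr.
  rewrite exchange_big /= big1 // => i _.
  under eq_bigr => k _ do rewrite scalerA.
  rewrite -scaler_suml (sum_enum_rank (fun k => v 0 k * M k i)).
  by move: vM => /rowP/(_ i); rewrite !mxE => ->; rewrite scale0r.
have Mfull : row_full M.
  by rewrite /row_full eqn_leq rank_leq_col (eqP Mfree).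
move=> x; have [k ->] := sS x.
pose r : 'rV[C]_#|I| := \row_i k (enum_val i).
have /submxP[v Ev] : (r <= M)%MS by apply: submx_full.
exists (fun j => v 0 (enum_rank j)).
under [RHS]eq_bigr => j _ do rewrite bE scaler_sumr.
rewrite exchange_big /= -sum_enum_rank; apply: eq_bigr => i _.
under eq_bigr => j _ do rewrite scalerA.
rewrite -scaler_suml enum_rankK (sum_enum_rank (fun k => v 0 k * M k _)).
by move: Ev => /rowP/(_ (enum_rank i)); rewrite !mxE enum_rankK => ->.
Qed.

End Dimension.

(** * A spanning family of n! 2^n elements *)

Section SergeevSpan.
Variables (C : fieldType) (n : nat).

Lemma spin_generated_span (T : algType C) (t0 : 'I_n.-1 -> T) :
  spin_rels t0 -> generates t0 ->
  exists w : seq T, size w = n.-1.+1`! /\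
    forall a, smallest (@subspace C T) [set` w] a.
Proof.
move=> [sq br an] tG; pose u i := if insub i is Some j then t0 j else 1.
have uE i (iN : (i < n.-1)%N) : u i = t0 (Ordinal iN) by rewrite /u insubT.
exists (spin_words u n.-1); split; first exact: size_spin_words.
have [||||h1 hm] := @spin_words_closed C n.-1 T u _ _ _ n.-1 => //.
- by move=> i iN; rewrite uE -expr2 sq.
- by move=> i iN; rewrite (uE i (ltnW iN)) (uE _ iN); apply: br.
- move=> i j ij jN; have iN := ltn_trans (ltnW ij) jN.
  by rewrite (uE i iN) (uE j jN); apply: an; rewrite /= ij.
apply: (gen_ind_right tG) => //; first exact: smallest_subspace.
by move=> i a ha; have := hm i a (ltn_ord i) ha; rewrite (uE i (ltn_ord i)) (_ : Ordinal _ = i) //; apply: val_inj.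
Qed.

Variables (A : algType C) (t : 'I_n.-1 -> A) (c : 'I_n -> A).
Hypothesis hA : sergeev_algebra t c.

Lemma sergeev_span : (0 < n)%N ->
  exists s : 'I_(n`!) * {set 'I_n} -> A,
    forall x, exists k : 'I_(n`!) * {set 'I_n} -> C, x = \sum_i k i *: s i.
Proof.
move=> n_gt0.
have [T [K [t0 [c0 [iT [iK [[[sp _] [cl _]] gT gK gt _]]]]]]] :=
  sergeev_algebra_tensor hA.
have [w [sw ws]] := spin_generated_span sp gT; rewrite prednK // in sw.
exists (fun i : 'I_(n`!) * {set 'I_n} => iT w`_(nat_of_ord i.1) * iK (cliff_mon c0 i.2)) => x; apply: span_coef.
set X := smallest _ _; have hX : subspace X by apply: smallest_subspace.
move: x; apply: (tensor_ind gt hX) => a b.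
move: a (ws a); apply: smallest_sub => [|a /= aw].
  split=> [|k u v hu hv]; first by rewrite lr0 mul0r; case: hX.
  by rewrite lrP mulrDl -scalerAl; case: hX => _; apply.
have [k ->] := cliff_span cl gK b.
rewrite lr_sum mulr_sumr; apply: subspace_sum => // S _.
rewrite lrZ -scalerAr; refine (subspaceZ _ hX _).
have iw : (index a w < n`!)%N by rewrite -sw index_mem.
by apply: sub_gen_smallest; exists (Ordinal iw, S); rewrite /= nth_index.
Qed.

End SergeevSpan.

(** * Coxeter generators and Jucys--Murphy elements *)

Section CoxeterRelations.
Variables (R : realType) (n : nat).
Local Notation C := R[i].

Lemma sqrt2_sq : sqrt2 R * sqrt2 R = 2.
Proof.
rewrite /sqrt2 -rmorphM /= -expr2 sqr_sqrtr ?ler0n //.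
by rewrite (rmorph_nat (real_complex R) 2).
Qed.

Lemma sqrt2_neq0 : sqrt2 R != 0.
Proof.
apply/eqP => h; have := sqrt2_sq; rewrite h mul0r => /eqP.
by rewrite eq_sym pnatr_eq0.
Qed.

Lemma two_neq0 : (2 : C) != 0.
Proof. by rewrite pnatr_eq0. Qed.

Variables (B : algType C) (t : 'I_n.-1 -> B) (c : 'I_n -> B).
Hypothesis hB : sergeev_rels t c.

Let cl : clifford_rels c. Proof. by case: hB. Qed.
Let csq := cliff_sq cl.
Let canti := cliff_anti cl.

Lemma sergeev_tc a b : t a * c b = - (c b * t a).
Proof. by case: hB. Qed.

Lemma sergeev_tsq a : t a * t a = 1.
Proof. by case: hB => -[h _ _] _ _; rewrite -expr2. Qed.

Lemma lo_neq_hi (a : 'I_n.-1) : lo a != hi a.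
Proof. by rewrite -val_eqE /=; lia. Qed.

Lemma sergeev_ct a b : c b * t a = - (t a * c b).
Proof. by rewrite sergeev_tc opprK. Qed.

Lemma cox_c_lo a : cox t c a * c (lo a) = c (hi a) * cox t c a.
Proof.
rewrite /cox -scalerAl -scalerAr; congr (_ *: _).
rewrite mulrA sergeev_ct mulNr -!mulrA -mulrN; congr (_ * _).
by rewrite mulrBl mulrBr !csq opprB.
Qed.

Lemma cox_c_hi a : cox t c a * c (hi a) = c (lo a) * cox t c a.
Proof.
rewrite /cox -scalerAl -scalerAr; congr (_ *: _).
rewrite mulrA sergeev_ct mulNr -!mulrA -mulrN; congr (_ * _).
by rewrite mulrBl mulrBr !csq opprB addrC.
Qed.

Lemma cox_c_other a b : b != lo a -> b != hi a -> cox t c a * c b = c b * cox t c a.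
Proof.
move=> bl bh; rewrite /cox -scalerAl -scalerAr; congr (_ *: _).
rewrite mulrA sergeev_ct mulNr -!mulrA -mulrN; congr (_ * _).
by rewrite mulrBl mulrBr (canti bl) (canti bh) -opprB opprK opprB opprD !opprK addrC.
Qed.

Lemma cox_c a b : cox t c a * c b = c (tperm (lo a) (hi a) b) * cox t c a.
Proof.
case: tpermP => [->|->|/eqP bl /eqP bh]; first exact: cox_c_lo.
- exact: cox_c_hi.
- exact: cox_c_other.
Qed.

Lemma half_sqrt2 : (sqrt2 R)^-1 * (sqrt2 R)^-1 = 2^-1.
Proof. by rewrite -invfM sqrt2_sq. Qed.

Lemma half_two : (2^-1 : C) *: (2 : B) = 1.
Proof. by rewrite -[2 : B](scaler_nat 2 (1 : B)) scalerA mulVf ?two_neq0 // scale1r. Qed.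

Lemma cox_sq a : cox t c a * cox t c a = 1.
Proof.
rewrite {1}/cox -scalerAl -mulrA mulrBl -cox_c_lo -cox_c_hi -mulrBr.
rewrite /cox -scalerAl -mulrA scalerAr scalerA scalerAr -[c (lo a) - _]opprB mulrN.
rewrite mulrA -scalerAr half_sqrt2 sergeev_tsq mul1r (cliff_diff_sq cl) ?opprK ?half_two //.
by rewrite eq_sym lo_neq_hi.
Qed.

(** Inverts the definition of s_a, since (c_(a+1) - c_a)^2 = -2. *)
Lemma cox_t a : t a = - (sqrt2 R)^-1 *: (cox t c a * (c (hi a) - c (lo a))).
Proof.
rewrite /cox -scalerAl scalerA -mulrA (cliff_diff_sq cl); last by rewrite eq_sym lo_neq_hi.
by rewrite mulrN scalerN mulNr half_sqrt2 scaleNr opprK scalerAr half_two mulr1.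
Qed.

(** The family [t] extended by 1 to all natural numbers, for splitting products over intervals of
    indices. *)
Let u (i : nat) : B := if insub i is Some j then t j else 1.

Lemma uE (i : 'I_n.-1) : u i = t i.
Proof. by rewrite /u valK. Qed.

Lemma prod_up_rec (k j : nat) : (k < j)%N -> (j < n.-1)%N ->
  \prod_(i < n.-1 | (k < i < j.+1)%N) t i =
  \prod_(i < n.-1 | (k < i < j)%N) t i * u j.
Proof.
move=> kj jn.
have E m : \prod_(i < n.-1 | (k < i < m)%N) t i = \prod_(0 <= i < n.-1 | (k < i < m)%N) u i.
  by rewrite big_mkord; apply: eq_bigr => i _; rewrite uE.
rewrite !E !(big_cat_nat (leq0n j.+1) jn) /=.
rewrite [X in _ * X = _]big_nat_cond [X in _ * X = _]big_pred0 ?mulr1; last by move=> i; lia.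
rewrite [X in _ = _ * X * _]big_nat_cond [X in _ = _ * X * _]big_pred0 ?mulr1; last by move=> i; lia.
rewrite !(big_mkcond _ u) !big_nat_recr //=.
rewrite [(j < j)%N]ltnn andbF [(j < j.+1)%N]ltnSn kj /= mulr1.
congr (_ * _); rewrite [LHS]big_nat_cond [RHS]big_nat_cond.
by apply: eq_bigr => i /andP[/andP[_ ij] _]; rewrite (ltn_trans ij (ltnSn j)) ij.
Qed.

Lemma prod_down_rec (k j : nat) : (k <= j)%N -> (j < n.-1)%N ->
  \prod_(i < n.-1 | (k <= rev_ord i < j.+1)%N) t (rev_ord i) =
  u j * \prod_(i < n.-1 | (k <= rev_ord i < j)%N) t (rev_ord i).
Proof.
move=> kj jn.
have E m : \prod_(i < n.-1 | (k <= rev_ord i < m)%N) t (rev_ord i) =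
    \prod_(0 <= i < n.-1 | (k <= n.-1 - i.+1 < m)%N) u (n.-1 - i.+1)%N.
  by rewrite big_mkord; apply: eq_bigr => i _; rewrite -uE.
have mn : (n.-1 - j.+1 < n.-1)%N by lia.
rewrite !E !(big_cat_nat (leq0n _) (ltnW mn)) /=.
rewrite [X in X * _ = _]big_nat_cond [X in X * _ = _]big_pred0 ?mul1r; last by move=> i; lia.
rewrite [X in _ = _ * (X * _)]big_nat_cond [X in _ = _ * (X * _)]big_pred0 ?mul1r; last by move=> i; lia.
rewrite !(big_mkcond _ (fun i => u (n.-1 - i.+1)%N)) !(big_ltn mn) /=.
have -> : (n.-1 - (n.-1 - j.+1).+1 = j)%N by lia.
rewrite [(j < j)%N]ltnn andbF [(j < j.+1)%N]ltnSn kj /= mul1r; congr (_ * _).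
rewrite [LHS]big_nat_cond [RHS]big_nat_cond; apply: eq_bigr => i /andP[/andP[ij jn'] _].
by congr (if _ then _ else _); lia.
Qed.

Lemma t_pair_adj (a : 'I_n.-1) : t_pair t (lo a) (hi a) = t a.
Proof.
rewrite /t_pair /= subnn expr0 mul1r.
rewrite [X in _ * X]big_pred0 ?mulr1; last by move=> i; lia.
by rewrite prod_down_rec // uE big_pred0 ?mulr1 // => i; lia.
Qed.

Lemma t_pair_rec (k : 'I_n) (a : 'I_n.-1) : (k < a)%N ->
  t_pair t k (hi a) = - (t a * t_pair t k (lo a) * t a).
Proof.
move=> ka; rewrite /t_pair /= prod_down_rec ?prod_up_rec ?(ltnW ka) // !uE.
have -> : (a.+1 - k.+1 = (a - k.+1).+1)%N by lia.
by rewrite exprS mulN1r !mulNr !mulrA (commr_sign (t a)).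
Qed.

Lemma jm_rec (a : 'I_n.-1) : jm t (hi a) = t a - t a * jm t (lo a) * t a.
Proof.
rewrite /jm (bigD1 (lo a)) //= t_pair_adj; congr (_ + _).
rewrite mulr_sumr mulr_suml -sumrN; apply: eq_big => [k|k /andP[h1 h2]].
  by rewrite -val_eqE /=; lia.
by apply: t_pair_rec; move: h1 h2; rewrite -val_eqE /=; lia.
Qed.

Lemma jm0 (a : 'I_n) : a = 0%N :> nat -> jm t a = 0.
Proof. by move=> a0; rewrite /jm big_pred0 // => k; rewrite a0. Qed.

Lemma ord_ind (P : 'I_n -> Prop) :
  (forall a : 'I_n, a = 0%N :> nat -> P a) ->
  (forall a : 'I_n.-1, P (lo a) -> P (hi a)) -> forall a, P a.
Proof.
move=> P0 PS [m mn]; elim: m mn => [|m IH] mn; first exact: P0.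
have mn' : (m < n.-1)%N by lia.
rewrite (_ : Ordinal mn = hi (Ordinal mn')); last exact: val_inj.
apply: PS; rewrite (_ : lo _ = Ordinal (ltnW mn)); first exact: IH.
exact: val_inj.
Qed.

Lemma jm_c a b : jm t a * c b = - (c b * jm t a).
Proof.
elim/ord_ind: a => [a a0|a IH]; first by rewrite jm0 // mul0r mulr0 oppr0.
have E : t a * jm t (lo a) * t a * c b = - (c b * (t a * jm t (lo a) * t a)).
  set m := jm t (lo a) in IH *.
  have e1 : m * t a * c b = c b * (m * t a).
    by rewrite -mulrA sergeev_tc mulrN (mulrA m) IH mulNr opprK mulrA.
  by rewrite -(mulrA (t a) m) -(mulrA (t a) (m * t a)) e1 mulrA sergeev_tc mulNr mulrA.
by rewrite jm_rec mulrBl mulrBr E sergeev_tc opprB opprK addrC.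
Qed.

Lemma x_jm0 (a : 'I_n) : a = 0%N :> nat -> x_jm t c a = 0.
Proof. by move=> a0; rewrite /x_jm jm0 // mul0r scaler0. Qed.

Lemma x_c_neq a b : a != b -> x_jm t c a * c b = c b * x_jm t c a.
Proof.
move=> ab; rewrite /x_jm -scalerAl -scalerAr; congr (_ *: _).
by rewrite -mulrA (canti ab) mulrN (mulrA (jm t a)) jm_c mulNr opprK mulrA.
Qed.

Lemma x_c_eq a : x_jm t c a * c a = - (c a * x_jm t c a).
Proof.
rewrite /x_jm -scalerAl -scalerAr -scalerN; congr (_ *: _).
have E : c a * jm t a = - (jm t a * c a) by rewrite jm_c opprK.
by rewrite (mulrA (c a)) E mulNr opprK.
Qed.

(** Together with [x_jm0] this determines the action of every x_a from that of the s_a and c_b. *)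
Lemma x_jm_rec (a : 'I_n.-1) : x_jm t c (hi a) =
  cox t c a * x_jm t c (lo a) * cox t c a + cox t c a * (1 + c (lo a) * c (hi a)).
Proof.
have h1 : cox t c a * (1 + c (lo a) * c (hi a)) = sqrt2 R *: (t a * c (hi a)).
  rewrite cox_t -[in RHS]scalerAl scalerA mulrN mulfV ?sqrt2_neq0 // scaleN1r -[in RHS]mulrA.
  by rewrite mulrBl csq -mulrN opprB opprK addrC.
rewrite h1 {1}/x_jm jm_rec mulrBl scalerBr addrC; congr (_ + _).
pose d := c (hi a) - c (lo a); pose m := jm t (lo a).
have dm : d * m = - (m * d) by rewrite /m mulrBl mulrBr !jm_c opprB opprK addrC.
have dct : d * c (lo a) * t a = t a * (d * c (lo a)).
  have dt : d * t a = - (t a * d) by rewrite mulrBl mulrBr !sergeev_ct opprK opprB addrC.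
  by rewrite -mulrA sergeev_ct mulrN (mulrA d) dt mulNr opprK mulrA.
have dcd : d * c (lo a) * d = (2 : C) *: c (hi a).
  have lh := lo_neq_hi a; have hl : hi a != lo a by rewrite eq_sym.
  have e1 : c (hi a) * c (lo a) * c (hi a) = c (lo a).
    by rewrite -mulrA (canti lh) mulrN mulrA csq mulN1r opprK.
  have e2 : c (hi a) * c (lo a) * c (lo a) = - c (hi a) by rewrite -mulrA csq mulrN1.
  rewrite /d mulrBl csq opprK mulrDl mul1r mulrBr e1 e2 opprK scaler_nat mulr2n.
  by rewrite (addrC (c (lo a))) addrACA subrr addr0.
have -> : cox t c a * x_jm t c (lo a) * cox t c a =
    (sqrt2 R)^-1 *: (t a * d * (m * c (lo a)) * (t a * d)).
  rewrite /cox /x_jm -/d -/m -!scalerAl -!scalerAr -!scalerAl !scalerA.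
  by congr (_ *: _); field; exact: sqrt2_neq0.
have -> : t a * d * (m * c (lo a)) * (t a * d) = - (t a * m * t a * (d * c (lo a) * d)).
  rewrite -(mulrA (t a) d) (mulrA d m) dm mulNr mulrN mulNr; congr (- _).
  by rewrite -!mulrA; congr (_ * (_ * _)); rewrite !mulrA dct !mulrA.
rewrite dcd -scalerAr scalerN scalerA; congr (- (_ *: _)).
by rewrite -[X in _ * X]sqrt2_sq mulrA mulVf ?sqrt2_neq0 // mul1r.
Qed.

End CoxeterRelations.

(** * Spin generators recovered from Coxeter generators *)

Section FromCoxeter.
Variables (R : realType) (n : nat).
Local Notation C := R[i].
Variables (B : algType C) (s : 'I_n.-1 -> B) (c : 'I_n -> B).
Hypothesis cl : clifford_rels c.
Hypothesis s_sq : forall a, s a * s a = 1.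
Hypothesis s_c : forall a b, s a * c b = c (tperm (lo a) (hi a) b) * s a.
Hypothesis s_braid : forall a b : 'I_n.-1, b = a.+1 :> nat ->
  s a * s b * s a = s b * s a * s b.
Hypothesis s_far : forall a b : 'I_n.-1, (a.+1 < b)%N || (b.+1 < a)%N ->
  s a * s b = s b * s a.

Let csq := cliff_sq cl.
Let canti := cliff_anti cl.

(** The formula of [cox_t]: hat U^lambda is given by the action of the s_a, while the presentation
    is in terms of the t_a. *)
Definition t_of_cox (a : 'I_n.-1) : B :=
  - (sqrt2 R)^-1 *: (s a * (c (hi a) - c (lo a))).

Local Notation d x y := (c x - c y).

Lemma s_diff a x y : s a * d x y =
  d (tperm (lo a) (hi a) x) (tperm (lo a) (hi a) y) * s a.
Proof. by rewrite mulrBr mulrBl !s_c. Qed.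

Lemma diff_s a x y : d x y * s a =
  s a * d (tperm (lo a) (hi a) x) (tperm (lo a) (hi a) y).
Proof. by rewrite s_diff !tpermK. Qed.

Lemma cox_t_of_cox a : cox t_of_cox c a = s a.
Proof.
rewrite /cox /t_of_cox -scalerAl scalerA -mulrA (cliff_diff_sq cl); last by rewrite eq_sym lo_neq_hi.
by rewrite !mulrN scaleNr scalerN opprK half_sqrt2 scalerAr half_two mulr1.
Qed.

Lemma diff_anti x y b : b != x -> b != y -> d x y * c b = - (c b * d x y).
Proof.
move=> bx ay; rewrite mulrBl mulrBr (canti bx) (canti ay) opprB opprK.
by rewrite addrC.
Qed.

Lemma diff_mul_l x y : x != y -> d x y * c y = - (c x * d x y).
Proof. by move=> xy; rewrite mulrBl mulrBr !csq opprB. Qed.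

Lemma diff_mul_r x y : x != y -> d x y * c x = - (c y * d x y).
Proof. by move=> xy; rewrite mulrBl mulrBr !csq opprB addrC. Qed.

Lemma t_of_cox_c a b : t_of_cox a * c b = - (c b * t_of_cox a).
Proof.
rewrite /t_of_cox -scalerAl -scalerAr -scalerN; congr (_ *: _).
have lh := lo_neq_hi a; have hl : hi a != lo a by rewrite eq_sym.
have E : c b * s a = s a * c (tperm (lo a) (hi a) b) by rewrite s_c tpermK.
rewrite -(mulrA (s a)) (mulrA (c b)) E -(mulrA (s a)) -mulrN; congr (_ * _).
case: tpermP => [->|->|/eqP bl /eqP bh].
- exact: diff_mul_l.
- exact: diff_mul_r.
- exact: diff_anti.
Qed.

Lemma t_of_cox_sq a : t_of_cox a * t_of_cox a = 1.
Proof.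
rewrite /t_of_cox -scalerAl -scalerAr scalerA mulrNN half_sqrt2.
rewrite -mulrA (mulrA (d _ _)) diff_s tpermL tpermR -[d (lo a) _]opprB mulrN mulNr.
rewrite -(mulrA (s a)) (cliff_diff_sq cl); last by rewrite eq_sym lo_neq_hi.
by rewrite !mulrN opprK mulrA s_sq mul1r half_two.
Qed.

Lemma t_of_cox_far (a b : 'I_n.-1) : (a.+1 < b)%N || (b.+1 < a)%N ->
  t_of_cox a * t_of_cox b = - (t_of_cox b * t_of_cox a).
Proof.
move=> far; have tn (e f : 'I_n.-1) : (e.+1 < f)%N || (f.+1 < e)%N ->
    (tperm (lo e) (hi e) (hi f) = hi f) /\ (tperm (lo e) (hi e) (lo f) = lo f).
  by move=> ef; rewrite !tpermD // -val_eqE /=; lia.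
have far' : (b.+1 < a)%N || (a.+1 < b)%N by rewrite orbC.
rewrite /t_of_cox -!scalerAl -!scalerAr !scalerA -scalerN; congr (_ *: _).
have P (e f : 'I_n.-1) : (e.+1 < f)%N || (f.+1 < e)%N ->
    s e * d (hi e) (lo e) * (s f * d (hi f) (lo f)) =
    s e * s f * (d (hi e) (lo e) * d (hi f) (lo f)).
  move=> ef; have fe : (f.+1 < e)%N || (e.+1 < f)%N by rewrite orbC.
  have [t1 t2] := tn _ _ fe.
  by rewrite -(mulrA (s e)) (mulrA (d _ _)) diff_s t1 t2 !mulrA.
rewrite !P // (s_far far) -mulrN; congr (_ * _).
have ha : hi b != hi a by rewrite -val_eqE /=; lia.
have hb : lo b != hi a by rewrite -val_eqE /=; lia.
have hc : hi b != lo a by rewrite -val_eqE /=; lia.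
have hd : lo b != lo a by rewrite -val_eqE /=; lia.
rewrite [LHS]mulrBr [in RHS]mulrBl (diff_anti ha hc) (diff_anti hb hd).
by rewrite opprB opprK addrC.
Qed.

Lemma t_of_cox_braid (a b : 'I_n.-1) : b = a.+1 :> nat ->
  t_of_cox a * t_of_cox b * t_of_cox a = t_of_cox b * t_of_cox a * t_of_cox b.
Proof.
move=> ba; have hl : hi a = lo b by apply: val_inj; rewrite /= ba.
set c1 := lo a; set c2 := lo b; set c3 := hi b.
have n12 : c1 != c2 by rewrite -val_eqE /=; lia.
have n13 : c1 != c3 by rewrite -val_eqE /=; lia.
have n23 : c2 != c3 by rewrite -val_eqE /=; lia.
have sa x y : d x y * s a = s a * d (tperm c1 c2 x) (tperm c1 c2 y) by rewrite diff_s hl.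
have sb x y : d x y * s b = s b * d (tperm c2 c3 x) (tperm c2 c3 y) by rewrite diff_s.
have p13 : tperm c1 c2 c3 = c3 by rewrite tpermD.
have p21 : tperm c2 c3 c1 = c1 by rewrite tpermD // eq_sym.
rewrite /t_of_cox hl -/c1 -/c2 -/c3 -!scalerAl -!scalerAr -!scalerAl !scalerA; congr (_ *: _).
(* The differences are moved to the right across the s's, which permute their indices. *)
have -> : s a * d c2 c1 * (s b * d c3 c2) * (s a * d c2 c1) =
    s a * s b * s a * (d c3 c2 * d c3 c1 * d c2 c1).
  rewrite -(mulrA (s a)) (mulrA (d c2 c1)) sb tpermL p21 !mulrA -(mulrA _ _ (s a)) sa p13 tpermR.
  by rewrite !mulrA -(mulrA _ _ (s a)) sa p13 tpermL !mulrA.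
have -> : s b * d c3 c2 * (s a * d c2 c1) * (s b * d c3 c2) =
    s b * s a * s b * (d c2 c1 * d c3 c1 * d c3 c2).
  rewrite -(mulrA (s b)) (mulrA (d c3 c2)) sa tpermR p13 !mulrA -(mulrA _ _ (s b)) sb tpermL p21.
  by rewrite !mulrA -(mulrA _ _ (s b)) sb tpermR p21 !mulrA.
rewrite (s_braid ba); congr (_ * _).
have -> : d c3 c1 = d c2 c1 + d c3 c2 by rewrite [RHS]addrC addrA subrK.
(* Both sides expand to -2 (x + y). *)
have g (x y : B) : x * x = - 2 -> y * y = - 2 -> y * (x + y) * x = x * (x + y) * y.
  move=> hx hy; rewrite !mulrDr !mulrDl hx hy -!mulrA hx hy.
  by rewrite !mulrN !mulNr !mulr_natl !mulr_natr.
by apply: g; apply: cliff_diff_sq; rewrite // eq_sym.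
Qed.

Lemma t_of_cox_rels : sergeev_rels t_of_cox c.
Proof.
split=> //; last exact: t_of_cox_c.
split=> [a|a b|a b]; [by rewrite expr2 t_of_cox_sq | exact: t_of_cox_braid |].
exact: t_of_cox_far.
Qed.

End FromCoxeter.

(** * Yang--Baxter identities in a quaternion algebra *)

Section Quaternion.
Variables (F : fieldType) (n : nat) (K : algType F) (c : 'I_n -> K).
Hypothesis cl : clifford_rels c.

(** The coefficient of v_T in s_a v_T, with u, v the contents of a, a + 1 and x, y their Clifford
    indices. *)
Definition dcoef (u v : F) (x y : 'I_n) : K :=
  ((v - u)^-1)%:A + (v + u)^-1 *: (c x * c y).

Definition acoef (u v : F) : F := 1 - ((u - v) ^+ 2)^-1 - ((u + v) ^+ 2)^-1.

Lemma dcoef_swap u v x y : x != y -> dcoef v u y x = - dcoef u v x y.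
Proof.
move=> xy; rewrite /dcoef (cliff_anti cl (a := y)) 1?eq_sym // (addrC u v) -(opprB v u) invrN.
by rewrite scaleNr scalerN opprD.
Qed.

(** The product has the form (p - q e)(p + q e) with e^2 = -1. Its value is 1 - [acoef u v], which
    the square of Y_a completes to 1. *)
Lemma dcoef_conj u v x y : x != y ->
  dcoef u v y x * dcoef u v x y = (((u - v) ^+ 2)^-1 + ((u + v) ^+ 2)^-1)%:A.
Proof.
move=> xy; have cyx : c y * c x = - (c x * c y) by apply: (cliff_anti cl); rewrite eq_sym.
have ee : c x * c y * (c x * c y) = -1.
  by rewrite -mulrA (mulrA (c y)) cyx mulNr -mulrA (cliff_sq cl y) !mulrN mulr1 opprK (cliff_sq cl).
have key p q (e : K) : e * e = -1 -> (p%:A - q *: e) * (p%:A + q *: e) = (p ^+ 2 + q ^+ 2)%:A.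
  move=> e2; rewrite mulrBl !mulrDr -!scalerAl -!scalerAr !mul1r !mulr1 e2 !scalerA.
  by rewrite scalerN opprD opprK (mulrC q p) addrA addrK -scalerDl.
rewrite /dcoef cyx scalerN key // !exprVn (addrC u v).
by rewrite -(opprB v u) sqrrN.
Qed.

Variables (x y z : 'I_n).
Hypotheses (xy : x != y) (yz : y != z) (xz : x != z).

Local Notation e12 := (c x * c y).
Local Notation e23 := (c y * c z).
Local Notation e13 := (c x * c z).

(** 1, c_x c_y, c_y c_z and c_x c_z multiply like the quaternion units up to sign. In these
    coordinates each identity below reduces to four scalar ones. *)
Definition quat (p q r s : F) : K := p%:A + q *: e12 + r *: e23 + s *: e13.

Lemma quatD p q r s p' q' r' s' :
  quat p q r s + quat p' q' r' s' = quat (p + p') (q + q') (r + r') (s + s').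
Proof.
by rewrite /quat !scalerDl addrACA; congr (_ + _); rewrite addrACA; congr (_ + _); rewrite addrACA.
Qed.

Lemma quat1E p : p%:A = quat p 0 0 0.
Proof. by rewrite /quat !scale0r !addr0. Qed.
Lemma quat12E p : p *: e12 = quat 0 p 0 0.
Proof. by rewrite /quat !scale0r !addr0 add0r. Qed.
Lemma quat23E p : p *: e23 = quat 0 0 p 0.
Proof. by rewrite /quat !scale0r !addr0 !add0r. Qed.
Lemma quat13E p : p *: e13 = quat 0 0 0 p.
Proof. by rewrite /quat !scale0r !add0r. Qed.

Lemma pair_sq u v : u != v -> c u * c v * (c u * c v) = -1.
Proof.
move=> uv; rewrite -mulrA (mulrA (c v)) (cliff_anti cl (a := v)) 1?eq_sym //.
by rewrite mulNr -mulrA (cliff_sq cl v) !mulrN mulr1 opprK (cliff_sq cl).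
Qed.

Lemma pair_mid u v w : c u * c v * (c v * c w) = - (c u * c w).
Proof. by rewrite -mulrA (mulrA (c v)) (cliff_sq cl) mulN1r mulrN. Qed.

Lemma pair_fst u v w : u != v -> c u * c v * (c u * c w) = c v * c w.
Proof. by move=> uv; rewrite (cliff_anti cl uv) mulNr pair_mid opprK. Qed.

Lemma pair_snd u v w : v != w -> c u * c v * (c w * c v) = c u * c w.
Proof.
by move=> vw; rewrite (cliff_anti cl (a := w)) 1?eq_sym // mulrN pair_mid opprK.
Qed.

Lemma pair_out u v w : u != v -> w != v -> u != w -> c v * c w * (c u * c v) = c u * c w.
Proof.
move=> uv wv uw; rewrite (cliff_anti cl uv) mulrN pair_fst 1?eq_sym //.
by rewrite (cliff_anti cl (a := w)) 1?eq_sym // opprK.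
Qed.

Lemma quatM p q r s p' q' r' s' :
  quat p q r s * quat p' q' r' s' =
  quat (p * p' - q * q' - r * r' - s * s')
       (p * q' + q * p' - r * s' + s * r')
       (p * r' + r * p' + q * s' - s * q')
       (p * s' + s * p' - q * r' + r * q').
Proof.
have yx : y != x by rewrite eq_sym. have zy : z != y by rewrite eq_sym.
have zx : z != x by rewrite eq_sym.
have a1 := pair_sq xy. have a2 := pair_sq yz. have a3 := pair_sq xz.
have b1 : e12 * e23 = - e13 := pair_mid x y z.
have b2 : e23 * e12 = e13 by rewrite pair_out.
have b3 : e12 * e13 = e23 by rewrite pair_fst.
have b4 : e13 * e12 = - e23 by rewrite pair_fst // (cliff_anti cl).
have b5 : e23 * e13 = - e12 by rewrite pair_snd // (cliff_anti cl).
have b6 : e13 * e23 = e12 by rewrite pair_snd.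
rewrite {1 2}/quat !mulrDl !mulrDr -!scalerAl -!scalerAr !scalerA !mul1r ?mulr1.
rewrite a1 a2 a3 b1 b2 b3 b4 b5 b6 !scalerN -!scaleNr.
rewrite !quat1E !quat12E !quat23E !quat13E !quatD; congr quat; ring.
Qed.

Lemma quatZ k p q r s : k *: quat p q r s = quat (k * p) (k * q) (k * r) (k * s).
Proof. by rewrite /quat !scalerDr !scalerA. Qed.

Lemma d12E u v : dcoef u v x y = quat (v - u)^-1 (v + u)^-1 0 0.
Proof. by rewrite /dcoef quat1E quat12E quatD !addr0 !add0r. Qed.
Lemma d23E u v : dcoef u v y z = quat (v - u)^-1 0 (v + u)^-1 0.
Proof. by rewrite /dcoef quat1E quat23E quatD !addr0 !add0r. Qed.
Lemma d13E u v : dcoef u v x z = quat (v - u)^-1 0 0 (v + u)^-1.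
Proof. by rewrite /dcoef quat1E quat13E quatD !addr0 !add0r. Qed.

Definition gen2 (u v : F) := (v - u != 0) && (v + u != 0).

(** The coefficient of the original tableau in the braid relation; the terms with [acoef] come from
    swapping there and back. *)
Lemma yang_baxter_diag u v w : gen2 u v -> gen2 v w -> gen2 u w ->
  dcoef u v y z * dcoef v w x z * dcoef u v x y + acoef u v *: dcoef u w x z =
  dcoef v w x y * dcoef u v x z * dcoef v w y z + acoef v w *: dcoef u w x z.
Proof.
move=> /andP[h1 h2] /andP[h3 h4] /andP[h5 h6].
rewrite !d12E !d13E !d23E !quatM quatZ quatZ !quatD /acoef.
have h1' : u - v != 0 by rewrite -opprB oppr_eq0.
have h3' : v - w != 0 by rewrite -opprB oppr_eq0.
have h2' : u + v != 0 by rewrite addrC.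
have h4' : v + w != 0 by rewrite addrC.
by congr quat; field; rewrite ?h1 ?h2 ?h3 ?h4 ?h5 ?h6 ?h1' ?h2' ?h3' ?h4'.
Qed.

(** The degenerate case u = w = 0. The terms with [acoef], which involve [dcoef 0 0], are left out
    because they agree on both sides. *)
Lemma yang_baxter_diag0 v : v != 0 ->
  dcoef 0 v y z * dcoef v 0 x z * dcoef 0 v x y =
  dcoef v 0 x y * dcoef 0 v x z * dcoef v 0 y z.
Proof.
move=> h; rewrite !d12E !d13E !d23E !quatM !subr0 !addr0 !sub0r !add0r.
by congr quat; field; rewrite ?h ?oppr_eq0 ?h.
Qed.

(** This identity and the next give the coefficients in the braid relation of the two tableaux that
    are one swap away. *)
Lemma yang_baxter_left u v w : gen2 u v -> gen2 v w -> gen2 u w ->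
  dcoef v w x z * dcoef u v x y + dcoef v u y z * dcoef u w x z =
  dcoef u w x y * dcoef v w y z.
Proof.
move=> /andP[h1 h2] /andP[h3 h4] /andP[h5 h6].
rewrite !d12E !d13E !d23E !quatM !quatD.
have h1' : u - v != 0 by rewrite -opprB oppr_eq0.
have h2' : u + v != 0 by rewrite addrC.
by congr quat; field; rewrite ?h1 ?h2 ?h3 ?h4 ?h5 ?h6 ?h1' ?h2'.
Qed.

Lemma yang_baxter_right u v w : gen2 u v -> gen2 v w -> gen2 u w ->
  dcoef u v x z * dcoef v w y z + dcoef w v x y * dcoef u w x z =
  dcoef u w y z * dcoef u v x y.
Proof.
move=> /andP[h1 h2] /andP[h3 h4] /andP[h5 h6].
rewrite !d12E !d13E !d23E !quatM !quatD.
have h3' : v - w != 0 by rewrite -opprB oppr_eq0.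
have h4' : v + w != 0 by rewrite addrC.
by congr quat; field; rewrite ?h1 ?h2 ?h3 ?h4 ?h5 ?h6 ?h3' ?h4'.
Qed.

End Quaternion.

(** * Commutation and braid relations of transpositions *)

Section Transpositions.
Variable n : nat.

Lemma tperm_far (a b : 'I_n.-1) : (a.+1 < b)%N || (b.+1 < a)%N ->
  (tperm (lo a) (hi a) (hi b) = hi b) * (tperm (lo a) (hi a) (lo b) = lo b).
Proof. by move=> ab; split; rewrite tpermD // -val_eqE /=; lia. Qed.

Lemma tperm_far_comm (a b : 'I_n.-1) i : (a.+1 < b)%N || (b.+1 < a)%N ->
  tperm (lo a) (hi a) (tperm (lo b) (hi b) i) = tperm (lo b) (hi b) (tperm (lo a) (hi a) i).
Proof.
move=> ab; have [h1 h2] := tperm_far ab.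
case: (tpermP (lo b) (hi b) i) => [->|->|/eqP il /eqP ih]; rewrite ?h1 ?h2 ?tpermL ?tpermR //.
have tn k : tperm (lo a) (hi a) k = k -> i != k -> k != tperm (lo a) (hi a) i.
  move=> hk ik; apply: contraNneq ik => e.
  by rewrite -(tpermK (lo a) (hi a) i) -e hk.
by rewrite (tpermD (tn _ h2 il) (tn _ h1 ih)).
Qed.

Lemma tperm_braid (T : finType) (x y z i : T) : x != y -> x != z -> y != z ->
  tperm x y (tperm y z (tperm x y i)) = tperm y z (tperm x y (tperm y z i)).
Proof.
move=> xy xz yz.
have [->|ix] := eqVneq i x.
  by rewrite tpermL tpermL (tpermD (z := z)) // (tpermD (z := x)) 1?eq_sym // tpermL tpermL.
have [->|iy] := eqVneq i y.
  by rewrite tpermR tpermL (tpermD (z := x)) 1?eq_sym // tpermL (tpermD (z := z)) // tpermR.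
have [->|iz] := eqVneq i z.
  by rewrite tpermR tpermR (tpermD (z := z)) // tpermR tpermR (tpermD (z := x)) 1?eq_sym.
by rewrite !(tpermD (z := i)) // eq_sym.
Qed.

End Transpositions.

(** * The operators s_a on functions from tableaux to the Clifford algebra *)

Section Model.
Variables (F : fieldType) (n : nat) (K : algType F) (c : 'I_n -> K).
Hypothesis cl : clifford_rels c.
Hypothesis cG : generates c.
Variable sg : 'I_n.-1 -> {lrmorphism K -> K}.
Hypothesis sgE : forall a x, sg a (c x) = c (tperm (lo a) (hi a) x).

Variables (Tab : finType) (kap : Tab -> 'I_n -> F) (sw : 'I_n.-1 -> Tab -> Tab).
Variable ys : F -> F -> F.

Definition ycoef a T := ys (kap T (lo a)) (kap T (hi a)).

Hypothesis ys_sym : forall u v, ys u v = ys v u.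
Hypothesis ys_sq : forall T a,
  ycoef a T ^+ 2 = acoef (kap T (lo a)) (kap T (hi a)).
Hypothesis kap_gen : forall T a, gen2 (kap T (lo a)) (kap T (hi a)).
Hypothesis swK : forall a, involutive (sw a).
Hypothesis kap_sw : forall a T, ycoef a T != 0 ->
  forall x, kap (sw a T) x = kap T (tperm (lo a) (hi a) x).
Hypothesis sw_far : forall (a b : 'I_n.-1) T, (a.+1 < b)%N || (b.+1 < a)%N ->
  ycoef a T != 0 -> ycoef b T != 0 -> sw a (sw b T) = sw b (sw a T).
Hypothesis sw_braid : forall (a b : 'I_n.-1) T, b = a.+1 :> nat ->
  ycoef a T != 0 -> ycoef b (sw a T) != 0 -> ycoef a (sw b (sw a T)) != 0 ->
  sw a (sw b (sw a T)) = sw b (sw a (sw b T)).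
Hypothesis kap_rep : forall (a b : 'I_n.-1) T, b = a.+1 :> nat ->
  ~~ gen2 (kap T (lo a)) (kap T (hi b)) ->
  kap T (lo a) = 0 /\ kap T (hi b) = 0.

Local Notation V := {ffun Tab -> K}.

Definition dop a T : K := dcoef c (kap T (lo a)) (kap T (hi a)) (lo a) (hi a).

(** A function [y] stands for the sum of the vectors y(T) v_T. Moving s_a across a Clifford element
    applies [sg a], and the coefficient at [T] receives contributions from [T] and its swap. The
    swap [sw] is total: inadmissible swaps are marked by [ycoef] being 0. *)
Definition sop_fun (a : 'I_n.-1) (y : V) : V :=
  [ffun T => sg a (y T) * dop a T + ycoef a T *: sg a (y (sw a T))].

Definition cop_fun (k : K) (y : V) : V := [ffun T => k * y T].

Lemma sop_lin a : linear (sop_fun a).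
Proof.
move=> k u v; apply/ffunP => T; rewrite !ffunE !lrP mulrDl -scalerAl !scalerDr.
by rewrite !scalerA (mulrC k) addrACA.
Qed.

Lemma cop_lin k : linear (cop_fun k).
Proof. by move=> l u v; apply/ffunP => T; rewrite !ffunE mulrDr -scalerAr. Qed.


Lemma ycoef_far (a b : 'I_n.-1) T : (a.+1 < b)%N || (b.+1 < a)%N ->
  ycoef b T != 0 -> ycoef a (sw b T) = ycoef a T.
Proof.
move=> ab h; rewrite /ycoef !(kap_sw h).
by have [-> ->] : (tperm (lo b) (hi b) (hi a) = hi a) * (tperm (lo b) (hi b) (lo a) = lo a)
  by apply: tperm_far; rewrite orbC.
Qed.

Lemma dcoef_comm u v u' v' x y x' y' : x != x' -> x != y' -> y != x' -> y != y' ->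
  dcoef c u v x y * dcoef c u' v' x' y' = dcoef c u' v' x' y' * dcoef c u v x y.
Proof.
move=> h1 h2 h3 h4; have anti z w : z != w -> c z * c w = - (c w * c z) by apply: cliff_anti.
have pc : c x * c y * (c x' * c y') = c x' * c y' * (c x * c y).
  have pw w : x != w -> y != w -> c x * c y * c w = c w * (c x * c y).
    by move=> xw yw; rewrite -mulrA (anti y w) // mulrN (mulrA (c x)) (anti x w) // mulNr opprK mulrA.
  by rewrite mulrA pw // -(mulrA (c x')) pw // mulrA.
rewrite /dcoef !mulrDl !mulrDr -!scalerAl -!scalerAr !mul1r !mulr1 !scalerA pc.
by rewrite addrACA; congr (_ + _); rewrite 1?addrC [RHS]addrC;
  congr (_ *: _ + _ *: _); rewrite mulrC.
Qed.

Variables (v0 : V) (hv0 : v0 != 0).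
Local Notation EV := (endo_alg hv0).

Definition sop (a : 'I_n.-1) : EV := Endo (sop_lin a).
Definition cop (k : K) : EV := Endo (cop_lin k).

Lemma sopE a y T : endo_fun (sop a) y T =
  sg a (y T) * dop a T + ycoef a T *: sg a (y (sw a T)).
Proof. by rewrite ffunE. Qed.

Lemma copE k y T : endo_fun (cop k) y T = k * y T.
Proof. by rewrite ffunE. Qed.

Lemma ycoef_sw a T : ycoef a (sw a T) = ycoef a T.
Proof.
have [h|h] := eqVneq (ycoef a T) 0; last first.
  by rewrite /ycoef !(kap_sw h) tpermL tpermR ys_sym.
have [h'|h'] := eqVneq (ycoef a (sw a T)) 0; first by rewrite h h'.
have : ycoef a (sw a (sw a T)) = ycoef a (sw a T).
  by rewrite /ycoef !(kap_sw h') tpermL tpermR ys_sym.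
by rewrite swK.
Qed.

Lemma sgK a x : sg a (sg a x) = x.
Proof.
have := @gen_ext _ _ _ _ c (sg a \o sg a : {lrmorphism K -> K}) (idfun : {lrmorphism K -> K}) cG.
by apply=> i /=; rewrite !sgE tpermK.
Qed.

Lemma sg_dcoef a u v x y : sg a (dcoef c u v x y) =
  dcoef c u v (tperm (lo a) (hi a) x) (tperm (lo a) (hi a) y).
Proof. by rewrite /dcoef lrD !lrZ lr1 lrM !sgE. Qed.

(** The coefficient at [T] is (1 - A) + A. The coefficient at the swapped tableau cancels, because
    exchanging both parameters and indices negates [dcoef]. *)
Lemma sop_sq a : sop a * sop a = 1.
Proof.
apply: endo_ext => y; apply/ffunP => T.
rewrite endo_algM sopE !sopE swK ycoef_sw !lrD !lrZ !lrM !sgK mulrDl scalerDr.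
rewrite -(mulrA (y T)) /dop sg_dcoef tpermL tpermR (dcoef_conj cl); last exact: lo_neq_hi.
rewrite -scalerAr mulr1 scalerA -expr2 ys_sq /acoef.
have E : ycoef a T *: y (sw a T) * dcoef c (kap T (lo a)) (kap T (hi a)) (lo a) (hi a) +
    ycoef a T *: (y (sw a T) * sg a (dcoef c (kap (sw a T) (lo a)) (kap (sw a T) (hi a))
      (lo a) (hi a))) = 0.
  have [->|h] := eqVneq (ycoef a T) 0; first by rewrite !scale0r mul0r addr0.
  rewrite !(kap_sw h) sg_dcoef tpermL tpermR (dcoef_swap cl _ _ (lo_neq_hi a)).
  by rewrite mulrN scalerN scalerAl subrr.
rewrite endo_alg1 -addrA (addrA (_ *: _ * _)) E add0r -scalerDl.
by rewrite -[RHS]scale1r; congr (_ *: _); ring.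
Qed.

Lemma sop_c a x : sop a * cop (c x) = cop (c (tperm (lo a) (hi a) x)) * sop a.
Proof.
apply: endo_ext => y; apply/ffunP => T.
rewrite !endo_algM sopE !copE sopE !lrM sgE.
by rewrite [RHS]mulrDr -[in RHS]scalerAr mulrA.
Qed.

Lemma copD k l : cop (k + l) = cop k + cop l.
Proof. by apply: endo_ext => y; apply/ffunP => T; rewrite endo_algD !ffunE mulrDl. Qed.

Lemma copM k l : cop (k * l) = cop k * cop l.
Proof. by apply: endo_ext => y; apply/ffunP => T; rewrite endo_algM !copE mulrA. Qed.

Lemma copN k : cop (- k) = - cop k.
Proof. by apply: endo_ext => y; apply/ffunP => T; rewrite endo_algN !ffunE mulNr. Qed.

Lemma cop1 : cop 1 = 1.
Proof. by apply: endo_ext => y; apply/ffunP => T; rewrite copE mul1r. Qed.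

Lemma copZ l k : cop (l *: k) = l *: cop k.
Proof. by apply: endo_ext => y; apply/ffunP => T; rewrite endo_algZ !ffunE scalerAl. Qed.

Lemma cop_rels : clifford_rels (fun x => cop (c x)).
Proof.
split=> [x|x y xy].
  by rewrite expr2 -copM (cliff_sq cl) copN cop1.
by rewrite -!copM (cliff_anti cl xy) copN.
Qed.

Lemma sg_far (a b : 'I_n.-1) x : (a.+1 < b)%N || (b.+1 < a)%N ->
  sg a (sg b x) = sg b (sg a x).
Proof.
move=> ab; have := @gen_ext _ _ _ _ c (sg a \o sg b : {lrmorphism K -> K})
  (sg b \o sg a : {lrmorphism K -> K}) cG.
apply=> i /=; rewrite !sgE; congr c.
exact: tperm_far_comm.
Qed.

Lemma sop_far (a b : 'I_n.-1) : (a.+1 < b)%N || (b.+1 < a)%N ->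
  sop a * sop b = sop b * sop a.
Proof.
move=> ab; have ba : (b.+1 < a)%N || (a.+1 < b)%N by rewrite orbC.
have [h1 h2] := tperm_far ab; have [h3 h4] := tperm_far ba.
apply: endo_ext => y; apply/ffunP => T; rewrite !endo_algM.
rewrite !sopE !lrD !lrM !lrZ !mulrDl !scalerDr !scalerA.
rewrite !(sg_far _ ab) /dop !sg_dcoef h1 h2 h3 h4.
have [a1 a2] : lo a != lo b /\ lo a != hi b by rewrite -!val_eqE /=; lia.
have [a3 a4] : hi a != lo b /\ hi a != hi b by rewrite -!val_eqE /=; lia.
have E (e f : 'I_n.-1) (z : K) (he : tperm (lo e) (hi e) (hi f) = hi f)
    (le : tperm (lo e) (hi e) (lo f) = lo f) :
    ycoef e T *: (z * dcoef c (kap (sw e T) (lo f)) (kap (sw e T) (hi f)) (lo f) (hi f)) =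
    ycoef e T *: z * dcoef c (kap T (lo f)) (kap T (hi f)) (lo f) (hi f).
  have [->|h] := eqVneq (ycoef e T) 0; first by rewrite !scale0r mul0r.
  by rewrite !(kap_sw h) he le scalerAl.
rewrite !E // -!addrA -(mulrA _ (dcoef _ _ _ _ _)) dcoef_comm 1?eq_sym // 1?eq_sym // mulrA.
congr (_ + _); rewrite addrCA; congr (_ + (_ + _)).
have [Ya|Ya] := eqVneq (ycoef a T) 0.
  rewrite Ya mul0r scale0r; have [Yb|Yb] := eqVneq (ycoef b T) 0; first by rewrite Yb mul0r scale0r.
  by rewrite ycoef_far // Ya mulr0 scale0r.
have [Yb|Yb] := eqVneq (ycoef b T) 0.
  by rewrite ycoef_far // Yb mulr0 mul0r !scale0r.
by rewrite !ycoef_far // mulrC (sw_far ab Ya Yb).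
Qed.

Lemma sg_braid (a b : 'I_n.-1) x : b = a.+1 :> nat ->
  sg a (sg b (sg a x)) = sg b (sg a (sg b x)).
Proof.
move=> ba; have hl : hi a = lo b by apply: val_inj; rewrite /= ba.
have := @gen_ext _ _ _ _ c (sg a \o (sg b \o sg a) : {lrmorphism K -> K})
  (sg b \o (sg a \o sg b) : {lrmorphism K -> K}) cG.
apply=> i /=; rewrite !sgE hl tperm_braid // -val_eqE /=; lia.
Qed.

(** Sorted by the six tableaux involved, with the same automorphism in front of each, so that the
    two sides of the braid relation can be compared term by term. *)
Lemma sop_expand (a b : 'I_n.-1) y T :
  endo_fun (sop a * (sop b * sop a)) y T =
  let s k := sg a (sg b (sg a k)) in
  s (y T) * (sg a (sg b (dop a T)) * sg a (dop b T) * dop a T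
             + (ycoef a T * ycoef a (sw a T)) *: sg a (dop b (sw a T))) +
  s (y (sw a T)) * (ycoef a T *: (sg a (dop b T) * dop a T +
     sg a (sg b (dop a (sw a T))) * sg a (dop b (sw a T)))) +
  s (y (sw b T)) * (ycoef b T *: (sg a (sg b (dop a (sw b T))) * dop a T)) +
  s (y (sw a (sw b T))) * ((ycoef b T * ycoef a (sw b T)) *: dop a T) +
  s (y (sw b (sw a T))) * ((ycoef a T * ycoef b (sw a T)) *: sg a (sg b (dop a (sw b (sw a T))))) +
  (ycoef a T * ycoef b (sw a T) * ycoef a (sw b (sw a T))) *: s (y (sw a (sw b (sw a T)))).
Proof.
rewrite !endo_algM !sopE swK /=; move: (dop) (ycoef) => dd yy.
rewrite !lrD !lrM !lrZ !lrD !lrM !lrZ.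
rewrite !mulrDl !scalerDr !mulrDl !mulrDr -!scalerAl -!scalerAr ?scalerDr ?scalerA !mulrA.
by rewrite [LHS](AC ((2*2)*(2*2)) ((1*6)*(2*5)*3*4*7*8)).
Qed.

Lemma sop_braid (a b : 'I_n.-1) : b = a.+1 :> nat ->
  sop a * sop b * sop a = sop b * sop a * sop b.
Proof.
move=> ba; rewrite -!mulrA; apply: endo_ext => yy; apply/ffunP => T.
rewrite !sop_expand /= -!(sg_braid _ ba).
have hl : lo b = hi a by apply: val_inj; rewrite /= ba.
have xy : lo a != hi a by exact: lo_neq_hi.
have yz : hi a != hi b by rewrite -hl lo_neq_hi.
have xz : lo a != hi b by rewrite -val_eqE /=; lia.
have Pa : (tperm (lo a) (hi a) (lo a) = hi a) * (tperm (lo a) (hi a) (hi a) = lo a) *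
  (tperm (lo a) (hi a) (hi b) = hi b) by rewrite tpermL tpermR tpermD.
have Pb : (tperm (hi a) (hi b) (lo a) = lo a) * (tperm (hi a) (hi b) (hi a) = hi b) *
  (tperm (hi a) (hi b) (hi b) = hi a) by rewrite tpermL tpermR tpermD // eq_sym.
have kb S : ycoef b S != 0 -> forall i, kap (sw b S) i = kap S (tperm (hi a) (hi b) i).
  by move=> h i; rewrite (kap_sw h) hl.
have sb u v i j : sg b (dcoef c u v i j) =
    dcoef c u v (tperm (hi a) (hi b) i) (tperm (hi a) (hi b) j) by rewrite sg_dcoef hl.
have sa u v i j : sg a (dcoef c u v i j) =
    dcoef c u v (tperm (lo a) (hi a) i) (tperm (lo a) (hi a) j) by rewrite sg_dcoef.
have da S : dop a S = dcoef c (kap S (lo a)) (kap S (hi a)) (lo a) (hi a) by [].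
have db S : dop b S = dcoef c (kap S (hi a)) (kap S (hi b)) (hi a) (hi b) by rewrite /dop hl.
have gb S : gen2 (kap S (hi a)) (kap S (hi b)) by rewrite -hl kap_gen.
have ya S : ycoef a S = ys (kap S (lo a)) (kap S (hi a)) by [].
have yb S : ycoef b S = ys (kap S (hi a)) (kap S (hi b)) by rewrite /ycoef hl.
have ga S := kap_gen S a.
set u := kap T (lo a); set v := kap T (hi a); set w := kap T (hi b).
(* Exchanging the roles of [a] and [b] exchanges the second and third terms and the fourth and
   fifth. *)
rewrite [RHS](AC 6 (1*3*2*5*4*6)) /=.
congr (_ * _ + _ * _ + _ * _ + _ * _ + _ * _ + _).
- have -> : (ycoef a T * ycoef a (sw a T)) *: sg a (dop b (sw a T)) =
      acoef u v *: dcoef c u w (lo a) (hi b).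
    rewrite ycoef_sw -expr2 ys_sq; have [h|h] := eqVneq (ycoef a T) 0.
      by rewrite -/u -/v (_ : acoef u v = 0) ?scale0r // /u /v -ys_sq h expr0n.
    by rewrite db !(kap_sw h) sg_dcoef !Pa.
  have -> : (ycoef b T * ycoef b (sw b T)) *: sg b (dop a (sw b T)) =
      acoef v w *: dcoef c u w (lo a) (hi b).
    rewrite ycoef_sw -expr2 ys_sq hl; have [h|h] := eqVneq (ycoef b T) 0.
      by rewrite -/v -/w (_ : acoef v w = 0) ?scale0r // /v /w -hl -ys_sq h expr0n.
    by rewrite da !(kb _ h) sb !Pb.
  rewrite !da !db !(sa, sb) !(Pa, Pb) -/u -/v -/w.
  (* The generic identity needs u and w to be neither equal nor opposite; otherwise both are 0. *)
  have [guw|guw] := boolP (gen2 u w); first exact: (yang_baxter_diag cl xy yz xz (ga T) (gb T) guw).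
  have [u0 w0] := kap_rep ba guw; rewrite -/u in u0; rewrite -/w in w0.
  have v0' : v != 0 by case/andP: (ga T); rewrite -/u -/v u0 subr0.
  rewrite u0 w0 (yang_baxter_diag0 cl) //; congr (_ + _ *: _).
  by rewrite /acoef !sub0r !add0r subr0 addr0 sqrrN.
- have [h|h] := eqVneq (ycoef a T) 0; first by rewrite h !scale0r.
  congr (_ *: _).
  have guw : gen2 u w by have := gb (sw a T); rewrite !(kap_sw h) !Pa.
  rewrite !da !db !(kap_sw h) !(sa, sb) !(Pa, Pb) -/u -/v -/w.
  exact: (yang_baxter_left cl xy yz xz (ga T) (gb T) guw).
- have [h|h] := eqVneq (ycoef b T) 0; first by rewrite h !scale0r.
  congr (_ *: _).
  have guw : gen2 u w by have := ga (sw b T); rewrite !(kb _ h) !Pb.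
  rewrite !da !db !(kb _ h) !(sa, sb) !(Pa, Pb) -/u -/v -/w.
  exact/esym/(yang_baxter_right cl xy yz xz (ga T) (gb T) guw).
- have [h|h] := eqVneq (ycoef b T) 0; first by rewrite h mul0r !scale0r.
  have [h'|h'] := eqVneq (ycoef a (sw b T)) 0; first by rewrite h' mulr0 !scale0r.
  congr (_ *: _).
  by rewrite !da !db !(kap_sw h') !(kb _ h) !(sa, sb) !(Pa, Pb).
- have [h|h] := eqVneq (ycoef a T) 0; first by rewrite h mul0r !scale0r.
  have [h'|h'] := eqVneq (ycoef b (sw a T)) 0; first by rewrite h' mulr0 !scale0r.
  congr (_ *: _).
  by rewrite !da !db !(kb _ h') !(kap_sw h) !(sa, sb) !(Pa, Pb).
(* Both coefficients are the product of the Y of the three pairs of parameters. If it is nonzero,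
   all swaps are admissible and the two resulting tableaux coincide. *)
- have L : ycoef a T * ycoef b (sw a T) * ycoef a (sw b (sw a T)) = ys u v * ys u w * ys v w.
    have [h|h] := eqVneq (ycoef a T) 0; first by rewrite h -/(ycoef a T) h !mul0r.
    have E : ycoef b (sw a T) = ys u w by rewrite yb !(kap_sw h) !Pa.
    have [h'|h'] := eqVneq (ycoef b (sw a T)) 0; first by rewrite h' -E h' !mulr0 !mul0r.
    by rewrite E !ya !(kb _ h') !(kap_sw h) !Pb !Pa.
  have R : ycoef b T * ycoef a (sw b T) * ycoef b (sw a (sw b T)) = ys v w * ys u w * ys u v.
    have [h|h] := eqVneq (ycoef b T) 0; first by rewrite h /v /w -yb h !mul0r.
    have E : ycoef a (sw b T) = ys u w by rewrite ya !(kb _ h) !Pb.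
    have [h'|h'] := eqVneq (ycoef a (sw b T)) 0; first by rewrite h' -E h' !mulr0 !mul0r.
    by rewrite E !yb !(kap_sw h') !(kb _ h) !Pa !Pb.
  have LR : ys v w * ys u w * ys u v = ys u v * ys u w * ys v w by ring.
  rewrite L R LR; have [->|] := eqVneq (ys u v * ys u w * ys v w) 0; first by rewrite !scale0r.
  rewrite -L !mulf_eq0 !negb_or => /andP[/andP[h1 h2] h3].
  by rewrite (sw_braid ba h1 h2 h3).
Qed.

End Model.

(** * Contents of standard tableaux and the coefficients Y_a *)

Section Contents.
Variables (R : realType) (n : nat).
Local Notation kp T a := (kappa R T a).

Definition pron (s : nat) : R := (s * s.+1)%N%:R.

Lemma kappaE (T : 'I_n -> box n) a : kp T a = Num.sqrt (pron (ct T a)).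
Proof. by rewrite /kappa /scontent /= expr0 mul1r. Qed.

Lemma kappa_ge0 (T : 'I_n -> box n) a : 0 <= kp T a.
Proof. by rewrite kappaE sqrtr_ge0. Qed.

Lemma kappa_sq (T : 'I_n -> box n) a : kp T a ^+ 2 = pron (ct T a).
Proof. by rewrite kappaE sqr_sqrtr // ler0n. Qed.

Lemma pron_inj s s' : pron s = pron s' -> s = s'.
Proof. by move/eqP; rewrite eqr_nat => /eqP; nia. Qed.

(** In this form A depends only on u^2 and v^2, which are the integers s (s + 1). *)
Lemma A_coefE (u v : R) : v - u != 0 -> v + u != 0 ->
  A_coef u v = 1 - 2 * (u ^+ 2 + v ^+ 2) / (u ^+ 2 - v ^+ 2) ^+ 2.
Proof.
move=> h1 h2; have h1' : u - v != 0 by rewrite -opprB oppr_eq0.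
have h2' : u + v != 0 by rewrite addrC.
have h3 : u ^+ 2 - v ^+ 2 != 0 by rewrite subr_sqr mulf_neq0.
by rewrite /A_coef; field; rewrite h3 h1' h2'.
Qed.

Lemma A_coef_sym (u v : R) : A_coef u v = A_coef v u.
Proof. by rewrite /A_coef (addrC u v) -(opprB v u) sqrrN. Qed.

Lemma acoef_C (u v : R) : (A_coef u v)%:C%C = acoef u%:C%C v%:C%C.
Proof.
by rewrite /A_coef /acoef !rmorphB /= !fmorphV !rmorphXn /= rmorphB rmorphD rmorph1.
Qed.

Lemma hi_lo (a : 'I_n.-1) : hi a = (lo a).+1 :> nat.
Proof. by []. Qed.

Variables (lam : spart n).
Implicit Type T : std_tab lam.

Lemma ct_hi_neq T (a : 'I_n.-1) : ct (val T) (lo a) != ct (val T) (hi a).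
Proof.
have tT := std_tableau T; have [h|h] := boolP (box_le (val T (lo a)) (val T (hi a))).
  by have := ct_adjacent tT (hi_lo a) h; lia.
by have := @ct_far _ _ _ tT (lo a) (hi a) (ltnSn _) h; lia.
Qed.

Lemma kappa_gen T x y : ct (val T) x != ct (val T) y ->
  (kp (val T) y - kp (val T) x != 0) && (kp (val T) y + kp (val T) x != 0).
Proof.
move=> ne; apply/andP; split.
  rewrite subr_eq0; apply: contra ne => /eqP E; apply/eqP/pron_inj.
  by rewrite -!kappa_sq E.
rewrite paddr_eq0 ?kappa_ge0 //; apply: contra ne => /andP[/eqP e1 /eqP e2].
by apply/eqP/pron_inj; rewrite -!kappa_sq e1 e2.
Qed.

Lemma pron_adjacent s : 1 - 2 * (pron s + pron s.+1) / (pron s - pron s.+1) ^+ 2 = 0.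
Proof.
have h : (s%:R + 1 : R) != 0 by rewrite natr1 pnatr_eq0.
have -> : pron s - pron s.+1 = - (2 * (s%:R + 1)) by rewrite /pron !natrM -!natr1; ring.
have -> : pron s + pron s.+1 = 2 * (s%:R + 1) ^+ 2 by rewrite /pron !natrM -!natr1; ring.
by field.
Qed.

(** With d = s' - s and S = s + s' + 1, the difference of the squares is -d S and twice their sum is
    S^2 + d^2 - 1. Hence A (d S)^2 = (d^2 - 1)(S^2 - 1), which is positive as d and S are at least
    2. *)
Lemma pron_far s s' : (s.+2 <= s')%N ->
  0 < 1 - 2 * (pron s + pron s') / (pron s - pron s') ^+ 2.
Proof.
move=> h; pose d : R := (s' - s)%N%:R; have [d2] : 2 <= d by rewrite ler_nat; lia.
have s'E : s'%:R = s%:R + d :> R by rewrite /d -natrD subnKC //; lia.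
have s0 : 0 <= s%:R :> R by rewrite ler0n.
have pE : pron s - pron s' = - (d * (2 * s%:R + 1 + d)).
  by rewrite /pron !natrM -!natr1 s'E; ring.
have qE : 2 * (pron s + pron s') = (2 * s%:R + 1 + d) ^+ 2 + d ^+ 2 - 1.
  by rewrite /pron !natrM -!natr1 s'E; ring.
set S := 2 * s%:R + 1 + d in pE qE; have S2 : 2 <= S by rewrite /S; lra.
have p0 : 0 < (pron s - pron s') ^+ 2 by rewrite pE sqrrN exprn_gt0 // mulr_gt0; lra.
rewrite subr_gt0 ltr_pdivrMr // mul1r pE qE sqrrN -subr_gt0.
have -> : (d * S) ^+ 2 - (S ^+ 2 + d ^+ 2 - 1) = (d ^+ 2 - 1) * (S ^+ 2 - 1) by ring.
by apply: mulr_gt0; nra.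
Qed.

(** The swap fails to be standard exactly when the two boxes are neighbours, where A = 0; otherwise
    the contents differ by at least 2 and A > 0. So Y_a has a real square root and detects
    admissible swaps. *)
Lemma A_coef_std T (a : 'I_n.-1) :
  if standard (parts lam) (swap_entries (val T) a)
  then 0 < A_coef (kp (val T) (lo a)) (kp (val T) (hi a))
  else A_coef (kp (val T) (lo a)) (kp (val T) (hi a)) == 0.
Proof.
have tT := std_tableau T; have /andP[g1 g2] := kappa_gen (ct_hi_neq T a).
rewrite A_coefE // !kappa_sq swap_standard; case: ifP => h.
  have [k|k] := @ct_far _ _ _ tT (lo a) (hi a) (ltnSn _) h; first exact: pron_far.
  by rewrite [X in 2 * X]addrC -[X in _ / X]sqrrN opprB; exact: pron_far.
have [->|->] := ct_adjacent tT (hi_lo a) (negbFE h); first by rewrite pron_adjacent.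
by rewrite [X in 2 * X]addrC -[X in _ / X]sqrrN opprB pron_adjacent.
Qed.

Definition Ckap T (a : 'I_n) : R[i] := (kp (val T) a)%:C%C.
(** Taken on real parts because the model is built over [R[i]], while all contents are real. *)
Definition Cys (u v : R[i]) : R[i] := (Num.sqrt (A_coef (complex.Re u) (complex.Re v)))%:C%C.
(** By default [T] itself when the exchange is not standard; then Y_a is 0 by [Y_neq0]. *)
Definition tab_swap (a : 'I_n.-1) T : std_tab lam := insubd T (swap_entries (val T) a).

Lemma Cys_sym u v : Cys u v = Cys v u.
Proof. by rewrite /Cys A_coef_sym. Qed.

Lemma YcoefE T a : ycoef Ckap Cys a T = (Y_coef R (val T) a)%:C%C.
Proof. by []. Qed.

Lemma Ys_sq T a : ycoef Ckap Cys a T ^+ 2 = acoef (Ckap T (lo a)) (Ckap T (hi a)).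
Proof.
rewrite YcoefE -acoef_C -rmorphXn /= sqr_sqrtr //.
by have := A_coef_std T a; case: ifP => _ => [/ltW|/eqP ->].
Qed.

Lemma Y_neq0 T a : (ycoef Ckap Cys a T != 0) = standard (parts lam) (swap_entries (val T) a).
Proof.
rewrite YcoefE /Y_coef; have := A_coef_std T a; case: ifP => _ => [h|/eqP ->].
  by rewrite fmorph_eq0 gt_eqF // sqrtr_gt0.
by rewrite sqrtr0 rmorph0 eqxx.
Qed.

Lemma val_tab_swap T a : ycoef Ckap Cys a T != 0 ->
  val (tab_swap a T) = swap_entries (val T) a.
Proof. by rewrite Y_neq0 => h; rewrite /tab_swap val_insubd h. Qed.

Lemma Ckap_gen T a : gen2 (Ckap T (lo a)) (Ckap T (hi a)).
Proof.
rewrite /gen2 /Ckap -rmorphB -rmorphD !fmorph_eq0.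
exact: kappa_gen (ct_hi_neq T a).
Qed.

Lemma tab_swapK a : involutive (tab_swap a).
Proof.
move=> T; have [h|h] := boolP (standard (parts lam) (swap_entries (val T) a)).
  have E : val (tab_swap a T) = swap_entries (val T) a by rewrite val_insubd h.
  by apply: val_inj; rewrite {1}/tab_swap val_insubd E swap_involutive (valP T).
have E : tab_swap a T = T by apply: val_inj; rewrite val_insubd (negbTE h).
by rewrite !E.
Qed.

Lemma Ckap_swap a T : ycoef Ckap Cys a T != 0 ->
  forall x, Ckap (tab_swap a T) x = Ckap T (tperm (lo a) (hi a) x).
Proof. by move=> h x; rewrite /Ckap val_tab_swap // /kappa ffunE. Qed.

Lemma tab_swap_far (a b : 'I_n.-1) T : (a.+1 < b)%N || (b.+1 < a)%N ->
  ycoef Ckap Cys a T != 0 -> ycoef Ckap Cys b T != 0 ->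
  tab_swap a (tab_swap b T) = tab_swap b (tab_swap a T).
Proof.
move=> ab ha hb; have ba : (b.+1 < a)%N || (a.+1 < b)%N by rewrite orbC.
have hab : ycoef Ckap Cys a (tab_swap b T) != 0 by rewrite (ycoef_far Ckap_swap).
have hba : ycoef Ckap Cys b (tab_swap a T) != 0 by rewrite (ycoef_far Ckap_swap).
apply: val_inj; rewrite !val_tab_swap //; apply/ffunP => x; rewrite !ffunE.
by rewrite tperm_far_comm.
Qed.

Lemma tab_swap_braid (a b : 'I_n.-1) T : b = a.+1 :> nat ->
  ycoef Ckap Cys a T != 0 -> ycoef Ckap Cys b (tab_swap a T) != 0 ->
  ycoef Ckap Cys a (tab_swap b (tab_swap a T)) != 0 ->
  tab_swap a (tab_swap b (tab_swap a T)) = tab_swap b (tab_swap a (tab_swap b T)).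
Proof.
move=> ba h1 h2 h3; have hl : lo b = hi a by apply: val_inj; rewrite /= ba.
have xy : lo a != hi a by exact: lo_neq_hi.
have yz : hi a != hi b by rewrite -hl lo_neq_hi.
have xz : lo a != hi b by rewrite -val_eqE /=; lia.
have Pa : (tperm (lo a) (hi a) (lo a) = hi a) * (tperm (lo a) (hi a) (hi a) = lo a) *
  (tperm (lo a) (hi a) (hi b) = hi b) by rewrite tpermL tpermR tpermD.
have Pb : (tperm (hi a) (hi b) (lo a) = lo a) * (tperm (hi a) (hi b) (hi a) = hi b) *
  (tperm (hi a) (hi b) (hi b) = hi a) by rewrite tpermL tpermR tpermD // eq_sym.
have g1 : ycoef Ckap Cys b T != 0.
  by move: h3; rewrite /ycoef !(Ckap_swap h2) !(Ckap_swap h1) !hl !Pb !Pa.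
have g2 : ycoef Ckap Cys a (tab_swap b T) != 0.
  by move: h2; rewrite /ycoef !(Ckap_swap h1) !(Ckap_swap g1) !hl !Pb !Pa.
have g3 : ycoef Ckap Cys b (tab_swap a (tab_swap b T)) != 0.
  by move: h1; rewrite /ycoef !(Ckap_swap g2) !(Ckap_swap g1) !hl !Pa !Pb.
apply: val_inj; rewrite !val_tab_swap //; apply/ffunP => x; rewrite !ffunE !hl.
by rewrite tperm_braid.
Qed.

Lemma Ckap_repeat (a b : 'I_n.-1) T : b = a.+1 :> nat ->
  ~~ gen2 (Ckap T (lo a)) (Ckap T (hi b)) -> Ckap T (lo a) = 0 /\ Ckap T (hi b) = 0.
Proof.
move=> ba; have tT := std_tableau T.
have [E _|ne] := eqVneq (ct (val T) (lo a)) (ct (val T) (hi b)); last first.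
  by rewrite /gen2 /Ckap -rmorphB -rmorphD !fmorph_eq0 kappa_gen.
have z : ct (val T) (lo a) = 0%N.
  by apply: (@ct_repeat _ _ _ tT (lo a) (hi a) (hi b)) => //=; rewrite ba.
by rewrite /Ckap !kappaE -E z /pron mul0n sqrtr0.
Qed.

End Contents.

(** * Modules from representations *)

Section RepModule.
Variables (C : fieldType) (A : algType C) (V : lmodType C) (v0 : V) (hv0 : v0 != 0).

Definition rep_mod of {lrmorphism A -> endo_alg hv0} : Type := V.

Variable rho : {lrmorphism A -> endo_alg hv0}.

HB.instance Definition _ := GRing.Zmodule.on (rep_mod rho).

Definition rep_scale (a : A) (v : rep_mod rho) : rep_mod rho := endo_fun (rho a) v.

Fact rep_scaleA a b v : rep_scale a (rep_scale b v) = rep_scale (a * b) v.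
Proof. by rewrite /rep_scale lrM. Qed.
Fact rep_scale1 : left_id 1 rep_scale.
Proof. by move=> v; rewrite /rep_scale lr1. Qed.
Fact rep_scaleDr : right_distributive rep_scale +%R.
Proof. by move=> a u v; rewrite /rep_scale endoD. Qed.
Fact rep_scaleDl v : {morph rep_scale^~ v : a b / a + b}.
Proof. by move=> a b; rewrite /rep_scale lrD. Qed.

HB.instance Definition _ := GRing.Zmodule_isLmodule.Build A (rep_mod rho)
  rep_scaleA rep_scale1 rep_scaleDr rep_scaleDl.

End RepModule.

(** * Automorphisms of the Clifford algebra *)

Section CliffordPresented.
Variables (C : fieldType) (n : nat) (K : algType C) (c : 'I_n -> K).
Hypothesis pc : presented (@clifford_rels C n) c.

Lemma cliff_transp (a : 'I_n.-1) : exists f : {lrmorphism K -> K},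
  forall x, f (c x) = c (tperm (lo a) (hi a) x).
Proof.
have [[sq an] univ] := pc; have [|f [fE _]] := univ K (fun x => c (tperm (lo a) (hi a) x)).
  by split=> [x|x y xy]; [exact: sq | apply: an; rewrite (inj_eq perm_inj)].
by exists f.
Qed.

Lemma cliff_sign_flip (a : 'I_n) : exists f : {lrmorphism K -> K}, sign_flip c a f.
Proof.
have [[sq an] univ] := pc.
have [|f [fE _]] := univ K (fun x => (-1) ^+ (x == a) *: c x).
  split=> [x|x y xy]; first by rewrite exprZn sq -exprM mulnC exprM sqrrN expr1n expr1n scale1r.
  by rewrite -!scalerAl -!scalerAr an // !scalerN !scalerA mulrC.
by exists f.
Qed.

Lemma cliff_presented_free (k : {set 'I_n} -> C) : (2 : C) != 0 ->
  \sum_S k S *: cliff_mon c S = 0 -> forall S, k S = 0.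
Proof.
move=> two; apply: cliff_mon_free => //; [by case: pc | exact: cliff_sign_flip].
Qed.

End CliffordPresented.

(** * Construction of hat U^lambda *)

Section ModelModule.
Variables (R : realType) (n : nat).
Hypothesis n_gt0 : (0 < n)%N.
Variables (A : algType R[i]) (t : 'I_n.-1 -> A) (c : 'I_n -> A).
Hypothesis hA : sergeev_algebra t c.
Local Notation C := R[i].

Variable lam : spart n.

(* The module \hat U^lambda, with its basis c_S v_T, before grading. *)
Definition is_model (M : lmodType A) (v : std_tab lam -> M) : Prop :=
  [/\ forall m, exists k : std_tab lam -> {set 'I_n} -> C,
        m = \sum_T (\sum_S k T S *: cliff_mon c S) *: v T,
      forall k : std_tab lam -> {set 'I_n} -> C,
        \sum_T (\sum_S k T S *: cliff_mon c S) *: v T = 0 -> forall T S, k T S = 0,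
      forall (T : std_tab lam) (a : 'I_n.-1),
        let u := kappa R (val T) (lo a) in
        let u' := kappa R (val T) (hi a) in
        cox t c a *: v T =
          (((u' - u)^-1)%:C%C%:A +
             ((u' + u)^-1)%:C%C *: (c (lo a) * c (hi a))) *: v T +
          (Y_coef R (val T) a)%:C%C%:A *:
            oapp v 0 (insub (swap_entries (val T) a)) &
      forall (T : std_tab lam) (a : 'I_n),
        x_jm t c a *: v T = (kappa R (val T) a)%:C%C%:A *: v T].

(** The operators of [Model], with the contents and swaps of tableaux of shape [lam], satisfy the
    relations of the algebra and so define a module; the eigenvalues of the x_a are deduced
    afterwards. *)
Lemma model_exists : exists (M : lmodType A) (v : std_tab lam -> M), is_model v.
Proof.
have [T [K [t0 [c0 [iT [iK [[_ pK] _ gK gt [tE cE]]]]]]]] := sergeev_algebra_tensor hA.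
have cl : clifford_rels c0 by case: pK.
have [sg sgE] := choice (cliff_transp pK).
have [T0 _] := std_tab_exists n_gt0 lam.
pose V : lmodType C := {ffun std_tab lam -> K}.
pose v0 : V := [ffun=> 1]; have hv0 : v0 != 0.
  by apply/eqP => /ffunP/(_ T0); rewrite !ffunE => /eqP; rewrite oner_eq0.
pose kp := @Ckap R n lam; pose ys := @Cys R; pose sw := @tab_swap n lam.
pose s := sop c0 sg kp sw ys hv0.
pose cp (k : K) : endo_alg hv0 := cop hv0 k.
have sgn := @Ckap_gen R n lam.
(* The universal property asks for the t_a, which are recovered from the operators s_a. *)
have rels : sergeev_rels (t_of_cox s (fun x => cp (c0 x))) (fun x => cp (c0 x)).
  apply: t_of_cox_rels.
  - exact: cop_rels.
  - apply: sop_sq => //; [exact: Cys_sym | exact: Ys_sq | exact: tab_swapK | exact: Ckap_swap].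
  - exact: sop_c.
  - apply: sop_braid => //; [exact: Cys_sym | exact: Ys_sq | exact: tab_swapK | exact: Ckap_swap
      | exact: tab_swap_braid | exact: Ckap_repeat].
  - apply: sop_far => //; [exact: Ckap_swap | exact: tab_swap_far].
have [rho [rt rc]] := sergeev_univ hA rels.
have rK k : rho (iK k) = cp k.
  apply: (gK (fun k => rho (iK k) = cp k)) => [|i]; last by have := rc i; rewrite cE.
  split; first split.
  - by rewrite !lr0 -[in RHS](scale0r 1) /cp copZ scale0r.
  - by move=> l u w hu hw; rewrite !lrP hu hw /cp copD copZ.
  - by rewrite !lr1 /cp cop1.
  - by move=> u w hu hw; rewrite !lrM hu hw /cp copM.
have rs a : rho (cox t c a) = s a.
  rewrite /cox lrZ lrM lrB rt !rc; 
  have cpr : clifford_rels (fun x => cp (c0 x)) by exact: cop_rels.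
  exact: (cox_t_of_cox s cpr a).
(* [kv k T1] is the vector k v_T1. *)
pose kv (k : K) (T1 : std_tab lam) : V := [ffun T' => if T' == T1 then k else 0].
have kvP l k k' T1 : kv (l *: k + k') T1 = l *: kv k T1 + kv k' T1.
  by apply/ffunP => T'; rewrite !ffunE; case: ifP => // _; rewrite scaler0 addr0.
have kvZ l k T1 : kv (l *: k) T1 = l *: kv k T1.
  by apply/ffunP => T'; rewrite !ffunE; case: ifP => // _; rewrite scaler0.
have kvD k k' T1 : kv (k + k') T1 = kv k T1 + kv k' T1.
  by have := kvP 1 k k' T1; rewrite !scale1r.
have ck k l T1 : endo_fun (rho (iK k)) (kv l T1) = kv (k * l) T1.
  by rewrite rK; apply/ffunP => T'; rewrite !ffunE; case: ifP => // _; rewrite mulr0.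
have skv a k T1 : endo_fun (s a) (kv k T1) =
    kv (sg a k * dop c0 kp a T1) T1 + ycoef kp ys a T1 *: kv (sg a k) (sw a T1).
  apply/ffunP => T'; rewrite sopE !ffunE.
  have -> : (sw a T' == T1) = (T' == sw a T1).
    by apply/eqP/eqP => [<-|->]; rewrite /sw tab_swapK.
  case: (eqVneq T' T1) => [->|_]; case: eqVneq => [E|_]; rewrite ?lr0 ?mul0r ?scaler0 //.
    by rewrite E ycoef_sw //; [exact: Cys_sym | exact: tab_swapK | exact: Ckap_swap].
pose M : lmodType A := rep_mod rho.
pose v (T1 : std_tab lam) : M := kv 1 T1.
have zE (a : A) (m : M) : a *: m = endo_fun (rho a) m :> V by [].
have monE S : iK (cliff_mon c0 S) = cliff_mon c S.
  by rewrite /cliff_mon lr_prod; apply: eq_bigr => i _; rewrite cE.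
have cv (k : {set 'I_n} -> C) T1 :
    (\sum_S k S *: cliff_mon c S) *: v T1 = kv (\sum_S k S *: cliff_mon c0 S) T1 :> V.
  rewrite -[in RHS](mulr1 (\sum_S _)) -ck lr_sum zE; congr (endo_fun (rho _) _).
  by apply: eq_bigr => S _; rewrite lrZ monE.
have kvs (f : std_tab lam -> K) T' : (\sum_T1 kv (f T1) T1) T' = f T'.
  rewrite sum_ffunE (bigD1 T') //= ffunE eqxx big1 ?addr0 // => T1 ne.
  by rewrite ffunE eq_sym (negbTE ne).
have scalE (l : C) (m : M) : l%:A *: m = (l *: (m : V)) :> V.
  by rewrite zE lrZ lr1.
exists M, v; split.
- move=> m; have [k kE] := choice (fun T1 => cliff_span cl gK ((m : V) T1)).
  exists k; apply: etrans (_ : \sum_T1 kv ((m : V) T1) T1 = _).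
    by apply/ffunP => T'; rewrite kvs.
  by apply: eq_bigr => T1 _; rewrite kE -cv.
- move=> k k0 T1 S; apply: (cliff_presented_free pK (two_neq0 R)).
  have <- := kvs (fun T1 => \sum_S k T1 S *: cliff_mon c0 S) T1.
  have -> : \sum_T2 kv (\sum_S k T2 S *: cliff_mon c0 S) T2 = 0 :> V.
    by rewrite -[RHS]k0; apply: eq_bigr => T2 _; rewrite -cv.
  by rewrite ffunE.
- move=> T1 a u u'; rewrite /= scalE !zE rs skv lr1 mul1r; congr (_ + _).
    rewrite -[in LHS](mulr1 (dop _ _ _ _)) -ck; congr (endo_fun (rho _) _).
    rewrite /dop /dcoef lrD !lrZ lr1 lrM cE cE /= /kp /Ckap -/u -/u'.
    by rewrite -rmorphB -rmorphD /= -!fmorphV.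
  rewrite YcoefE; have := Y_neq0 R T1 a; rewrite YcoefE.
  case: insubP => [T2 sT E2|nst] /=.
    by move=> _; congr (_ *: _); rewrite /sw /tab_swap /v; congr kv; apply: val_inj;
      rewrite val_insubd sT.
  by rewrite (negbTE nst) => /negbFE/eqP ->; rewrite !scale0r.
(* Induction on [a] for all tableaux at once, since x_(a+1) v_T involves x_a at [T] and at its
   swap. *)
- move=> T1 a; rewrite scalE zE; move: a T1; apply: ord_ind => [a a0|a IH] T1.
    rewrite x_jm0 // lr0; have tT := std_tableau T1.
    by rewrite kappaE (ct0 tT a0) /pron mul0n sqrtr0 rmorph0 scale0r endo_alg0.
  have rA := sergeev_algebra_rels hA.
  have rx : rho (x_jm t c (hi a)) = s a * rho (x_jm t c (lo a)) * s a +
      s a * rho (iK (1 + c0 (lo a) * c0 (hi a))).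
    have -> : iK (1 + c0 (lo a) * c0 (hi a)) = 1 + c (lo a) * c (hi a).
      by rewrite lrD lr1 lrM !cE.
    by rewrite x_jm_rec // lrD !lrM !rs.
  pose e0 := c0 (lo a) * c0 (hi a).
  (* x_a anticommutes with e0 = c_a c_(a+1), which changes the sign of the coefficient of e0. *)
  have xD p q T2 : endo_fun (rho (x_jm t c (lo a))) (kv (p%:A + q *: e0) T2) =
      kp T2 (lo a) *: kv (p%:A - q *: e0) T2.
    rewrite -[X in kv X T2](mulr1 (p%:A + q *: e0)) -ck -endo_algM -lrM.
    have -> : x_jm t c (lo a) * iK (p%:A + q *: e0) =
        iK (p%:A - q *: e0) * x_jm t c (lo a).
      have lh := lo_neq_hi a.
      have e0E : iK e0 = c (lo a) * c (hi a) by rewrite lrM !cE.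
      have xe : x_jm t c (lo a) * iK e0 = - (iK e0 * x_jm t c (lo a)).
        by rewrite e0E mulrA (x_c_eq rA) mulNr -mulrA (x_c_neq rA) // mulrA.
      move: (x_jm t c (lo a)) xe => X xe.
      rewrite lrD lrB !lrZ lr1 mulrDr mulrBl -!scalerAr -!scalerAl mulr1 mul1r.
      by rewrite xe scalerN.
    by rewrite lrM endo_algM IH endoZ ck mulr1.
  have sge : sg a e0 = - e0.
    by rewrite lrM !sgE tpermL tpermR (cliff_anti cl) // eq_sym lo_neq_hi.
  pose u := kp T1 (lo a); pose u' := kp T1 (hi a).
  pose al := (u' - u)^-1; pose be := (u' + u)^-1.
  have DE : dop c0 kp a T1 = al%:A + be *: e0 by [].
  pose T2 := sw a T1; pose y := ycoef kp ys a T1; pose k2 := kp T2 (lo a).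
  pose D := dop c0 kp a T1; pose D2 := dop c0 kp a T2.
  have yT2 : ycoef kp ys a T2 = y.
    by rewrite ycoef_sw //; [exact: Cys_sym | exact: tab_swapK | exact: Ckap_swap].
  have sT2 : sw a T2 = T1 by apply: tab_swapK.
  have e2 : e0 * e0 = -1 by apply: (pair_sq cl); apply: lo_neq_hi.
  have biM p q p' q' : (p%:A + q *: e0) * (p'%:A + q' *: e0) =
      (p * p' - q * q')%:A + (p * q' + q * p') *: e0.
    rewrite mulrDl !mulrDr -!scalerAl -!scalerAr !mul1r mulr1 e2 !scalerA.
    by rewrite scalerN -scaleNr [X in _ + X]addrC addrACA -!scalerDl.
  have DD : D * D = (al ^+ 2 - be ^+ 2)%:A + (2 * al * be) *: e0.
    by rewrite /D DE biM; congr (_%:A + _ *: _); ring.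
  have /andP[g1 g2] : gen2 u u' := sgn T1 a.
  have y2 : y ^+ 2 = 1 - al ^+ 2 - be ^+ 2.
    rewrite Ys_sq /acoef -/(kp T1) -/u -/u' /al /be !exprVn (addrC u u') -(opprB u' u).
    by rewrite sqrrN.
  have k2E : y != 0 -> forall x, kp T2 x = kp T1 (tperm (lo a) (hi a) x).
    by move=> y0 x; apply: Ckap_swap.
  have biE : 1 - e0 = 1%:A + (-1) *: e0 by rewrite scale1r scaleN1r.
  have yky : y * k2 * y = u' * y ^+ 2.
    have [->|y0] := eqVneq y 0; first by rewrite !mul0r expr0n mulr0.
    by rewrite /k2 k2E // tpermL -/u' mulrC mulrA -expr2 mulrC.
  have biD p q p' q' : (p%:A + q *: e0) + (p'%:A + q' *: e0) =
      (p + p')%:A + (q + q') *: e0 by rewrite addrACA -!scalerDl.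
  have biZ p q l : l *: (p%:A + q *: e0) = (l * p)%:A + (l * q) *: e0.
    by rewrite scalerDr !scalerA.
  have bi1 p : p%:A = p%:A + 0 *: e0 by rewrite scale0r addr0.
  (* [E1] and [E2] are the coefficients of v_T and of its swap in x_(a+1) v_T, expanded by
     [x_jm_rec]. *)
  have E1 : u *: (D * D) + (y * k2 * y)%:A + (1 - e0) * D = u'%:A.
    rewrite DD /D DE biE biM biZ yky y2 [X in _ + X + _]bi1 !biD [RHS]bi1.
    by congr (_%:A + _ *: _); rewrite /al /be; field; rewrite ?g1 ?g2.
  have E2 : (u * y) *: D + (y * k2) *: D2 + y *: (1 - e0) = 0.
    have [->|y0] := eqVneq y 0; first by rewrite !mul0r mulr0 !scale0r !addr0.
    have g1' : u - u' != 0 by rewrite -opprB oppr_eq0.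
    have g2' : u + u' != 0 by rewrite addrC.
    have -> : D2 = ((u - u')^-1)%:A + (u + u')^-1 *: e0.
      by rewrite /D2 /dop /dcoef !k2E // tpermL tpermR.
    rewrite /k2 k2E // tpermL -/u' /D DE biE !biZ !biD.
    rewrite -[RHS](addr0 0) -[X in _ = X + _](scale0r (1 : K)) -[X in _ = _ + X](scale0r e0).
    by congr (_%:A + _ *: _); rewrite /al /be; field; rewrite ?g1 ?g2 ?g1' ?g2'.
  rewrite rx endo_algD !endo_algM ck mulr1 /v skv lr1 mul1r -/D -/y -/T2.
  rewrite endoD endoZ {1}/D DE xD IH -/u -/(kp T2) -/k2.
  rewrite endoD !endoZ !skv -/D -/D2 -/y -/T2 yT2 sT2 lrB lrD !lrZ lr1 sge mul1r.
  rewrite scalerN opprK -DE -/D -[(kappa R (val T2) (lo a))%:C%C]/k2.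
  rewrite -[(kappa R (val T1) (hi a))%:C%C]/u'.
  transitivity (kv (u *: (D * D) + (y * k2 * y)%:A + (1 - e0) * D) T1 +
                kv ((u * y) *: D + (y * k2) *: D2 + y *: (1 - e0)) T2).
    have kve : kv (1 - e0) T2 = kv 1 T2 + kv (- e0) T2 by exact: kvD.
    clearbody D D2; rewrite !kvD !kvZ kve !scalerDr !scalerA.
    by rewrite [LHS](AC (2*2*(1*2)) ((1*4*5)*(2*3*(6*7)))).
  have kv0 T' : kv 0 T' = 0 by rewrite -(scale0r (0 : K)) kvZ scale0r.
  by rewrite E1 E2 kvZ kv0 addr0.
Qed.

End ModelModule.

(** * Signed contents as weights and the action of e_U *)

Section Weights.
Variables (R : realType) (n : nat) (A : algType R[i]).
Variables (t : 'I_n.-1 -> A) (c : 'I_n -> A).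
Local Notation C := R[i].

Definition barred_index := {lam : spart n & barred_tab lam}.

Definition entry (i : barred_index) (a : 'I_n) : box n * bool :=
  (pos (projT2 i) a, barred (projT2 i) a).

Definition weight (i : barred_index) (a : 'I_n) : C := (scontent R (entry i a))%:C%C.

Definition e_of (i : barred_index) : A := e_tab t c (projT2 i).

Lemma diagram_spart_inj (lam lam' : spart n) :
  diagram n (parts lam) = diagram n (parts lam') -> lam = lam'.
Proof.
by move=> /(diagram_inj (leqnn n) (partsP lam) (partsP lam'))/(@parts_inj n).
Qed.

Lemma entry_inj (i i' : barred_index) : entry i =1 entry i' -> i = i'.
Proof.
case: i => lam U; case: i' => lam' U' E.
have E1 : val (val U).1 =1 val (val U').1 by move=> a; have := E a; rewrite /entry => -[].
have E2 a : (a \in (val U).2) = (a \in (val U').2) by have := E a; rewrite /entry => -[].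
have ll : lam = lam'.
  apply: diagram_spart_inj.
  have [_ _ h _] := std_tableau (val U).1; have [_ _ h' _] := std_tableau (val U').1.
  by apply/setP => b; rewrite h h'; apply: eq_existsb => a; rewrite E1.
case: lam' / ll in U' E E1 E2 *; congr existT; apply: val_inj.
case: (val U) (val U') E1 E2 => [T B] [T' B'] /= E1 E2; congr pair.
  by apply: val_inj; apply/ffunP.
exact/setP.
Qed.

(** The square of the signed content determines the content, hence the addable box. The sign then
    determines the bar: off the diagonal the content is positive, and on it no bar is allowed. *)
Lemma scontent_possible_inj (D : {set box n}) q q' :
  possible D q -> possible D q' -> scontent R q = scontent R q' -> q = q'.
Proof.
case: q => b s; case: q' => b' s' /andP[ab hs] /andP[ab' hs'].
have oct d : addable D d -> (d.1 <= d.2)%N.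
  by rewrite addableE => /andP[_ idl]; apply: (ideal_oct idl); rewrite in_setU1 eqxx.
rewrite /scontent /=; set m := (b.2 - b.1)%N; set m' := (b'.2 - b'.1)%N => E.
have p0 k : 0 <= (k * k.+1)%N%:R :> R by rewrite ler0n.
have mm : m = m'.
  apply: (@pron_inj R); have := congr1 (fun x => x ^+ 2) E.
  by rewrite !exprMn -!exprM ![(_ * 2)%N]mulnC !exprM !sqrrN !expr1n !mul1r !sqr_sqrtr.
have bb : b = b' by apply: addable_inj ab ab' mm.
congr pair => //; rewrite -{}bb in hs' *.
move: hs hs' E; rewrite /= -mm; have [dg|nd] := boolP (is_diag b); first by rewrite !implybF => /negbTE-> /negbTE->.
move=> _ _ E; have m0 : (0 < m)%N.
  rewrite /m subn_gt0 ltn_neqAle (oct _ ab) andbT; apply: contraNN nd => /eqP e.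
  by rewrite /is_diag -val_eqE /= e.
have : 0 < Num.sqrt (m * m.+1)%N%:R :> R by rewrite sqrtr_gt0 ltr0n muln_gt0 m0.
move: E; move: (Num.sqrt _) => x; clear; case: s; case: s' => //=; rewrite ?expr1 ?expr0 ?mulN1r ?mul1r => E x0; exfalso.
  by have := x0; rewrite -E oppr_gt0 ltNge ltW.
by have := x0; rewrite E oppr_gt0 ltNge ltW.
Qed.

Lemma entry_possible (i : barred_index) (k : 'I_n) :
  possible (prefix_set (pos (projT2 i)) k) (entry i k).
Proof.
case: i => lam U /=; rewrite /possible /= (tableau_addable _ (std_tableau (val U).1)) /=.
by apply/implyP => h; have /forall_inP := valP U; apply.
Qed.

Definition has_weight (M : lmodType A) (z : M) (w : 'I_n -> C) : Prop :=
  forall a, x_jm t c a *: z = (w a)%:A *: z.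

Lemma prod_scalar (M : lmodType A) (z : M) (I : finType) (P : pred I)
    (F : I -> A) (f : I -> C) :
  (forall i, P i -> F i *: z = (f i)%:A *: z) ->
  (\prod_(i | P i) F i) *: z = (\prod_(i | P i) f i)%:A *: z.
Proof.
move=> h; apply: (big_ind2 (fun x (y : C) => x *: z = y%:A *: z)) => //.
  by rewrite !scale1r.
move=> x y x' y' hx hx'.
rewrite -(scalerA x x') hx' scalerA -scalerAr mulr1 -[X in (_ *: X) *: z]mul1r scalerAl.
by rewrite -(scalerA _ x) hx scalerA -scalerAl mul1r scalerA mulrC.
Qed.

(** On a weight vector e_U is a product of scalars. For its own weight each factor is 1; otherwise a
    factor vanishes at the first entry where the two barred tableaux differ. *)
Lemma e_of_weight (M : lmodType A) (z : M) i i' :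
  has_weight z (weight i') -> e_of i *: z = if i == i' then z else 0.
Proof.
move=> hz; pose q0 k := entry i k.
pose D (k : 'I_n) := prefix_set (pos (projT2 i)) k.
pose f (k : 'I_n) (q : box n * bool) : C :=
  ((scontent R (q0 k) - scontent R q)^-1)%:C%C * (weight i' k - (scontent R q)%:C%C).
pose P (k : 'I_n) (q : box n * bool) := possible (D k) q && (q != q0 k).
have es : e_of i *: z = (\prod_k \prod_(q | P k q) f k q)%:A *: z.
  apply: prod_scalar => k _; apply: prod_scalar => q _.
  rewrite -[X in (_ *: X) *: z]mul1r scalerAl -scalerA scalerBl hz -scalerBl -scalerBl.
  by rewrite scalerA -scalerAl mul1r scalerA.
rewrite es; case: eqVneq => [ii'|ne].
  rewrite big1 ?scale1r ?scale1r // => k _; apply: big1 => q /andP[pq nq].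
  rewrite /f -ii' /weight -/(q0 k) -rmorphB -rmorphM /= mulVf // subr_eq0.
  by apply: contraNneq nq => E; apply/eqP/esym/(scontent_possible_inj (entry_possible i k) pq).
have [k kP kmin] : exists2 k : 'I_n, entry i k != entry i' k &
    forall j : 'I_n, (j < k)%N -> entry i j = entry i' j.
  have [k0 k0P] : exists k, entry i k != entry i' k.
    apply/existsP; apply: contraT; rewrite negb_exists => /forallP h.
    by case/eqP: ne; apply: entry_inj => a; apply/eqP; have := h a; rewrite negbK.
  case: (@arg_minnP _ k0 (fun k => entry i k != entry i' k) val k0P) => k kP kmin; exists k => // j jk.
  by apply/eqP; apply: contraTT jk => /kmin; rewrite -leqNgt.
suff -> : \prod_k \prod_(q | P k q) f k q = 0 by rewrite !scale0r.
(* Up to [k] the shapes agree, so the entry of [i'] is among the alternatives over which the factor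
   of [i] runs. *)
have DD : D k = prefix_set (pos (projT2 i')) k.
  apply/setP => b; rewrite !inE; apply: eq_existsb => a.
  by case: ltnP => //= /kmin []; rewrite /pos => ->.
rewrite (bigD1 k) //= (bigD1 (entry i' k)) /=; first by rewrite /f /weight subrr mulr0 !mul0r.
by rewrite /P DD entry_possible eq_sym.
Qed.

End Weights.

(** * Parity in the Sergeev algebra *)

Section Parity.
Variables (R : realType) (n : nat) (A : algType R[i]).
Variables (t : 'I_n.-1 -> A) (c : 'I_n -> A).
Hypothesis hA : sergeev_algebra t c.
Let rA := sergeev_algebra_rels hA.
Local Notation ev := (gA t c false).

(** Negating all generators preserves the relations, so it defines an endomorphism that acts by 1 on
    the even part and by -1 on the odd part. *)
Lemma parity_direct a : gA t c false a -> gA t c true a -> a = 0.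
Proof.
have [ts [csq can] tc] := rA.
have rA' : sergeev_rels (fun a => - t a) (fun b => - c b).
  case: ts => t1 t2 t3; split; [split| split |].
  - by move=> i; rewrite sqrrN.
  - by move=> i j ij; rewrite !mulrNN !mulrN t2.
  - by move=> i j ij; rewrite !mulrNN t3.
  - by move=> i; rewrite sqrrN.
  - by move=> i j ij; rewrite !mulrNN can.
  - by move=> i j; rewrite !mulrNN tc.
have [f [ft fc]] := sergeev_univ hA rA'.
have fE i x : gA t c i x -> f x = (-1) ^+ i *: x.
  apply: (parity_ind (P := fun x => f x = (-1) ^+ i *: x)).
    split; first by rewrite lr0 scaler0.
    by move=> k u v hu hv; rewrite lrP hu hv scalerDr !scalerA mulrC.
  move=> w <-; rewrite lr_prod signr_odd; elim: w => [|g w IH].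
    by rewrite !big_nil scale1r.
  have fg : f (sergeev_gen t c g) = - sergeev_gen t c g by case: g.
  by rewrite !big_cons IH [X in X * _]fg mulNr -scalerAr /= exprS mulN1r scaleNr.
move=> /fE; rewrite scale1r => E /fE; rewrite E scaleN1r => /eqP.
by rewrite -subr_eq0 opprK -mulr2n -scaler_nat scaler_eq0 (negbTE (two_neq0 R)) => /eqP.
Qed.

Lemma ev_subspace : subspace ev.
Proof. exact: parity_subspace. Qed.

Lemma ev1 : ev 1. Proof. exact: parity1. Qed.

Lemma evM a b : ev a -> ev b -> ev (a * b).
Proof. exact: (@parityM _ _ _ _ false false). Qed.

Lemma odd_t a : gA t c true (t a).
Proof. exact: (@parity_gen _ _ _ _ (inl a)). Qed.

Lemma odd_c b : gA t c true (c b).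
Proof. exact: (@parity_gen _ _ _ _ (inr b)). Qed.

Lemma ev_prod (I : Type) (r : seq I) (P : pred I) (F : I -> A) :
  (forall i, P i -> ev (F i)) -> ev (\prod_(i <- r | P i) F i).
Proof. by move=> h; apply: (big_ind (fun a => ev a)) => //; [exact: ev1 | exact: evM]. Qed.

Lemma ev_cc a b : ev (c a * c b).
Proof. exact: (@parityM _ _ _ _ true true _ _ (odd_c a) (odd_c b)). Qed.

Lemma ev_cox a : ev (cox t c a).
Proof.
apply: (subspaceZ _ ev_subspace); apply: (@parityM _ _ _ _ true true); first exact: odd_t.
apply: subspaceD (odd_c _) _; first exact: parity_subspace.
by apply: subspaceN (odd_c _); exact: parity_subspace.
Qed.

Lemma odd_jm a : gA t c true (jm t a).
Proof.
have so := parity_subspace (sergeev_gen t c) true.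
move: a; apply: ord_ind => [a a0|a IH]; first by rewrite jm0 //; case: so.
rewrite jm_rec; apply: (subspaceD so (odd_t a)); apply: (subspaceN so).
exact: (@parityM _ _ _ _ false true _ _ (@parityM _ _ _ _ true true _ _ (odd_t a) IH) (odd_t a)).
Qed.

Lemma ev_x a : ev (x_jm t c a).
Proof.
apply: (subspaceZ _ ev_subspace).
exact: (@parityM _ _ _ _ true true _ _ (odd_jm a) (odd_c a)).
Qed.

Lemma ev_e_of i : ev (e_of t c i).
Proof.
apply: ev_prod => k _; apply: ev_prod => q _; apply: (subspaceZ _ ev_subspace).
by apply: (subspaceD ev_subspace (ev_x k)); apply: (subspaceN ev_subspace);
  apply: (subspaceZ _ ev_subspace ev1).
Qed.

End Parity.

(** * The weight vectors c_S v_T and transitions between them *)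

Section Monomials.
Variables (R : realType) (n : nat) (A : algType R[i]).
Variables (t : 'I_n.-1 -> A) (c : 'I_n -> A).
Hypothesis hA : sergeev_algebra t c.
Local Notation C := R[i].
Let rA := sergeev_algebra_rels hA.
Let cl : clifford_rels c. Proof. by case: rA. Qed.

Let es : subspace (gA t c false) := @ev_subspace R n A t c.

Lemma x_cliff_mon a S :
  x_jm t c a * cliff_mon c S = ((-1) ^+ (a \in S) *: cliff_mon c S) * x_jm t c a.
Proof.
transitivity ((\prod_(b | b \in S) ((-1) ^+ (b == a) *: c b)) * x_jm t c a).
  apply: (big_ind2 (fun y z => x_jm t c a * y = z * x_jm t c a)) => [|y z y' z' h h'|b _].
  - by rewrite mulr1 mul1r.
  - by rewrite mulrA h -mulrA h' mulrA.
  - case: (eqVneq b a) => [->|ba]; first by rewrite (x_c_eq rA) scaleN1r mulNr.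
    by rewrite scale1r (x_c_neq rA) // eq_sym.
congr (_ * _); rewrite scaler_prod; congr (_ *: _); case: (boolP (a \in S)) => aS.
  rewrite (bigD1 a) //= eqxx expr1 big1 ?mulr1 // => i /andP[_ /negbTE ->].
  by rewrite expr0.
rewrite big1 // => i iS; rewrite (_ : i == a = false) //.
by apply: contraNF aS => /eqP <-.
Qed.

Section Barred.
Variable lam : spart n.

Definition diag_set (T : std_tab lam) : {set 'I_n} := finset (fun a => is_diag (val T a)).

Lemma barred_tab_of_subproof (T : std_tab lam) (S : {set 'I_n}) :
  [forall a in (S :\: diag_set T)%SET, ~~ is_diag (val T a)].
Proof. by apply/forall_inP => a; rewrite !inE => /andP[]. Qed.

(* The bars on the diagonal entries, whose signed content is 0, are dropped. *)
Definition barred_tab_of (T : std_tab lam) (S : {set 'I_n}) : barred_tab lam :=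
  exist (fun U : std_tab lam * {set 'I_n} => is_true [forall a in U.2, ~~ is_diag (val U.1 a)])
    (T, (S :\: diag_set T)%SET) (barred_tab_of_subproof T S).

Definition index_of (T : std_tab lam) (S : {set 'I_n}) : barred_index n :=
  existT (fun l => barred_tab l) lam (barred_tab_of T S).

Lemma index_of_barred (U : barred_tab lam) :
  index_of (val U).1 (val U).2 = existT (fun l => barred_tab l) lam U.
Proof.
congr existT; apply: val_inj => /=; case: U => -[T B] /= h; congr pair.
apply/setP => a; rewrite !inE; rewrite andbC.
by case: (boolP (a \in B)) => // aB; have /= -> := forall_inP h a aB.
Qed.

(** A letter a of [S] changes the sign of the eigenvalue of x_a, just as a bar does; on the diagonal
    the eigenvalue is 0 in any case. *)
Lemma cliff_mon_weight (M : lmodType A) (v : std_tab lam -> M) T S :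
  (forall (T : std_tab lam) (a : 'I_n),
     x_jm t c a *: v T = (kappa R (val T) a)%:C%C%:A *: v T) ->
  has_weight t c (cliff_mon c S *: v T) (weight R (index_of T S)).
Proof.
move=> xv a; rewrite scalerA x_cliff_mon -scalerA xv.
rewrite !scalerA -scalerAr mulr1 -scalerAl mul1r scalerA.
congr (_ *: _ *: _); rewrite /weight /kappa /scontent /=.
rewrite /barred /pos /= !inE expr0 mul1r; case: (boolP (is_diag (val T a))) => [/eqP dg|_] /=.
  by rewrite dg subnn mul0n sqrtr0 mulr0 mul0r.
by case: (a \in S); rewrite ?expr1 ?mulrN1 ?mulN1r ?rmorphN // mulr1 mul1r.
Qed.

Lemma entry_index_of T S a :
  entry (index_of T S) a = (val T a, (a \in S) && ~~ is_diag (val T a)).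
Proof. by rewrite /entry /pos /barred /= !inE andbC. Qed.

Lemma index_of_flip T S a i : is_diag (pos (projT2 i) a) ->
  (index_of T (flip a S) == i) = (index_of T S == i).
Proof.
move=> da; suff h S1 : index_of T S1 = i -> index_of T (flip a S1) = i.
  by apply/eqP/eqP => [/h|/h //]; rewrite flipK.
move=> Ei; rewrite -Ei in da *; apply: entry_inj => b.
rewrite !entry_index_of !inE; congr pair; case: eqVneq => [->|_]; last by rewrite addbF.
by rewrite (_ : is_diag (val T a)) ?andbF.
Qed.

Lemma e_of_cliff_mon (M : lmodType A) (v : std_tab lam -> M) T S i :
  is_model t c v ->
  e_of t c i *: (cliff_mon c S *: v T) =
    if i == index_of T S then cliff_mon c S *: v T else 0.
Proof. by case=> _ _ _ /(@cliff_mon_weight M v T S); apply: e_of_weight. Qed.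

(** For a standard swap, v_(s_a T) is obtained from v_T by the even element s_a - D divided by Y_a,
    and standard tableaux are connected by such swaps. Evenness is needed for the grading in
    [Uhat_exists]. *)
Lemma even_transition (M : lmodType A) (v : std_tab lam -> M) T0 T :
  is_model t c v -> exists2 psi, gA t c false psi & psi *: v T0 = v T.
Proof.
case=> _ _ sv _; move: T; apply: (std_tab_connected (T0 := T0)).
  by exists 1; [exact: ev1 | rewrite scale1r].
move=> T T' a [psi evp psiE] T'E.
have Y0 : (Y_coef R (val T) a)%:C%C != 0.
  by rewrite -YcoefE Y_neq0 -T'E; exact: valP.
have := sv T a; rewrite /= -T'E insubT; first exact: valP.
move=> st; rewrite /= (_ : Sub (val T') st = T'); last exact: val_inj.
set D := (X in X *: v T + _); move=> E; exists ((Y_coef R (val T) a)%:C%C^-1 *: (cox t c a - D) * psi).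
  apply: evM evp; apply: (subspaceZ _ es).
  apply: (subspaceD es); first exact: ev_cox.
  apply: (subspaceN es); apply: (subspaceD es).
    exact: (subspaceZ _ es (@ev1 R n A t c)).
  exact: (subspaceZ _ es (@ev_cc R n A t c _ _)).
rewrite -scalerA psiE -[X in (_ *: X) *: _]mul1r scalerAl -scalerA scalerBl E addrC addKr.
by rewrite scalerA -scalerAl mul1r scalerA mulVf // !scale1r.
Qed.

Lemma model_transition (M : lmodType A) (v : std_tab lam -> M) T S T' S' :
  is_model t c v -> exists psi, psi *: (cliff_mon c S *: v T) = cliff_mon c S' *: v T'.
Proof.
move=> mv; have [psi _ psiE] := even_transition T T' mv.
have [y [yS _]] := cliff_mon_linv cl S.
by exists (cliff_mon c S' * (psi * y)); rewrite !scalerA -!mulrA yS mulr1 -scalerA psiE.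
Qed.

End Barred.
End Monomials.

(** * Faithfulness and the idempotent relations *)

Section Faithful.
Variables (R : realType) (n : nat).
Hypothesis n_gt0 : (0 < n)%N.
Variables (A : algType R[i]) (t : 'I_n.-1 -> A) (c : 'I_n -> A).
Hypothesis hA : sergeev_algebra t c.
Local Notation C := R[i].
Let rA := sergeev_algebra_rels hA.
Let cl : clifford_rels c. Proof. by case: rA. Qed.

Definition model lam : lmodType A := projT1 (cid (model_exists n_gt0 hA lam)).

Lemma model_ex lam : exists v : std_tab lam -> model lam, is_model t c v.
Proof. by rewrite /model; case: cid. Qed.

Definition mvec lam : std_tab lam -> model lam := projT1 (cid (model_ex lam)).

Lemma mvecP lam : is_model t c (@mvec lam).
Proof. by rewrite /mvec; case: cid. Qed.

(** The vector w_U, fixed by e_U, through which S_n e_U is compared with hat U^lambda. *)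
Definition wvec lam (U : barred_tab lam) : model lam := cliff_mon c (val U).2 *: mvec (val U).1.

Local Notation E U := (e_tab t c U).

Lemma e_of_existT lam (U : barred_tab lam) : E U = e_of t c (existT (fun l => barred_tab l) lam U).
Proof. by []. Qed.

Lemma e_wvec lam (U U' : barred_tab lam) :
  E U *: wvec U' = if U == U' then wvec U' else 0.
Proof.
rewrite /wvec e_of_existT (e_of_cliff_mon hA _ _ _ (mvecP lam)) index_of_barred.
by rewrite eq_Tagged.
Qed.

Lemma e_wvec_neq lam lam' (U : barred_tab lam) (U' : barred_tab lam') :
  lam != lam' -> E U *: wvec U' = 0.
Proof.
move=> ne; rewrite /wvec e_of_existT (e_of_cliff_mon hA _ _ _ (mvecP lam')) index_of_barred.
by case: eqP => // /(congr1 (@projT1 _ _)) /= /eqP; rewrite (negbTE ne).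
Qed.

Lemma wvec_transition lam (U : barred_tab lam) T S :
  exists psi, psi *: wvec U = cliff_mon c S *: mvec T.
Proof. exact: (model_transition hA _ _ _ _ (mvecP lam)). Qed.

Definition pair_index := {lam : spart n & (std_tab lam * barred_tab lam)%type}.

Lemma card_pair_index : (n`! <= #|{: pair_index}|)%N.
Proof.
apply: leq_trans (tableau_pairs_count n_gt0) _.
rewrite card_tagged sumnE big_map big_enum /=.
by apply: leq_sum => lam _; rewrite card_prod.
Qed.

(** The independent elements c_S psi e_U are numerous enough to span, by [free_big_spans]. Applying
    such a combination to w_U isolates the coefficients for [U] as coordinates in the basis c_S
    v_T. *)
Lemma sergeev_faithful (a : A) : (forall lam (U : barred_tab lam), a *: wvec U = 0) -> a = 0.
Proof.
have h (p : pair_index) : exists q : A, q *: wvec (projT2 p).2 = mvec (projT2 p).1.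
  have [q qE] := wvec_transition (projT2 p).2 (projT2 p).1 finset.set0.
  by exists q; rewrite qE cliff_mon0 scale1r.
have [psi psiE] := choice h.
pose b (j : pair_index * {set 'I_n}) : A :=
  cliff_mon c j.2 * psi j.1 * E (projT2 j.1).2.
(* Of the factors e_U' only the one for [U] survives on w_U. *)
have bw (k : pair_index * {set 'I_n} -> C) lam (U : barred_tab lam) :
    (\sum_j k j *: b j) *: wvec U =
    \sum_T (\sum_S k (existT _ lam (T, U), S) *: cliff_mon c S) *: mvec T.
  have -> : \sum_j k j *: b j = \sum_p \sum_S k (p, S) *: b (p, S).
    by rewrite pair_bigA; apply: eq_bigr => -[].
  rewrite scaler_suml.
  have -> : \sum_(p : pair_index) (\sum_S k (p, S) *: b (p, S)) *: wvec U =
     \sum_(l : spart n) \sum_(q : std_tab l * barred_tab l)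
        (\sum_S k (existT _ l q, S) *: b (existT _ l q, S)) *: wvec U.
    by rewrite sig_big_dep; apply: eq_bigr => -[].
  rewrite (bigD1 lam) //= [X in _ + X]big1 ?addr0; last first.
    move=> l ll; apply: big1 => q _; rewrite scaler_suml big1 // => S _.
    by rewrite /b /= scalerAl -scalerA e_wvec_neq // scaler0.
  transitivity (\sum_T \sum_U' (\sum_S k (existT _ lam (T, U'), S) *:
      b (existT _ lam (T, U'), S)) *: wvec U).
    by rewrite pair_bigA; apply: eq_bigr => -[].
  apply: eq_bigr => T _; rewrite (bigD1 U) //= [X in _ + X]big1 ?addr0; last first.
    move=> U' UU; rewrite scaler_suml big1 // => S _.
    by rewrite /b /= scalerAl -scalerA e_wvec (negbTE UU) scaler0.
  rewrite !scaler_suml; apply: eq_bigr => S _; rewrite /b /= scalerAl -scalerA e_wvec eqxx.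
  by rewrite scalerAl -scalerA (psiE (existT _ lam (T, U))).
have bfree k : (forall lam (U : barred_tab lam), (\sum_j k j *: b j) *: wvec U = 0) ->
    forall j, k j = 0.
  move=> k0 [[lam [T U]] S]; have [_ free _ _] := mvecP lam.
  apply: (free (fun T S => k (existT _ lam (T, U), S)) _ T S).
  by have := k0 lam U; rewrite bw.
have [s sE] := sergeev_span hA n_gt0.
have [||k ->] := free_big_spans (s := s) (b := b) sE _ _ a.
- by move=> k k0; apply: bfree => lam U; rewrite k0 scale0r.
- by rewrite !card_prod card_ord leq_mul2r card_pair_index orbT.
by move=> /bfree k0; rewrite big1 // => j _; rewrite k0 scale0r.
Qed.

(** Since e_U fixes w_U and kills every other w_U', the product [a * E U] kills all of them. *)
Lemma wvec_ann lam (U : barred_tab lam) a : a *: wvec U = 0 -> a * E U = 0.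
Proof.
move=> a0; apply: sergeev_faithful => l U'; rewrite -scalerA.
have [ll|ll] := eqVneq lam l; last by rewrite e_wvec_neq // scaler0.
case: l / ll U' => U'; rewrite e_wvec; case: eqP => [<-//|_]; exact: scaler0.
Qed.

Lemma wvec_eq lam (U : barred_tab lam) a b : a *: wvec U = b *: wvec U -> a * E U = b * E U.
Proof.
by move=> ab; apply/eqP; rewrite -subr_eq0 -mulrBl wvec_ann ?eqxx // scalerBl ab subrr.
Qed.

Lemma e_wvecE lam (U : barred_tab lam) : E U *: wvec U = wvec U.
Proof. by rewrite e_wvec eqxx. Qed.

Lemma e_idem lam (U : barred_tab lam) : E U * E U = E U.
Proof. by rewrite -[RHS]mul1r; apply: wvec_eq; rewrite scale1r e_wvecE. Qed.

Lemma e_ortho (i j : barred_index n) : i != j -> e_of t c i * e_of t c j = 0.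
Proof.
case: i j => l U [l' U'] ij; apply: wvec_ann.
have [ll|ll] := eqVneq l l'; last exact: e_wvec_neq.
case: l' / ll U' ij => U'; rewrite eq_Tagged /= => UU.
by rewrite [LHS](e_wvec U U') (negbTE UU).
Qed.

Lemma e_sum : \sum_i e_of t c i = 1.
Proof.
apply/eqP; rewrite -subr_eq0; apply/eqP/sergeev_faithful => lam U.
rewrite scalerBl scale1r scaler_suml (bigD1 (existT (fun l => barred_tab l) lam U)) //=.
rewrite [X in _ + X - _]big1 ?addr0 => [|[l U'] ne]; first by rewrite [X in X - _]e_wvecE subrr.
rewrite -[wvec U]e_wvecE scalerA.
by rewrite -[_ * _]/(e_of t c (existT _ l U') * e_of t c (existT _ lam U)) e_ortho ?scale0r.
Qed.

(** On each model, c_d maps c_S v_T to a vector of the same barred tableau, because letters on the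
    diagonal carry no bar. *)
Lemma e_c (i : barred_index n) d : is_diag (pos (projT2 i) d) ->
  c d * e_of t c i = e_of t c i * c d.
Proof.
move=> dg; apply/eqP; rewrite -subr_eq0; apply/eqP/sergeev_faithful => lam U.
rewrite scalerBl -!scalerA /wvec; set T := (val U).1; set S := (val U).2.
have [s sE] := cliff_mon_flip cl d S.
have cw : c d *: (cliff_mon c S *: mvec T) =
    ((-1) ^+ s)%:A *: (cliff_mon c (flip d S) *: mvec T).
  by rewrite scalerA sE scalerA -scalerAl mul1r.
have comm (a : A) (k : C) (w : model lam) : a *: (k%:A *: w) = k%:A *: (a *: w).
  by rewrite !scalerA -scalerAr -scalerAl mulr1 mul1r.
rewrite cw comm !(e_of_cliff_mon hA _ _ _ (mvecP lam)) ![i == _]eq_sym index_of_flip //.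
by case: eqP; rewrite ?scaler0 ?cw subrr.
Qed.

End Faithful.

(** * Subalgebras generated by some of the c_d *)

Section CliffordSubalgebra.
Variables (R : realType) (n : nat) (A : algType R[i]).
Variables (t : 'I_n.-1 -> A) (c : 'I_n -> A).
Hypothesis hA : sergeev_algebra t c.
Local Notation C := R[i].

Lemma clifford_sub_subalgebra P : subalgebra (clifford_subalgebra c P).
Proof. exact: smallest_subalgebra. Qed.

Lemma clifford_sub_gen (P : pred 'I_n) d : P d -> clifford_subalgebra c P (c d).
Proof. by move=> Pd X [_]; apply; exists d. Qed.

Lemma clifford_sub_ind (P : pred 'I_n) (X : set A) : subalgebra X ->
  (forall d, P d -> X (c d)) -> forall a, clifford_subalgebra c P a -> X a.
Proof. by move=> sX gX a; apply; split=> // b [d [Pd ->]]; apply: gX. Qed.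

Lemma clifford_sub_mono (P Q : pred 'I_n) a : (forall d, P d -> Q d) ->
  clifford_subalgebra c P a -> clifford_subalgebra c Q a.
Proof.
move=> PQ; apply: clifford_sub_ind; first exact: clifford_sub_subalgebra.
by move=> d /PQ; exact: clifford_sub_gen.
Qed.

Lemma clifford_sub_mon (P : pred 'I_n) (S : {set 'I_n}) : (forall d, d \in S -> P d) ->
  clifford_subalgebra c P (cliff_mon c S).
Proof.
move=> SP; have [_ h1 hM] := clifford_sub_subalgebra P.
by apply: (big_ind (fun a => clifford_subalgebra c P a)) => // d /SP; exact: clifford_sub_gen.
Qed.

Lemma clifford_sub_coef P a : clifford_subalgebra c P a ->
  exists k : {set 'I_n} -> C, a = \sum_S k S *: cliff_mon c S.
Proof.
have [T [K [t0 [c0 [iT [iK [[_ pK] _ gK _ [_ cE]]]]]]]] := sergeev_algebra_tensor hA.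
have cl0 : clifford_rels c0 by case: pK.
move=> Pa; have [k ->] : exists k, a = iK k.
  apply: (clifford_sub_ind (X := fun a => exists k, a = iK k)) Pa; last first.
    by move=> d _; exists (c0 d); rewrite cE.
  split; first split.
  - by exists 0; rewrite lr0.
  - by move=> l _ _ [x ->] [y ->]; exists (l *: x + y); rewrite lrP.
  - by exists 1; rewrite lr1.
  - by move=> _ _ [x ->] [y ->]; exists (x * y); rewrite lrM.
have [l ->] := cliff_span cl0 gK k; exists l; rewrite lr_sum; apply: eq_bigr => S _.
by rewrite lrZ lr_prod; congr (_ *: _); apply: eq_bigr => d _; rewrite cE.
Qed.

Lemma clifford_sub_split P a : clifford_subalgebra c P a -> exists a0 a1,
  [/\ clifford_subalgebra c P a0 /\ gA t c false a0,
      clifford_subalgebra c P a1 /\ gA t c true a1 & a = a0 + a1].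
Proof.
have [sX X1 XM] := clifford_sub_subalgebra P.
have sg i : subspace (gA t c i) := parity_subspace _ i.
have M i j x y : gA t c i x -> gA t c j y -> gA t c (i (+) j) (x * y) by exact: parityM.
pose X a := exists a0 a1,
  [/\ clifford_subalgebra c P a0 /\ gA t c false a0,
      clifford_subalgebra c P a1 /\ gA t c true a1 & a = a0 + a1].
refine (clifford_sub_ind (X := X) _ _ (a := a)); last first.
  move=> d Pd; exists 0, (c d); rewrite add0r; split=> //.
    by split; [case: sX | case: (sg false)].
  by split; [exact: clifford_sub_gen | exact: odd_c].
split; first split.
- exists 0, 0; rewrite addr0; split=> //; split; try by case: sX.
    by case: (sg false).
  by case: (sg true).
- move=> k _ _ [x0 [x1 [[X0 g0] [X1' g1] ->]]] [y0 [y1 [[Y0 h0] [Y1 h1] ->]]].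
  exists (k *: x0 + y0), (k *: x1 + y1); rewrite scalerDr addrACA; split=> //.
    by split; [case: sX => _ | case: (sg false) => _]; apply.
  by split; [case: sX => _ | case: (sg true) => _]; apply.
- exists 1, 0; rewrite addr0; split=> //; first by split=> //; exact: ev1.
  by split; [case: sX | case: (sg true)].
- move=> _ _ [x0 [x1 [[X0 g0] [X1' g1] ->]]] [y0 [y1 [[Y0 h0] [Y1 h1] ->]]].
  exists (x0 * y0 + x1 * y1), (x0 * y1 + x1 * y0).
  rewrite mulrDl !mulrDr [RHS]addrACA [x1 * y1 + _]addrC -!addrA; split; last first.
    by congr (_ + _); rewrite addrCA.
    split; first exact: (subspaceD sX (XM _ _ X0 Y1) (XM _ _ X1' Y0)).
    exact: (subspaceD (sg true) (M false true _ _ g0 h1) (M true false _ _ g1 h0)).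
  split; first exact: (subspaceD sX (XM _ _ X0 Y0) (XM _ _ X1' Y1)).
  exact: (subspaceD (sg false) (M false false _ _ g0 h0) (M true true _ _ g1 h1)).
Qed.

(** * Matrix units transported to a Clifford subalgebra *)

Section MatrixUnits.
Variables (P : pred 'I_n) (p N : nat) (D : set 'M[C]_N) (gD : bool -> set 'M[C]_N).
Variables (phi : A -> 'M[C]_N) (u : 'I_p -> 'I_p -> 'M[C]_N) (E : 'I_p -> A).
Local Notation B := (clifford_subalgebra c P).
Hypothesis phiP : superalgebra_iso t c B D gD phi.
Hypothesis BE : forall r, B (E r).
Hypothesis phiE : forall r, phi (E r) = u r r.
Hypothesis uD : forall r s, D (u r s).
Hypothesis uM : forall r s s' r', u r s *m u s' r' = if s == s' then u r r' else 0.
Hypothesis u1 : \sum_r u r r = 1%:M.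
Hypothesis u_neq0 : forall r s, u r s != 0.
Hypothesis u_even : forall r, gD false (u r r).
Hypothesis gD_direct : forall M M', gD false M -> gD false M' -> gD true (M - M') -> M = M'.
Hypothesis gD_simple : forall i r M, D M -> gD i M -> M != 0 -> M *m u r r = M ->
  exists2 M', D M' & M' *m M = u r r.

Lemma phi0 : phi 0 = 0.
Proof.
have [hP _ _ _ _] := phiP; have [[B0 _] _ _] := clifford_sub_subalgebra P.
have := hP 1 0 0 B0 B0; rewrite !scale1r addr0 => /eqP.
by rewrite -subr_eq0 opprD addNKr oppr_eq0 => /eqP.
Qed.

Lemma phi_inj x y : B x -> B y -> phi x = phi y -> x = y.
Proof. by have [_ _ _ [_ inj _] _] := phiP => Bx By; apply: inj; rewrite inE. Qed.

Lemma phi_surj M : D M -> exists2 x, B x & phi x = M.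
Proof. by have [_ _ _ [_ _ surj] _] := phiP => /surj [x Bx <-]; exists x. Qed.

Lemma phi_sum (I : finType) (F : I -> A) : (forall i, B (F i)) ->
  phi (\sum_i F i) = \sum_i phi (F i).
Proof.
have [hP _ _ _ _] := phiP; have [[B0 BP] _ _] := clifford_sub_subalgebra P.
move=> BF; suff [] : B (\sum_i F i) /\ phi (\sum_i F i) = \sum_i phi (F i) by [].
apply: (big_rec2 (fun x y => B x /\ phi x = y)); first by rewrite phi0.
move=> i x _ _ [Bx <-]; rewrite -[F i]scale1r; split; first exact: BP.
by rewrite hP // !scale1r.
Qed.

Lemma cid_ortho r s : E r * E s = if r == s then E r else 0.
Proof.
have [_ hM _ _ _] := phiP; have [[B0 BP] _ BM] := clifford_sub_subalgebra P.
apply: phi_inj; first exact: BM; first by case: eqP.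
by rewrite hM // !phiE uM; case: eqP => [->|_]; rewrite ?phiE ?phi0.
Qed.

Lemma cid_sum : \sum_r E r = 1.
Proof.
have [_ _ h1 _ _] := phiP; have [sB B1 _] := clifford_sub_subalgebra P.
apply: phi_inj => //; first exact: subspace_sum.
by rewrite phi_sum // h1 -u1; apply: eq_bigr => r _; rewrite phiE.
Qed.

(** The image of the even part of [E r] differs from an even matrix by an odd one, so it is the
    image of [E r] itself. *)
Lemma cid_even r : gA t c false (E r).
Proof.
have [hP _ _ _ hg] := phiP; have [sB _ _] := clifford_sub_subalgebra P.
have [a0 [a1 [[B0 g0] [B1 g1] EE]]] := clifford_sub_split (BE r).
suff <- : a0 = E r by [].
apply: phi_inj => //; apply: gD_direct; first exact: (hg false).
  by rewrite phiE.
have -> : phi a0 - phi (E r) = phi (- a1).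
  have -> : - a1 = (-1) *: E r + a0 by rewrite EE scaleN1r opprD addrC addNKr.
  by rewrite hP // scaleN1r addrC.
apply: (hg true); first exact: (subspaceN sB B1).
exact: (subspaceN (@parity_subspace _ _ _ (sergeev_gen t c) true) g1).
Qed.

Lemma cid_simple i r y : B y -> gA t c i y -> y != 0 -> y * E r = y ->
  exists2 b, B b & b * y = E r.
Proof.
have [_ hM _ [hD _ _] hg] := phiP; have [[B0 _] _ BM] := clifford_sub_subalgebra P.
move=> By gy y0 yE; have [||||M DM ME] := gD_simple (i := i) (r := r) (M := phi y).
- exact: hD.
- exact: hg.
- by apply: contraNneq y0; rewrite -phi0 => /phi_inj ->.
- by rewrite -phiE -hM // yE.
have [b Bb bE] := phi_surj DM; exists b => //.
by apply: phi_inj => //; [exact: BM | rewrite hM // bE ME phiE].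
Qed.

Lemma cid_unit r s : exists x, [/\ B x, x != 0, E r * x = x & x * E s = x].
Proof.
have [_ hM _ _ _] := phiP; have [[B0 _] _ BM] := clifford_sub_subalgebra P.
have [x Bx xE] := phi_surj (uD r s); exists x; split=> //.
- by apply: contraNneq (u_neq0 r s) => x0; rewrite -xE x0 phi0.
- by apply: phi_inj => //; [exact: BM | rewrite hM // phiE xE uM eqxx].
- by apply: phi_inj => //; [exact: BM | rewrite hM // phiE xE uM eqxx].
Qed.

End MatrixUnits.

End CliffordSubalgebra.

(** * Elementary matrix computations *)

Section MatrixModels.
Variables (C : fieldType) (N : nat).
Implicit Types (r s : 'I_N) (M : 'M[C]_N).

Lemma delta_mx_mul r s s' r' :
  delta_mx r s *m delta_mx s' r' = if s == s' then delta_mx r r' else 0 :> 'M[C]_N.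
Proof. by rewrite mul_delta_mx_cond; case: eqP; rewrite ?mulr1n ?mulr0n. Qed.

Lemma delta_mx_sum : \sum_r delta_mx r r = 1%:M :> 'M[C]_N.
Proof.
apply/matrixP => i j; rewrite summxE !mxE (bigD1 i) //= mxE eqxx big1 ?addr0 => [|k ki].
  by rewrite eq_sym.
by rewrite mxE eq_sym (negbTE ki).
Qed.

Lemma delta_mx_neq0 r s : delta_mx r s != 0 :> 'M[C]_N.
Proof. by apply/eqP => /matrixP/(_ r s)/eqP; rewrite !mxE !eqxx oner_eq0. Qed.

(** M vanishes outside column r; a multiple of [delta_mx r s] moves a nonzero entry of that column
    to position (r, r). *)
Lemma column_delta_mx M r : M != 0 -> M *m delta_mx r r = M ->
  exists M', M' *m M = delta_mx r r.
Proof.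
move=> M0 ME; have ME' i j : M i j = M i r *+ (j == r).
  rewrite -{1}ME mxE (bigD1 r) //= mxE eqxx big1 ?addr0 => [|k kr].
    by case: eqP; rewrite ?mulr1 ?mulr0 // mulr0n.
  by rewrite mxE (negbTE kr) mulr0.
have [s sr] : exists s, M s r != 0.
  apply/existsP; apply: contraNT M0; rewrite negb_exists => /forallP h.
  apply/eqP/matrixP => i j; rewrite ME' mxE; have := h i; rewrite negbK => /eqP ->.
  exact: mul0rn.
exists ((M s r)^-1 *: delta_mx r s); apply/matrixP => i j; rewrite -scalemxAl !mxE.
rewrite (bigD1 s) //= mxE eqxx andbT big1 ?addr0 => [|k ks].
  rewrite (ME' s j); case: (i == r); case: (j == r);
    rewrite ?mulr1n ?mulr0n ?mul1r ?mul0r ?mulr0 ?mulVf //.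
by rewrite mxE (negbTE ks) andbF mul0r.
Qed.

Lemma block_mx_eq0 (M0 M1 M2 M3 : 'M[C]_N) : block_mx M0 M1 M2 M3 = 0 ->
  [/\ M0 = 0, M1 = 0, M2 = 0 & M3 = 0].
Proof. by rewrite -(block_mx0 _ N N N N) => /eq_block_mx. Qed.

End MatrixModels.

(** * Common properties of the Clifford idempotents *)

Section Idempotents.
Variables (R : realType) (n : nat) (A : algType R[i]).
Variables (t : 'I_n.-1 -> A) (c : 'I_n -> A).
Local Notation C := R[i].

(* Everything that is used of the isomorphism of the Clifford subalgebra with *)
(* Mat or Q; the two types of superalgebras are treated alike afterwards.     *)
Definition matrix_idempotents (P : pred 'I_n) (p : nat) (E : 'I_p -> A) : Prop :=
  let B := clifford_subalgebra c P in
  [/\ forall r, B (E r) /\ gA t c false (E r),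
      forall r s, E r * E s = if r == s then E r else 0,
      \sum_r E r = 1,
      forall i r y, B y -> gA t c i y -> y != 0 -> y * E r = y ->
        exists2 b, B b & b * y = E r &
      forall r s, exists x, [/\ B x, x != 0, E r * x = x & x * E s = x]].

Lemma clifford_idempotentsP lam (U : barred_tab lam) E :
  clifford_idempotents t c U E -> matrix_idempotents (diag_entry U) E.
Proof.
case=> BE; set N := (2 ^ (len lam)./2)%N; case: ifP => _ [phi [phiP phiE]].
- pose u (r s : 'I_N) : 'M[C]_(N + N) := block_mx (delta_mx r s) 0 0 (delta_mx r s).
  have uD r s : Q_mat (u r s) by exists (delta_mx r s), 0.
  have uM r s s' r' : u r s *m u s' r' = if s == s' then u r r' else 0.
    rewrite /u mulmx_block !mulmx0 !mul0mx !addr0 add0r delta_mx_mul.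
    by case: eqP => // _; rewrite block_mx0.
  have u1 : \sum_r u r r = 1%:M.
    rewrite scalar_mx_block -delta_mx_sum.
    apply: (big_ind2 (fun x y => x = block_mx y 0 0 y)) => //; first by rewrite block_mx0.
    by move=> _ y _ y' -> ->; rewrite add_block_mx !addr0.
  have u0 r s : u r s != 0.
    by apply/eqP => /block_mx_eq0 [/eqP]; rewrite (negbTE (delta_mx_neq0 _ r s)).
  have ue r : Q_part false (u r r) by exists (delta_mx r r).
  have gdir (M M' : 'M[C]_(N + N)) : Q_part false M -> Q_part false M' ->
      Q_part true (M - M') -> M = M'.
    move=> [M0 ->] [M1 ->] [M2] /=; rewrite opp_block_mx add_block_mx !subr0.
    by case/eq_block_mx => /eqP; rewrite subr_eq0 => /eqP ->.
  have gsim i r (M : 'M[C]_(N + N)) : Q_mat M -> Q_part i M -> M != 0 ->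
      M *m u r r = M -> exists2 M', Q_mat M' & M' *m M = u r r.
    (* A homogeneous element of Q is given by one block, and its left inverse can be taken of the
       same parity. Homogeneity is essential: Q is not simple as an ungraded algebra. *)
    move=> _ [M0 ->]; case: i => M00.
      rewrite /u mulmx_block !mulmx0 !mul0mx !addr0 !add0r => /eq_block_mx [_ M0E _ _].
      have [|M1 M1E] := column_delta_mx _ M0E.
        by apply: contraNneq M00 => ->; rewrite block_mx0.
      exists (block_mx 0 M1 M1 0); first by exists 0, M1.
      by rewrite mulmx_block !mulmx0 !mul0mx !addr0 !add0r M1E.
    rewrite /u mulmx_block !mulmx0 !mul0mx !addr0 !add0r => /eq_block_mx [M0E _ _ _].
    have [|M1 M1E] := column_delta_mx _ M0E.
      by apply: contraNneq M00 => ->; rewrite block_mx0.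
    exists (block_mx M1 0 0 M1); first by exists M1, 0.
    by rewrite mulmx_block !mulmx0 !mul0mx !addr0 !add0r M1E.
  split.
  + by move=> r; split; [exact: BE | apply: (cid_even (u := u) phiP)].
  + by move=> r s; apply: (cid_ortho (u := u) phiP).
  + exact: (cid_sum (u := u) phiP).
  + by move=> i r y; apply: (cid_simple (u := u) phiP).
  + by move=> r s; apply: (cid_unit (u := u) phiP).
- pose u (r s : 'I_N) : 'M[C]_N := delta_mx r s.
  have ue r : mat_part false (u r r).
    move=> y z; rewrite mxE; case: (y =P r) => [->|//]; case: (z =P r) => [->|//].
    by rewrite addbb.
  have gdir (M M' : 'M[C]_N) : mat_part false M -> mat_part false M' ->
      mat_part true (M - M') -> M = M'.
    move=> h h' h1; apply/matrixP => y z; have := h y z; have := h' y z; have := h1 y z.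
    rewrite !mxE; case: (_ (+) _) => /=.
      by move=> _ -> // ->.
    by move=> /(_ isT)/eqP; rewrite subr_eq0 => /eqP.
  split.
  + by move=> r; split; [exact: BE | apply: (cid_even (u := u) phiP)].
  + by move=> r s; apply: (cid_ortho (u := u) phiP) => //; exact: delta_mx_mul.
  + by apply: (cid_sum (u := u) phiP) => //; exact: delta_mx_sum.
  + move=> i r y; apply: (cid_simple (u := u) phiP) => // j s M _ _ M0.
    by case/(column_delta_mx M0) => M' M'E; exists M'.
  + move=> r s; apply: (cid_unit (u := u) phiP) => //; first exact: delta_mx_mul.
    by move=> *; exact: delta_mx_neq0.
Qed.

End Idempotents.

(** * The corner e_U S_n e_U *)

Section LeftIdeal.
Variables (R : realType) (n : nat).
Hypothesis n_gt0 : (0 < n)%N.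
Variables (A : algType R[i]) (t : 'I_n.-1 -> A) (c : 'I_n -> A).
Hypothesis hA : sergeev_algebra t c.
Local Notation C := R[i].
Let rA := sergeev_algebra_rels hA.
Let cl : clifford_rels c. Proof. by case: rA. Qed.

Variables (lam : spart n) (U : barred_tab lam).
Local Notation B := (clifford_subalgebra c (diag_entry U)).
Local Notation eU := (e_tab t c U).
Local Notation w := (wvec n_gt0 hA U).
Local Notation v := (mvec n_gt0 hA (lam := lam)).

Lemma scaler_swap (M : lmodType A) (a b : A) (k : C) (m : M) :
  a *: ((k *: b) *: m) = k%:A *: (a *: (b *: m)).
Proof. by rewrite !scalerA -scalerAr -!scalerAl mul1r. Qed.

Lemma diag_clifford_comm b : B b -> b * eU = eU * b.
Proof.
move: b; refine (clifford_sub_ind (X := fun b => b * eU = eU * b) _ _); last first.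
  by move=> d Pd; apply: (e_c n_gt0 hA (i := existT _ lam U)).
split; first split.
- by rewrite mul0r mulr0.
- by move=> k x y hx hy; rewrite mulrDl mulrDr -scalerAl -scalerAr hx hy.
- by rewrite mul1r mulr1.
- by move=> x y hx hy; rewrite -mulrA hy mulrA hx mulrA.
Qed.

Lemma clifford_mul_vec_eq0 P T b : clifford_subalgebra c P b -> b *: v T = 0 -> b = 0.
Proof.
have [_ free _ _] := mvecP n_gt0 hA lam.
move=> /(clifford_sub_coef hA) [k ->] b0; apply: big1 => S _.
suff h : \sum_T' (\sum_S (if T' == T then k S else 0) *: cliff_mon c S) *: v T' = 0.
  by have := free _ h T S; rewrite eqxx => ->; rewrite scale0r.
rewrite (bigD1 T) //= eqxx b0 add0r big1 // => T' /negbTE ->.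
by rewrite big1 ?scale0r // => S' _; rewrite scale0r.
Qed.

Lemma clifford_mul_e_eq0 P b : clifford_subalgebra c P b -> b * eU = 0 -> b = 0.
Proof.
move=> Bb be0; have [y [_ yE]] := cliff_mon_linv cl (val U).2.
suff bc0 : b * cliff_mon c (val U).2 = 0 by rewrite -[b]mulr1 -yE mulrA bc0 mul0r.
apply: (@clifford_mul_vec_eq0 predT (val U).1).
  have [_ _ BM] := clifford_sub_subalgebra c predT; apply: BM.
    by apply: clifford_sub_mono Bb.
  exact: clifford_sub_mon.
by rewrite -scalerA -[_ *: v _]/w -(e_wvecE n_gt0 hA U) scalerA be0 scale0r.
Qed.

(** Such an [S] differs from the bars of [U] by diagonal letters only, and these are removed one at
    a time by multiplication in [B]. *)
Lemma diag_mon_wvec S : existT _ lam U = index_of (val U).1 S ->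
  exists2 b, B b & b *: w = cliff_mon c S *: v (val U).1.
Proof.
have [sB B1 BM] := clifford_sub_subalgebra c (diag_entry U).
have [k] := ubnP #|(S :&: diag_set (val U).1)%SET|; elim: k S => // k IH S kS US.
have [S0|[d]] := set_0Vmem (S :&: diag_set (val U).1)%SET.
  exists 1 => //; rewrite scale1r /wvec; congr (cliff_mon c _ *: _).
  have : existT (fun l => barred_tab l) lam U == index_of (val U).1 S by apply/eqP.
  rewrite eq_Tagged /= => /eqP/(congr1 (fun V => (val V).2)) /= ->.
  by apply/finset.setDidPl; rewrite -finset.setI_eq0 S0.
rewrite !inE => /andP[dS dd].
have [||b Bb bE] := IH (flip d S).
- rewrite ltnS in kS; apply: (leq_trans _ kS); apply: proper_card; apply/properP; split.
    apply/fintype.subsetP => a; rewrite !inE; case: eqVneq => [->|_]; rewrite ?addbF //.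
    by rewrite dS.
  by exists d; rewrite !inE ?dS ?eqxx.
- by apply/esym/eqP; rewrite index_of_flip; [rewrite -US | exact: dd].
have [s sE] := cliff_mon_flip cl d (flip d S); rewrite flipK in sE.
exists ((-1) ^+ s *: (c d * b)).
  apply: (subspaceZ _ sB); apply: BM => //; exact: clifford_sub_gen.
have -> : cliff_mon c S = (-1) ^+ s *: (c d * cliff_mon c (flip d S)).
  by rewrite sE scalerA -expr2 sqrr_sign scale1r.
by rewrite !scalerAl -!scalerA bE.
Qed.

(** The image of e_U in the model is spanned by the c_S v_T with barred tableau [U], which lie in B
    w_U; [wvec_eq] transfers this to the algebra. *)
Lemma corner a : exists2 b, B b & eU * a * eU = b * eU.
Proof.
suff [b Bb bE] : exists2 b, B b & eU *: (a *: w) = b *: w.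
  by exists b => //; apply: wvec_eq; rewrite -scalerA.
have [sB B1 BM] := clifford_sub_subalgebra c (diag_entry U).
have [span _ _ _] := mvecP n_gt0 hA lam; have [k ->] := span (a *: w).
pose Q m := exists2 b, B b & m = b *: w.
have Q0 : Q 0 by exists 0; [case: sB | rewrite scale0r].
have QD x y : Q x -> Q y -> Q (x + y).
  by move=> [b Bb ->] [b' Bb' ->]; exists (b + b'); [exact: (subspaceD sB) | rewrite scalerDl].
rewrite scaler_sumr; apply: (big_ind Q) => // T _.
rewrite scaler_suml scaler_sumr; apply: (big_ind Q) => // S _.
rewrite scaler_swap (e_of_existT t c) (e_of_cliff_mon hA _ _ _ (mvecP n_gt0 hA lam)).
case: eqP => [US|_]; last by rewrite scaler0.
have TU : T = (val U).1.
  have : existT (fun l => barred_tab l) lam U == index_of T S by apply/eqP.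
  by rewrite eq_Tagged /= => /eqP ->.
rewrite TU in US *; have [b Bb <-] := diag_mon_wvec US.
exists (k T S *: b); first exact: (subspaceZ _ sB).
by rewrite scalerA -scalerAl mul1r TU.
Qed.

(** Some e_U' x is nonzero because the e_U' sum to 1, and U' has shape [lam] because x w_U lies in
    the model of [lam]. Transitions between w_U and w_U' then factor e_U' x through e_U. *)
Lemma corner_reach x : x * eU = x -> x != 0 -> exists a, eU * (a * x) != 0.
Proof.
move=> xe x0.
have xw : x *: w != 0.
  by apply: contraNneq x0 => xw0; rewrite -xe wvec_ann.
have [span _ _ _] := mvecP n_gt0 hA lam; have [k kE] := span (x *: w).
have [j jx] : exists j, e_of t c j * x != 0.
  apply/existsP; apply: contraNT x0; rewrite negb_exists => /forallP h.
  rewrite -[x]mul1r -(e_sum n_gt0 hA) mulr_suml big1 // => j _.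
  by apply/eqP; have := h j; rewrite negbK.
case: j jx => l U'; rewrite -(e_of_existT t c) => jx.
have ll : lam = l.
  apply/eqP; apply: contraNT jx => ll; rewrite -xe mulrA.
  apply/eqP/wvec_ann; rewrite -scalerA kE scaler_sumr big1 // => T _.
  rewrite scaler_suml scaler_sumr big1 // => S _.
  rewrite scaler_swap (e_of_existT t c) (e_of_cliff_mon hA _ _ _ (mvecP n_gt0 hA lam)).
  case: eqP => [/(congr1 (@projT1 _ _)) /= E|_]; last by rewrite scaler0.
  by rewrite E eqxx in ll.
case: l / ll U' jx => U' jx.
have [al alE] := model_transition hA (val U').1 (val U').2 (val U).1 (val U).2 (mvecP n_gt0 hA lam).
have [be beE] := model_transition hA (val U).1 (val U).2 (val U').1 (val U').2 (mvecP n_gt0 hA lam).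
have h1 : be * al * e_tab t c U' = e_tab t c U'.
  by rewrite -[RHS]mul1r; apply: wvec_eq; rewrite -scalerA alE beE scale1r.
have h2 : eU * al * e_tab t c U' = al * e_tab t c U'.
  by apply: wvec_eq; rewrite -scalerA alE (e_wvecE n_gt0 hA).
exists (al * e_tab t c U'); apply: contraNneq jx => h0.
have -> : e_tab t c U' * x = be * (eU * (al * e_tab t c U' * x)).
  by rewrite -{1}h1 -(mulrA be) -{1}h2 !mulrA.
by rewrite h0 mulr0.
Qed.

End LeftIdeal.

(** * Homogeneous components in supermodules *)

Section SupermoduleTheory.
Variables (C : fieldType) (A : algType C) (gA : bool -> set A).
Variables (V : lmodType A) (gV : bool -> set V).
Hypothesis sV : supermodule gA gV.

Lemma supermoduleB i u v : gV i u -> gV i v -> gV i (u - v).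
Proof.
have [/(_ i) [_ h] _ _] := sV => gu gv.
by have := h (-1) v u gv gu; rewrite scaleN1r scaleNr scale1r addrC.
Qed.

Lemma supermodule_split v : exists v0 v1, [/\ gV false v0, gV true v1 & v = v0 + v1].
Proof.
have [_ /(_ v) [f [[gf ->] _]] _] := sV.
by exists (f false), (f true); split=> //; rewrite big_bool /= addrC.
Qed.

Lemma supermodule_direct v0 v1 : gV false v0 -> gV true v1 -> v0 + v1 = 0 -> v0 = 0 /\ v1 = 0.
Proof.
have [g0 /(_ 0) [f [_ uniq]] _] := sV => gv0 gv1 E.
have f0 : f = [ffun=> 0].
  apply: uniq; split; first by move=> j; rewrite ffunE; case: (g0 j).
  by rewrite big1 // => j _; rewrite ffunE.
have fv : f = [ffun i => if i then v1 else v0].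
  apply: uniq; split; first by case; rewrite ffunE.
  by rewrite big_bool /= !ffunE addrC E.
by split; [have := congr1 (fun h => fun_of_fin h false) fv
  | have := congr1 (fun h => fun_of_fin h true) fv]; rewrite f0 !ffunE => <-.
Qed.

End SupermoduleTheory.

(** * Simplicity of the left ideals *)

Section SimpleIdeal.
Variables (R : realType) (n : nat).
Hypothesis n_gt0 : (0 < n)%N.
Variables (A : algType R[i]) (t : 'I_n.-1 -> A) (c : 'I_n -> A).
Hypothesis hA : sergeev_algebra t c.
Local Notation C := R[i].
Local Notation gr := (gA t c).

Let sg i : subspace (gr i). Proof. exact: parity_subspace. Qed.
Let gM i j x y : gr i x -> gr j y -> gr (i (+) j) (x * y). Proof. exact: parityM. Qed.

Lemma grB i x y : gr i x -> gr i y -> gr i (x - y).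
Proof. by move=> gx gy; apply: (subspaceD (sg i) gx (subspaceN (sg i) gy)). Qed.

Lemma gr_split (x : A) : exists x0 x1, [/\ gr false x0, gr true x1 & x = x0 + x1].
Proof. exact: parity_split (sergeev_generates hA) x. Qed.

Lemma gr_direct x0 x1 y0 y1 : gr false x0 -> gr true x1 -> gr false y0 -> gr true y1 ->
  x0 + x1 = y0 + y1 -> x0 = y0 /\ x1 = y1.
Proof.
move=> gx0 gx1 gy0 gy1 E; have E' : x0 - y0 = y1 - x1.
  by apply/eqP; rewrite subr_eq addrAC eq_sym subr_eq E addrC.
have z : x0 - y0 = 0 by apply: (parity_direct hA); [exact: grB | rewrite E'; exact: grB].
split; first by apply/eqP; rewrite -subr_eq0 z.
by apply/eqP; rewrite eq_sym -subr_eq0 -E' z.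
Qed.

Lemma gr_fixed e x0 x1 : gr false e -> gr false x0 -> gr true x1 ->
  (x0 + x1) * e = x0 + x1 -> x0 * e = x0 /\ x1 * e = x1.
Proof.
move=> ge g0 g1; rewrite mulrDl; apply: gr_direct => //.
  exact: (gM (i := false) (j := false)).
exact: (gM (i := true) (j := false)).
Qed.

Variables (lam : spart n) (U : barred_tab lam) (p : nat) (E : 'I_p -> A).
Hypothesis mE : matrix_idempotents t c (diag_entry U) E.
Local Notation B := (clifford_subalgebra c (diag_entry U)).
Local Notation eU := (e_tab t c U).
Local Notation e r := (E r * e_tab t c U).

Lemma E_comm r : E r * eU = eU * E r.
Proof. by apply: (diag_clifford_comm n_gt0 hA); case: mE => /(_ r)[]. Qed.

Lemma e_mul r s : e r * e s = if r == s then e r else 0.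
Proof.
have [_ oE _ _ _] := mE.
rewrite E_comm mulrA -[eU * E r * E s]mulrA oE; case: eqP => _; last by rewrite mulr0 mul0r.
by rewrite -E_comm -mulrA (e_idem n_gt0 hA).
Qed.

Lemma e_even r : gr false (e r).
Proof.
apply: (gM (i := false) (j := false)); first by case: mE => /(_ r)[].
exact: (@ev_e_of _ _ _ t c (existT _ lam U)).
Qed.

Lemma e_fix_eU r x : x * e r = x -> x * eU = x.
Proof. by move=> <-; rewrite -!mulrA (e_idem n_gt0 hA). Qed.

Lemma e_fix_E r x : x * e r = x -> x * E r = x.
Proof.
have [_ oE _ _ _] := mE; move=> <-.
by rewrite E_comm -!mulrA oE eqxx.
Qed.

(** By [corner_reach] and [corner], [X] contains a nonzero element b E_r e_U with b in the Clifford
    subalgebra. A nonzero homogeneous component of b E_r can be brought to E_r by left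
    multiplication. Stated for subsets of [A], this serves both for annihilators and for
    submodules. *)
Lemma ideal_simple r (X : set A) :
  X 0 -> (forall a x y, X x -> X y -> X (a * x + y)) ->
  (forall x, X x -> x * e r = x) ->
  (forall x, X x -> exists x0 x1, [/\ X x0, gr false x0, X x1, gr true x1 & x = x0 + x1]) ->
  (exists2 x, X x & x != 0) -> X (e r).
Proof.
move=> X0 XP Xe Xg [x Xx x0].
have XM a y : X y -> X (a * y) by move=> Xy; rewrite -[_ * _]addr0; apply: XP.
have [a ax0] := corner_reach n_gt0 hA (e_fix_eU (Xe _ Xx)) x0.
have [BE _ _ simple _] := mE; have [_ B1 BM] := clifford_sub_subalgebra c (diag_entry U).
have Xz : X (eU * (a * x)) by exact: (XM _ _ (XM _ _ Xx)).
move: ax0 Xz; set z := eU * _ => z0 Xz.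
have [b Bb bE] := corner n_gt0 hA U (a * x).
have zE : z = b * E r * eU.
  transitivity (z * eU * E r); first by rewrite (e_fix_eU (Xe _ Xz)) (e_fix_E (Xe _ Xz)).
  by rewrite [z * eU]bE -[RHS]mulrA E_comm mulrA.
have By : B (b * E r) by apply: BM => //; case: (BE r).
have [y0 [y1 [[By0 g0] [By1 g1] yE]]] := clifford_sub_split t By.
have [z0' [z1' [Xz0 gz0 Xz1 gz1 zzE]]] := Xg _ Xz.
have ge : gr false eU := @ev_e_of _ _ _ t c (existT _ lam U).
have [E0 E1] : y0 * eU = z0' /\ y1 * eU = z1'.
  apply: gr_direct gz0 gz1 _; first exact: (gM (i := false) (j := false)).
    exact: (gM (i := true) (j := false)).
  by rewrite -mulrDl -yE -zE.
have gE : gr false (E r) by case: (BE r).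
have [|F0 F1] := gr_fixed gE g0 g1.
  by rewrite -yE -mulrA; have [_ -> _ _ _] := mE; rewrite eqxx.
have key i y : B y -> gr i y -> y * E r = y -> y != 0 -> X (y * eU) -> X (e r).
  move=> By' gy yr y0' Xy; have [b' _ <-] := simple i r y By' gy y0' yr.
  by rewrite -mulrA; apply: XM.
have [y00|/(key _ _ By0 g0 F0)] := eqVneq y0 0; last by apply; rewrite E0.
apply: (key _ _ By1 g1 F1); last by rewrite E1.
by apply: contraNneq z0 => y10; rewrite zE yE y00 y10 addr0 mul0r.
Qed.

(** A nonzero homogeneous vector fixed by E_r e_U generates the simple module. Its annihilator in
    S_n E_r e_U is graded and does not contain E_r e_U, hence is 0. *)
Lemma simple_generator r (V : lmodType A) (gV : bool -> set V) :
  simple_supermodule gr gV -> (exists v : V, e r *: v != 0) ->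
  exists (v : V) (q : bool), [/\ gV q v, v != 0,
    forall x, x * e r = x -> x *: v = 0 -> x = 0 &
    forall u, exists2 x, x * e r = x & u = x *: v].
Proof.
move=> [sV _ simple] [v' ev'].
have [_ _ gS] := sV.
have [q [v [gv ev]]] : exists q v, gV q v /\ e r *: v != 0.
  have [v0 [v1 [g0 g1 vE]]] := supermodule_split sV v'.
  have [ev0|ev0] := eqVneq (e r *: v0) 0; last by exists false, v0.
  by exists true, v1; split=> //; apply: contraNneq ev' => ev1; rewrite vE scalerDr ev0 ev1 addr0.
have ee : e r * e r = e r by rewrite e_mul eqxx.
exists (e r *: v), q; split=> //.
- exact: (gS false q _ _ (e_even r) gv).
- move=> x xe xv; apply/eqP; apply: contraT => x0.
  pose X := [set y | y * e r = y /\ y *: (e r *: v) = 0].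
  have [] : X (e r); last first.
    by move=> _ /eqP; rewrite scalerA ee (negbTE ev).
  apply: (@ideal_simple r X).
  + by split; rewrite ?mul0r ?scale0r.
  + move=> a y z [ye yv] [ze zv]; split; first by rewrite mulrDl -mulrA ye ze.
    by rewrite scalerDl -scalerA yv zv scaler0 addr0.
  + by move=> y [].
  + move=> y [ye yv]; have [y0 [y1 [g0 g1 yE]]] := gr_split y.
    have [|F0 F1] := gr_fixed (e_even r) g0 g1; first by rewrite -yE.
    have gev : gV q (e r *: v) by exact: (gS false q _ _ (e_even r) gv).
    have h0 := gS _ _ _ _ g0 gev; have h1 := gS _ _ _ _ g1 gev.
    have s0 : y0 *: (e r *: v) + y1 *: (e r *: v) = 0 by rewrite -scalerDl -yE.
    have [z0 z1] : y0 *: (e r *: v) = 0 /\ y1 *: (e r *: v) = 0.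
      case: (q) h0 h1 => /= h0 h1; last exact: (supermodule_direct sV h0 h1 s0).
      by rewrite addrC in s0; have [-> ->] := supermodule_direct sV h1 h0 s0.
    by exists y0, y1.
  + by exists x.
- pose X := [set u | exists x, u = x *: (e r *: v)].
  have gX : graded_submodule gV X.
    split.
    + by exists 0; rewrite scale0r.
    + by move=> a _ _ [x ->] [y ->]; exists (a * x + y); rewrite [RHS]scalerDl -[(a * x) *: _]scalerA.
    + move=> _ [x ->]; have [x0 [x1 [g0 g1 ->]]] := gr_split x.
      have gev : gV q (e r *: v) by exact: (gS false q _ _ (e_even r) gv).
      have h0 := gS _ _ _ _ g0 gev; have h1 := gS _ _ _ _ g1 gev.
      rewrite scalerDl; case: (q) h0 h1 => /= h0 h1.
        exists (x1 *: (e r *: v)), (x0 *: (e r *: v)).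
        by split=> //; [exists x1 | exists x0 | rewrite addrC].
      exists (x0 *: (e r *: v)), (x1 *: (e r *: v)).
      by split=> //; [exists x0 | exists x1].
  have [X0|XT u] := simple X gX.
    have : X (e r *: v) by exists 1; rewrite scale1r.
    by rewrite X0 => /eqP; rewrite (negbTE ev).
  have : X u by rewrite XT.
  case=> x ->; exists (x * e r); first by rewrite -mulrA ee.
  by rewrite -(scalerA x) [e r *: (e r *: v)]scalerA ee.
Qed.

End SimpleIdeal.

(** * The direct sum and the isomorphisms with U^lambda *)

Lemma direct_sum_idempotents (A : nzRingType) (I : finType) (f : I -> A) :
  (forall i j, f i * f j = if i == j then f i else 0) -> \sum_i f i = 1 ->
  direct_sum (fun i => [set a * f i | a in setT] : set A).
Proof.
move=> ff f1 v; exists [ffun i => v * f i]; split.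
  split; first by move=> i; rewrite ffunE; exists v.
  by under eq_bigr do rewrite ffunE; rewrite -mulr_sumr f1 mulr1.
move=> h [hX ->]; apply/ffunP => j; rewrite ffunE mulr_suml (bigD1 j) //= big1 ?addr0.
  by have [a _ <-] := hX j; rewrite -mulrA ff eqxx.
by move=> i ij; have [a _ <-] := hX i; rewrite -mulrA ff (negbTE ij) mulr0.
Qed.

Section Claims.
Variables (R : realType) (n : nat).
Hypothesis n_gt0 : (0 < n)%N.
Variables (A : algType R[i]) (t : 'I_n.-1 -> A) (c : 'I_n -> A).
Hypothesis hA : sergeev_algebra t c.
Local Notation C := R[i].
Local Notation gr := (gA t c).
Let rA := sergeev_algebra_rels hA.
Let cl : clifford_rels c. Proof. by case: rA. Qed.

Variable E : forall lam : spart n, barred_tab lam -> 'I_(2 ^ (len lam)./2) -> A.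
Hypothesis hE : forall (lam : spart n) (U : barred_tab lam),
  clifford_idempotents t c U (E U).

Let mE lam (U : barred_tab lam) : matrix_idempotents t c (diag_entry U) (E U).
Proof. exact: clifford_idempotentsP (hE U). Qed.

Local Notation e U r := (E U r * e_tab t c U).

Lemma ideals_direct_sum :
  direct_sum (fun i : ideal_index n =>
    let: existT lam (U, r) := i in left_ideal (e U r)).
Proof.
pose f (i : ideal_index n) := e (tagged i).1 (tagged i).2.
rewrite (_ : (fun i : ideal_index n => _) =
  (fun i => [set a * f i | a in setT] : set A)); last by apply/funext => -[lam [U r]].
apply: direct_sum_idempotents.
- move=> [l [U r]] [l' [U' r']]; rewrite /f /=.
  have [ll|ll] := eqVneq l l'.
    case: l' / ll U' r' => U' r'; rewrite eq_Tagged /= -pair_eqE /=.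
    have [<-|UU] := eqVneq U U'; first exact: (e_mul n_gt0 hA (mE U)).
    rewrite /= [E U' r' * _](E_comm n_gt0 hA (mE U')) -mulrA [e_tab _ _ U * _]mulrA.
    have := @e_ortho _ _ n_gt0 _ _ _ hA (existT _ l U) (existT _ l U').
    by rewrite eq_Tagged => /(_ UU) ->; rewrite mul0r mulr0.
  rewrite ifN; last by apply: contraNN ll => /eqP/(congr1 tag) /= ->.
  rewrite [E U' r' * _](E_comm n_gt0 hA (mE U')) -mulrA [e_tab _ _ U * _]mulrA.
  have -> : e_tab t c U * e_tab t c U' = 0; last by rewrite mul0r mulr0.
  apply: (@e_ortho _ _ n_gt0 _ _ _ hA (existT _ l U) (existT _ l' U')).
  by apply: contraNN ll => /eqP/(congr1 tag) /= ->.
- transitivity (\sum_(l : spart n) \sum_(q : barred_tab l * 'I_(2 ^ (len l)./2)) e q.1 q.2).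
    by rewrite sig_big_dep; apply: eq_bigr => -[].
  rewrite -(e_sum n_gt0 hA).
  transitivity (\sum_(l : spart n) \sum_(U : barred_tab l) e_tab t c U); last first.
    by rewrite sig_big_dep; apply: eq_bigr => -[].
  apply: eq_bigr => l _; transitivity (\sum_(U : barred_tab l) \sum_r e U r).
    by rewrite pair_bigA; apply: eq_bigr => -[].
  by apply: eq_bigr => U _; rewrite -mulr_suml; have [_ _ -> _ _] := mE U; rewrite mul1r.
Qed.

Section Irreducible.
Variables (lam : spart n) (V : lmodType A) (gV : bool -> set V).

(** The vector E_r c_S v_T of hat U^lambda, where [U] is T barred at S, is nonzero and fixed by E_r
    e_U. So one of its components in the copies of U^lambda is not killed. *)
Lemma is_U_nonzero (U : barred_tab lam) r : is_U t c lam gV -> exists x : V, e U r *: x != 0.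
Proof.
move=> [_ [W [gW [v [[_ _ vfree _ vx] [X [gX dX iso]]]]]]].
have [BE _ _ _ units] := mE U.
pose T := (val U).1; pose y := E U r * cliff_mon c (val U).2.
have [z [_ zS]] := cliff_mon_linv cl (val U).2.
have y0 : y != 0.
  have [b [_ b0 Eb _]] := units r r; apply: contraNneq b0 => yy.
  by rewrite -Eb -[E U r]mulr1 -zS mulrA -/y yy !mul0r.
have [sB B1 BM] := clifford_sub_subalgebra c predT.
have By : clifford_subalgebra c predT y.
  apply: BM; last exact: clifford_sub_mon.
  by have [BEr _] := BE r; apply: clifford_sub_mono BEr.
pose w := y *: v T.
have w0 : w != 0.
  apply: contraNneq y0 => w0.
  have [y1 [_ uniq]] := vfree 0.
  have e1 : y1 = [ffun=> 0].
    apply: uniq; split; first by move=> T'; rewrite ffunE; case: sB.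
    by rewrite big1 // => T' _; rewrite ffunE scale0r.
  have e2 : y1 = [ffun T' => if T' == T then y else 0].
    apply: uniq; split; first by move=> T'; rewrite ffunE; case: ifP => // _; case: sB.
    rewrite (bigD1 T) //= ffunE eqxx -/w w0 add0r big1 // => T' /negbTE T'T.
    by rewrite ffunE T'T scale0r.
  have := congr1 (fun h => fun_of_fin h T) e2.
  by rewrite e1 !ffunE eqxx => <-.
have ew : e U r *: w = w.
  rewrite /w scalerA /y -mulrA (mulrA (e_tab t c U)) -(E_comm n_gt0 hA (mE U)).
  rewrite -[E U r * _ * cliff_mon _ _]mulrA mulrA; have [_ -> _ _ _] := mE U; rewrite eqxx -!scalerA.
  congr (_ *: _).
  have := @e_of_weight _ _ _ t c W (cliff_mon c (val U).2 *: v T)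
    (existT _ lam U) (existT _ lam U).
  by rewrite eqxx; apply; rewrite -index_of_barred; apply: (cliff_mon_weight hA).
have [f [[fX wE] _]] := dX w.
have [i ei] : exists i, e U r *: f i != 0.
  apply/existsP; apply: contraT; rewrite negb_exists => /forallP h.
  case/eqP: w0; rewrite -ew wE scaler_sumr big1 // => i _.
  by apply/eqP; have := h i; rewrite negbK.
have [g [q [gL [_ ginj _] _]]] := iso i; have [X0 XP _] := gX i.
have g0 : g 0 = 0.
  have := gL 1 0 0 X0 X0; rewrite !scale1r addr0 => /eqP.
  by rewrite -subr_eq0 opprD addNKr oppr_eq0 => /eqP.
exists (g (f i)); apply: contraNneq ei => eg.
have := gL (e U r) (f i) 0 (fX i) X0; rewrite addr0 g0 addr0 eg => ge0.
apply/eqP/ginj; rewrite ?inE ?g0 //.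
by rewrite -[_ *: _]addr0; apply: XP.
Qed.

Lemma ideal_iso (U : barred_tab lam) r : simple_supermodule gr gV ->
  (exists x : V, e U r *: x != 0) ->
  super_isomorphic (gr : bool -> set A^o) gV (left_ideal (e U r)) setT.
Proof.
move=> sV ne0; have [v [q [gv v0 inj surj]]] := simple_generator n_gt0 hA (mE U) sV ne0.
have ee : e U r * e U r = e U r by rewrite (e_mul n_gt0 hA (mE U)) eqxx.
have fixP x : left_ideal (e U r) x <-> x * e U r = x.
  by split=> [[a _ <-]|<-]; [rewrite -mulrA ee | exists x].
have [[_ _ gS] _ _] := sV.
exists (fun x : A => x *: v), q; split.
- by move=> a x y _ _; rewrite scalerDl scalerA.
- split=> //.
  + move=> x y; rewrite !inE => /fixP xe /fixP ye xy.
    apply/eqP; rewrite -subr_eq0; apply/eqP/inj; first by rewrite mulrBl xe ye.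
    by rewrite scalerBl xy subrr.
  + by move=> u _; have [x xe ->] := surj u; exists x => //; apply/fixP.
- by move=> i x _ gx; apply: gS.
Qed.

End Irreducible.

End Claims.

(** * Left ideals as graded modules *)

Section Submodule.
Variables (D : nzRingType) (V : lmodType D) (X : set V).
Hypothesis hX : X 0 /\ forall k u v, X u -> X v -> X (k *: u + v).

Definition submodT of X 0 /\ (forall k u v, X u -> X v -> X (k *: u + v)) :=
  {v : V | `[< X v >]}.

HB.instance Definition _ := SubChoice.on (submodT hX).

Lemma submodT_closed : GRing.subsemimod_closed (fun a : V => `[< X a >]).
Proof.
have [X0 XL] := hX.
have E a : (a \in (fun a : V => `[< X a >])) = `[< X a >] by [].
split; first split.
- by rewrite E; apply/asboolP.
- move=> a b; rewrite !E => /asboolP Xa /asboolP Xb; apply/asboolP.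
  by have := XL 1 _ _ Xa Xb; rewrite scale1r.
- move=> k a; rewrite !E => /asboolP Xa; apply/asboolP.
  by have := XL k _ _ Xa X0; rewrite addr0.
Qed.

HB.instance Definition _ :=
  GRing.SubChoice_isSubLmodule.Build D V _ (submodT hX) submodT_closed.

Lemma submodTP (x : submodT hX) : X (val x).
Proof. exact/asboolP/(valP x). Qed.

Definition in_submod (v : V) (Xv : X v) : submodT hX := exist _ v (introT (asboolP _) Xv).

End Submodule.

Section FixedIdeal.
Variables (R : realType) (n : nat).
Variables (A : algType R[i]) (t : 'I_n.-1 -> A) (c : 'I_n -> A).
Hypothesis hA : sergeev_algebra t c.
Local Notation C := R[i].
Local Notation gr := (gA t c).
Variable f : A.
Hypothesis f_even : gr false f.

Lemma fixed_closed : [set x : A^o | (x : A) * f = x] 0 /\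
  forall (k : A) u v, [set x : A^o | (x : A) * f = x] u ->
    [set x : A^o | (x : A) * f = x] v -> [set x : A^o | (x : A) * f = x] (k *: u + v).
Proof.
split; first by rewrite /= mul0r.
by move=> k u v /= hu hv; rewrite mulrDl -mulrA hu hv.
Qed.

(* As a left ideal, A f when f is idempotent. *)
Definition fixed_ideal : lmodType A := submodT fixed_closed.

Definition fixed_val (x : fixed_ideal) : A := val x.

Definition fixed_in (x : A) (xf : x * f = x) : fixed_ideal := @in_submod A A^o _ fixed_closed x xf.

Lemma fixed_inK x (xf : x * f = x) : fixed_val (fixed_in xf) = x.
Proof. by []. Qed.

Lemma fixed_valE (x : fixed_ideal) : fixed_val x * f = fixed_val x.
Proof. exact: (@submodTP A A^o _ fixed_closed x). Qed.

Lemma fixed_val_inj x y : fixed_val x = fixed_val y -> x = y.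
Proof. exact: val_inj. Qed.

Lemma fixed_val0 : fixed_val 0 = 0. Proof. by []. Qed.
Lemma fixed_valD x y : fixed_val (x + y) = fixed_val x + fixed_val y. Proof. by []. Qed.
Lemma fixed_valZ a x : fixed_val (a *: x) = a * fixed_val x. Proof. by []. Qed.

Lemma fixed_val_sum (I : finType) (F : I -> fixed_ideal) :
  fixed_val (\sum_i F i) = \sum_i fixed_val (F i).
Proof. by apply: (big_morph fixed_val fixed_valD). Qed.

Definition fixed_gr (i : bool) : set fixed_ideal := [set x | gr i (fixed_val x)].

Lemma fixed_split (x : fixed_ideal) : exists x0 x1,
  [/\ fixed_gr false x0, fixed_gr true x1 & x = x0 + x1].
Proof.
have [a0 [a1 [g0 g1 aE]]] := gr_split hA (fixed_val x).
have [|F0 F1] := gr_fixed hA f_even g0 g1; first by rewrite -aE fixed_valE.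
exists (fixed_in F0), (fixed_in F1); split=> //.
by apply: fixed_val_inj; rewrite fixed_valD !fixed_inK.
Qed.

Lemma fixed_supermodule : supermodule gr fixed_gr.
Proof.
have sg i : subspace (gr i) := parity_subspace _ i.
split.
- move=> i; split; first by case: (sg i).
  move=> k u v gu gv; rewrite /fixed_gr /= fixed_valD fixed_valZ -scalerAl mul1r.
  by case: (sg i) => _; apply.
- move=> x; have [x0 [x1 [g0 g1 xE]]] := fixed_split x.
  exists [ffun i : bool => if i then x1 else x0]; split.
    split; first by case; rewrite ffunE.
    by rewrite big_bool /= !ffunE addrC.
  move=> h [gh hE].
  have xh : fixed_val x0 + fixed_val x1 = fixed_val (h false) + fixed_val (h true).
    by rewrite -!fixed_valD -xE hE big_bool /= addrC.
  have [h0 h1] := gr_direct hA g0 g1 (gh false) (gh true) xh.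
  by apply/ffunP; case; rewrite ffunE; apply: fixed_val_inj.
- by move=> i j a v ga gv; apply: parityM.
Qed.

End FixedIdeal.

(** * Existence of U^lambda *)

Section SimpleModuleExists.
Variables (R : realType) (n : nat).
Hypothesis n_gt0 : (0 < n)%N.
Variables (A : algType R[i]) (t : 'I_n.-1 -> A) (c : 'I_n -> A).
Hypothesis hA : sergeev_algebra t c.
Local Notation C := R[i].
Local Notation gr := (gA t c).
Variable lam : spart n.

Section Uhat.
Variables (U : barred_tab lam).
Hypothesis U_unbarred : (val U).2 = finset.set0.
Local Notation eU := (e_tab t c U).
Local Notation w := (wvec n_gt0 hA U).
Local Notation v0 := (mvec n_gt0 hA (lam := lam)).

Let e_ev : gr false eU := @ev_e_of _ _ _ t c (existT _ lam U).
Local Notation W := (fixed_ideal eU).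

(** The model was built without a grading, whereas S_n e_U inherits one from S_n. For unbarred [U]
    the map x |-> x w_U identifies the two, and even transitions make the vectors v_T even. *)
Lemma Uhat_exists : exists v : std_tab lam -> W, is_Uhat t c (fixed_gr t c (f := eU)) v.
Proof.
have [span free cv xv] := mvecP n_gt0 hA lam.
have h T : exists psi : A, gr false psi /\ psi *: w = v0 T.
  have [psi evp <-] := even_transition (val U).1 T (mvecP n_gt0 hA lam).
  by exists psi; split=> //; rewrite /wvec U_unbarred cliff_mon0 scale1r.
have [psi psiP] := choice h.
have psiE T : psi T *: w = v0 T by case: (psiP T).
have fx a : a * eU * eU = a * eU by rewrite -mulrA (e_idem n_gt0 hA).
pose v T : W := fixed_in (fx (psi T)).
have vE T : fixed_val (v T) = psi T * eU by [].
exists v; split.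
- exact: (fixed_supermodule hA e_ev).
- by move=> T; have [evp _] := psiP T; apply: (@parityM _ _ _ _ false false).
- move=> x; have [k kE] := span (fixed_val x *: w).
  exists [ffun T => \sum_S k T S *: cliff_mon c S]; split.
    split=> [T|].
      rewrite ffunE; have [sB _ _] := clifford_sub_subalgebra c predT.
      refine (@subspace_sum _ _ _ _ _ _ _ sB (fun S _ => subspaceZ _ sB _)).
      exact: clifford_sub_mon.
    apply: fixed_val_inj; rewrite fixed_val_sum -(fixed_valE x).
    transitivity ((\sum_T (\sum_S k T S *: cliff_mon c S) * psi T) * eU).
      apply: wvec_eq; rewrite kE scaler_suml; apply: eq_bigr => T _.
      by rewrite -scalerA psiE.
    by rewrite mulr_suml; apply: eq_bigr => T _; rewrite fixed_valZ vE mulrA ffunE.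
  move=> y [yB xE].
  have hk T : exists k' : {set 'I_n} -> C, y T = \sum_S k' S *: cliff_mon c S.
    exact: (clifford_sub_coef hA (yB T)).
  have [k' k'E] := choice hk.
  have xw : fixed_val x *: w = \sum_T (\sum_S k' T S *: cliff_mon c S) *: v0 T.
    rewrite xE fixed_val_sum scaler_suml; apply: eq_bigr => T _.
    by rewrite fixed_valZ vE -!scalerA (e_wvecE n_gt0 hA) psiE k'E.
  have kk T S : k T S = k' T S.
    apply/eqP; rewrite -subr_eq0; apply/eqP.
    apply: (free (fun T S => k T S - k' T S)).
    apply/eqP; have := xw; rewrite kE => /eqP; rewrite -subr_eq0 -sumrB.
    apply: etrans; congr (_ == _); apply: eq_bigr => T' _; rewrite -scalerBl -sumrB.
    by congr (_ *: _); apply: eq_bigr => S' _; rewrite scalerBl.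
  by apply/ffunP => T; rewrite ffunE k'E; apply: eq_bigr => S _; rewrite kk.
- move=> T a u u'.
  pose z := oapp psi 0 (insub (swap_entries (val T) a)).
  have zE : fixed_val (oapp v 0 (insub (swap_entries (val T) a))) = z * eU.
    by rewrite /z; case: insubP => [T' _ _|_] /=; rewrite ?mul0r.
  have zw : z *: w = oapp v0 0 (insub (swap_entries (val T) a)).
    by rewrite /z; case: insubP => [T' _ _|_] /=; rewrite ?scale0r.
  apply: fixed_val_inj; rewrite fixed_valD !fixed_valZ zE vE !mulrA -mulrDl.
  apply: wvec_eq; rewrite [RHS]scalerDl -!(scalerA _ (psi T)) -(scalerA _ z) psiE zw.
  exact: cv.
- move=> T a; apply: fixed_val_inj; rewrite !fixed_valZ vE !mulrA.
  by apply: wvec_eq; rewrite -!scalerA psiE xv.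
Qed.

Variable E : 'I_(2 ^ (len lam)./2) -> A.
Hypothesis mE : matrix_idempotents t c (diag_entry U) E.
Local Notation e r := (E r * eU).
Let ee r : gr false (e r) := e_even mE r.

Lemma e_neq0 r : e r != 0.
Proof.
have [BE _ _ _ units] := mE; have [b [_ b0 Eb _]] := units r r.
apply: contraNneq b0 => er0; rewrite -Eb (_ : E r = 0) ?mul0r //.
by have [Br _] := BE r; exact: (clifford_mul_e_eq0 n_gt0 hA Br er0).
Qed.

Lemma fixed_ideal_simple r : simple_supermodule gr (fixed_gr t c (f := e r)).
Proof.
have err : e r * e r = e r by rewrite (e_mul n_gt0 hA mE) eqxx.
split.
- exact: (fixed_supermodule hA (ee r)).
- exists (fixed_in err); apply: contraNneq (e_neq0 r) => x0.
  by rewrite -[e r](fixed_inK err) x0.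
- move=> X [X0 XP Xg].
  have [[x [Xx x0]]|nX] := pselect (exists x, X x /\ x != 0).
    right; apply/seteqP; split=> // y _.
    pose Y : set A := [set a | exists2 x, X x & fixed_val x = a].
    have [z Xz zE] : Y (e r).
      apply: (ideal_simple n_gt0 hA mE (X := Y)).
      - by exists 0.
      - move=> a _ _ [x1 X1 <-] [x2 X2 <-]; exists (a *: x1 + x2) => //; exact: XP.
      - by move=> _ [x1 _ <-]; rewrite fixed_valE.
      - move=> _ [x1 /Xg[y0 [y1 [Xy0 g0 Xy1 g1 ->]]] <-].
        exists (fixed_val y0), (fixed_val y1); split=> //; by [exists y0 | exists y1].
      - exists (fixed_val x); first by exists x.
        by apply: contraNneq x0 => x0; apply/eqP/fixed_val_inj.
    have -> : y = fixed_val y *: z + 0.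
      by apply: fixed_val_inj; rewrite addr0 fixed_valZ zE fixed_valE.
    exact: XP.
  left; apply/seteqP; split=> [x Xx|_ ->] //=.
  by apply/eqP; apply: contrapT => /negP x0; apply: nX; exists x.
Qed.

(** S_n e_U is the direct sum of the S_n E_r e_U, which are all isomorphic to the one for [r0]. *)
Lemma fixed_ideal_is_U r0 : is_U t c lam (fixed_gr t c (f := e r0)).
Proof.
have [BE _ Esum _ units] := mE.
split; first exact: fixed_ideal_simple.
have [v vP] := Uhat_exists; exists W, (fixed_gr t c (f := eU)), v; split=> //.
have eeU r : e r * eU = e r by rewrite -mulrA (e_idem n_gt0 hA).
have em r s : e r * e s = if r == s then e r else 0 := e_mul n_gt0 hA mE r s.
have fe x r : x * e r * eU = x * e r by rewrite -mulrA eeU.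
exists (fun r => [set x : W | fixed_val x * e r = fixed_val x]); split.
- move=> r; split.
  + by rewrite /= fixed_val0 mul0r.
  + move=> a x y /= xe ye; rewrite fixed_valD fixed_valZ mulrDl -mulrA xe ye //.
  + move=> x /= xe; have [x0 [x1 [g0 g1 xE]]] := fixed_split hA e_ev x.
    have [|F0 F1] := gr_fixed hA (ee r) g0 g1; first by rewrite -fixed_valD -xE.
    by exists x0, x1.
- move=> x; exists [ffun r => fixed_in (fe (fixed_val x) r)]; split.
    split; first by move=> r; rewrite ffunE /= fixed_inK -mulrA em eqxx.
    apply: fixed_val_inj; rewrite fixed_val_sum -[LHS]fixed_valE.
    transitivity (fixed_val x * \sum_r e r).
      by rewrite -mulr_suml Esum mul1r.
    by rewrite mulr_sumr; apply: eq_bigr => r _; rewrite ffunE fixed_inK.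
  move=> f [fX ->]; apply/ffunP => r; rewrite ffunE; apply: fixed_val_inj.
  rewrite fixed_inK fixed_val_sum mulr_suml (bigD1 r) //= big1 ?addr0; first exact: fX.
  by move=> s sr; rewrite -(fX s) -mulrA em (negbTE sr) mulr0.
(* The matrix unit [b] at position (r, r0) gives a nonzero vector of S_n E_r0 e_U fixed by E_r e_U,
   so [simple_generator] applies. *)
- move=> r; have [b [Bb b0 Eb bE]] := units r r0.
  have bc := diag_clifford_comm n_gt0 hA Bb.
  have bf : b * eU * e r0 = b * eU.
    by rewrite (E_comm n_gt0 hA mE) -mulrA (mulrA eU) (e_idem n_gt0 hA) -(E_comm n_gt0 hA mE) mulrA bE.
  have ne0 : e r *: fixed_in bf != 0.
    apply: contraNneq b0 => /(congr1 (@fixed_val _ _ _)).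
    rewrite fixed_valZ fixed_inK fixed_val0 bc -mulrA (mulrA eU) (e_idem n_gt0 hA) -bc mulrA Eb.
    by move=> be0; apply/eqP; apply: (clifford_mul_e_eq0 n_gt0 hA Bb be0).
  have ne : exists x : fixed_ideal (e r0), e r *: x != 0 by exists (fixed_in bf).
  have [u [q [gu u0 inj surj]]] := simple_generator n_gt0 hA mE (fixed_ideal_simple r0) ne.
  exists (fun x => fixed_val x *: u), q; split.
  + by move=> a x y _ _; rewrite fixed_valD fixed_valZ scalerDl scalerA.
  + split=> //.
    * move=> x y; rewrite !inE /= => xe ye xy; apply: fixed_val_inj.
      apply/eqP; rewrite -subr_eq0; apply/eqP/inj; first by rewrite mulrBl xe ye.
      by rewrite scalerBl xy subrr.
    * move=> y _; have [x xe ->] := surj y.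
      have xU : x * eU = x by rewrite -xe -mulrA eeU.
      by exists (fixed_in xU).
  + have [_ _ gS] := fixed_supermodule hA (ee r0).
    by move=> i x _ gx; apply: gS.
Qed.

End Uhat.

Lemma unbarred_tab_exists : exists U : barred_tab lam, (val U).2 = finset.set0.
Proof.
have [T _] := std_tab_exists n_gt0 lam.
by exists (barred_tab_of T finset.set0); rewrite /= finset.set0D.
Qed.

End SimpleModuleExists.

Local Close Scope classical_set_scope.

Theorem theorem2p3 (R : realType) (n : nat) (hn : (0 < n)%N)
    (A : algType R[i]) (t : 'I_n.-1 -> A) (c : 'I_n -> A)
    (hA : sergeev_algebra t c)
    (E : forall lam : spart n, barred_tab lam -> 'I_(2 ^ (len lam)./2) -> A)
    (hE : forall (lam : spart n) (U : barred_tab lam),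
       clifford_idempotents t c U (E lam U)) :
  [/\ direct_sum (fun i : ideal_index n =>
        let: existT lam (U, r) := i in
        left_ideal (E lam U r * e_tab t c U)),
      forall lam : spart n,
        exists (V : lmodType A) (gV : bool -> set V), is_U t c lam gV &
      forall (lam : spart n) (V : lmodType A) (gV : bool -> set V),
        is_U t c lam gV ->
        forall (U : barred_tab lam) (r : 'I_(2 ^ (len lam)./2)),
          super_isomorphic (gA t c : bool -> set A^o) gV
            (left_ideal (E lam U r * e_tab t c U)) setT].
Proof.
split.
- exact: (ideals_direct_sum hn hA hE).
(* Existence of U^lambda, which keeps the isomorphism clause from being vacuous. *)
- move=> lam; have [U U0] := unbarred_tab_exists hn lam.
  have r0 : 'I_(2 ^ (len lam)./2) := Ordinal (expn_gt0 2 _).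
  exists (fixed_ideal (E lam U r0 * e_tab t c U)).
  exists (fixed_gr t c (f := E lam U r0 * e_tab t c U)).
  exact: (fixed_ideal_is_U hn hA U0 (clifford_idempotentsP (hE lam U))).
- move=> lam V gV VU U r; apply: (ideal_iso hn hA hE); first by case: VU.
  exact: (is_U_nonzero hn hA hE U r VU).
Qed.
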